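(* Let $r=(L+1)^2$ with $L\ge 1$ an integer, let $k=\left\lfloor\frac{\sqrt r}{\log r}\right\rfloor$, and let $\omega_N$ be the random set of $N=kr$ points of $\mathbb{S}^3$ obtained by drawing $r$ points from the Harmonic ensemble on $\mathbb{S}^2$ and taking, on the Hopf fibre over each of them, a set of $k$ roots of unity (with random phase). Then, as $N\to\infty$ (equivalently $L\to\infty$), $$ \mathbb{E}\left[E_0(\omega_N)\right] = -\frac{N^2}{4} -\frac{1}{3}N\log N +\frac{2}{3}N\log\log N +\mathcal{O}(N). $$
   Context: Logarithmic energy: for $\omega_N=\{x_1,\dots,x_N\}\subset\mathbb{S}^3\subset\mathbb{R}^4$, $E_0(\omega_N)=\sum_{i\neq j}\log\frac{1}{\|x_i-x_j\|}$, the sum being over ordered pairs $(i,j)$, $1\le i,j\le N$, $i\ne j$, with $\|\cdot\|$ the Euclidean norm. Hopf fibration: $h:\mathbb{S}^3\to\mathbb{S}^2$, $h(a,b,c,d)=(a^2+b^2-c^2-d^2,\,2(ad+bc),\,2(bd-ac))$. For each $y\in\mathbb{S}^2$ the fibre $h^{-1}(y)$ is a great circle of $\mathbb{S}^3$. Lifting: given $y_1,\dots,y_r\in\mathbb{S}^2$, for each $i$ one takes $k$ equally spaced points on the great circle $h^{-1}(y_i)$ (a copy of the $k$-th roots of unity) rotated along the circle by a random angle uniform in $[0,2\pi)$; the rotations are independent of each other and of the base points. Harmonic ensemble: the determinantal point process of $r=(L+1)^2$ points on $\mathbb{S}^2$, with respect to surface measure $\sigma$ ($\sigma(\mathbb{S}^2)=4\pi$),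 whose kernel is the reproducing kernel of the space of spherical harmonics of degree at most $L$, namely $K_L(x,y)=\frac{1}{4\pi}\sum_{\ell=0}^{L}(2\ell+1)P_\ell(\langle x,y\rangle)=\frac{L+1}{4\pi}P_L^{(1,0)}(\langle x,y\rangle)$, where $P_\ell$ is the Legendre polynomial and $P_L^{(1,0)}$ the Jacobi polynomial. That is, its $m$-point intensity functions are $\rho_m(x_1,\dots,x_m)=\det(K_L(x_i,x_j))_{1\le i,j\le m}$. *)

(* Defs.v *)
From HB Require Import structures.
From mathcomp Require Import all_boot all_order all_algebra.
From mathcomp Require Import all_classical all_reals all_analysis.
From mathcomp Require Import measurable_realfun.
From mathcomp Require Import ring.
Import Order.TTheory GRing.Theory Num.Theory.
Import numFieldNormedType.Exports.

Set Implicit Arguments.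
Unset Strict Implicit.
Unset Printing Implicit Defensive.

Local Open Scope classical_set_scope.
Local Open Scope ring_scope.

(* R^n is [n.-tuple R]: its library sigma-algebra is the product one, i.e. the
   Borel sigma-algebra.  The spheres are subsets of R^3 and R^4. *)
Section Euclidean.
Context {R : realType} {n : nat}.
Implicit Types x y : n.-tuple R.

Definition dot x y : R := \sum_(i < n) tnth x i * tnth y i.

Definition euclidean_dist x y : R :=
  Num.sqrt (\sum_(i < n) (tnth x i - tnth y i) ^+ 2).

Definition unit_sphere : set (n.-tuple R) := [set x | dot x x = 1].

(* The sum is over ordered pairs of distinct indices.  The value is the
   logarithmic energy when the points are pairwise distinct; coincident points
   contribute [ln 0^-1 = 0] instead of +oo. *)
Definition log_energy (I : finType) (x : I -> n.-tuple R) : R :=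
  \sum_(i : I) \sum_(j : I | j != i) ln (1 / euclidean_dist (x i) (x j)).

End Euclidean.
Arguments unit_sphere {R} n.

Section Hopf.
Context {R : realType}.
Implicit Types p : 4.-tuple R.

Definition hopf p : 3.-tuple R :=
  [tuple p`_0 ^+ 2 + p`_1 ^+ 2 - p`_2 ^+ 2 - p`_3 ^+ 2;
         2 * (p`_0 * p`_3 + p`_1 * p`_2);
         2 * (p`_1 * p`_3 - p`_0 * p`_2)].

(* With p = (z1, z2) in C^2 this is (e^{it} z1, e^{-it} z2), that is
   cos t * p + sin t * Jp with Jp = (-p1, p0, p3, -p2) a unit vector orthogonal
   to p: for p on the sphere, t |-> fibre_rot t p is the unit-speed
   parametrization of the great circle hopf^-1(hopf p). *)
Definition fibre_rot (t : R) p : 4.-tuple R :=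
  [tuple cos t * p`_0 - sin t * p`_1;
         cos t * p`_1 + sin t * p`_0;
         cos t * p`_2 + sin t * p`_3;
         cos t * p`_3 - sin t * p`_2].

Lemma unit_sphere_fibre_rot t p :
  unit_sphere 4 p -> unit_sphere 4 (fibre_rot t p).
Proof.
rewrite /unit_sphere /= /dot !big_ord_recl !big_ord0 !(tnth_nth 0) /= => p1.
have h := cos2Dsin2 t.
transitivity ((cos t ^+ 2 + sin t ^+ 2) *
  (p`_0 * p`_0 + (p`_1 * p`_1 + (p`_2 * p`_2 + (p`_3 * p`_3 + 0))))).
  by ring.
by rewrite h p1 mul1r.
Qed.

Lemma hopf_fibre_rot t p : hopf (fibre_rot t p) = hopf p.
Proof.
have h := cos2Dsin2 t.
apply: val_inj; rewrite /=.
congr [:: _; _; _].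
- by rewrite -[RHS]mul1r -h; ring.
- by rewrite -[RHS]mul1r -h; ring.
- by rewrite -[RHS]mul1r -h; ring.
Qed.

(* A measurable choice of an origin on each fibre, from which the phases are
   measured. *)
Definition hopf_section (s : 3.-tuple R -> 4.-tuple R) : Prop :=
  measurable_fun (unit_sphere 3) s /\
  forall y, unit_sphere 3 y -> unit_sphere 4 (s y) /\ hopf (s y) = y.

(* The r * k points obtained from y_1, ..., y_r: k equally spaced points on the
   fibre over each y_i, with phase t_i. *)
Definition hopf_lift (s : 3.-tuple R -> 4.-tuple R) (r k : nat)
    (y : 'I_r -> 3.-tuple R) (t : 'I_r -> R) (ij : 'I_r * 'I_k) : 4.-tuple R :=
  fibre_rot (t ij.1 + 2 * pi * (ij.2)%:R / k%:R) (s (y ij.1)).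

End Hopf.

Section SurfaceMeasure.
Context {R : realType}.
Local Notation mu := (@lebesgue_measure R).

Definition spherical (p : R * R) : 3.-tuple R :=
  [tuple sin p.1 * cos p.2; sin p.1 * sin p.2; cos p.1].

Definition spherical_dom : set (R * R) := `[0, pi] `*` `[0, 2 * pi].

(* Surface measure of the unit sphere of R^3, as a measure on R^3: the area
   element is sin(p.1) dp.1 dp.2 in spherical coordinates. *)
Definition surface_measure (A : set (3.-tuple R)) : \bar R :=
  (\int[mu \x mu]_(p in spherical_dom `&` spherical @^-1` A) (sin p.1)%:E)%E.

Let measurable_spherical : measurable_fun setT spherical.
Proof.
have msin : measurable_fun setT (@sin R).
  by apply: continuous_measurable_fun; exact: continuous_sin.
have mcos : measurable_fun setT (@cos R).
  by apply: continuous_measurable_fun; exact: continuous_cos.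
have m1 (f : R -> R) : measurable_fun setT f ->
    measurable_fun setT (fun p : R * R => f p.1).
  by move=> mf; exact: measurableT_comp.
have m2 (f : R -> R) : measurable_fun setT f ->
    measurable_fun setT (fun p : R * R => f p.2).
  by move=> mf; exact: measurableT_comp.
apply: measurable_cons; first by apply: measurable_funM; [exact: m1|exact: m2].
apply: measurable_cons; first by apply: measurable_funM; [exact: m1|exact: m2].
apply: measurable_cons; first exact: m1.
exact: measurable_cst.
Qed.

Let surface_measure0 : surface_measure set0 = 0%E.
Proof. by rewrite /surface_measure preimage_set0 setI0 integral_set0. Qed.

Let sin_dom_ge0 p : spherical_dom p -> (0 <= (sin p.1)%:E :> \bar R)%E.
Proof.
case=> p0pi _; rewrite lee_fin; apply: sin_ge0_pi.
by move: p0pi; rewrite /= in_itv.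
Qed.

Let surface_measure_ge0 A : (0 <= surface_measure A)%E.
Proof. by apply: integral_ge0 => p [/sin_dom_ge0]. Qed.

Let surface_measure_sigma_additive : semi_sigma_additive surface_measure.
Proof.
move=> /= F mF tF mUF; rewrite /surface_measure; apply: cvg_toP.
  apply: ereal_nondecreasing_is_cvgn => m n mn.
  apply: lee_sum_nneg_natr => // k _ _.
  exact: surface_measure_ge0.
rewrite preimage_bigcup setI_bigcupr ge0_integral_bigcup//=.
- move=> k; apply: measurableI; first exact: measurableX.
  by rewrite -[X in measurable X]setTI; exact: measurable_spherical.
- apply: measurable_funTS; apply: measurableT_comp => //.
  apply: measurableT_comp => //.
  by apply: continuous_measurable_fun; exact: continuous_sin.
- by move=> p [k _ [/sin_dom_ge0]].
- apply/trivIsetP => i j _ _ ij; rewrite setIACA -preimage_setI.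
  by move/trivIsetP : tF => ->//; rewrite preimage_set0 setI0.
Qed.

HB.instance Definition _ := isMeasure.Build _ _ _ surface_measure
  surface_measure0 surface_measure_ge0 surface_measure_sigma_additive.

End SurfaceMeasure.

Section PointProcess.
Context {R : realType} {d d' : measure_display} {T : measurableType d}
  {E : measurableType d'}.

(* For f >= 0 this is the integral of f against the m-fold product measure. *)
Fixpoint iterated_integral (mu : {measure set E -> \bar R}) (m : nat) :
    (m.-tuple E -> \bar R) -> \bar R :=
  if m is m'.+1 then fun f =>
    (\int[mu]_x iterated_integral mu (fun t : m'.-tuple E => f [tuple of x :: t]))%E
  else fun f => f [tuple].

(* A process of n points is given by a labelling X_1, ..., X_n.  [rho m] is the
   m-point intensity function with respect to mu when it is the density of the
   m-th factorial moment measure: for every measurable B in E^m, the expected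
   number of m-tuples of points with distinct labels that lie in B is the
   integral of [rho m] over B. *)
Definition joint_intensities (P : probability T R) (n : nat)
    (X : 'I_n -> {RV P >-> E}) (mu : {measure set E -> \bar R})
    (rho : forall m, m.-tuple E -> R) : Prop :=
  forall (m : nat) (B : set (m.-tuple E)), measurable B ->
    'E_P[fun w => (\sum_(u : {ffun 'I_m -> 'I_n} | injectiveb u)
                     \1_B [tuple X (u j) w | j < m])%R]%E =
    iterated_integral mu (fun x => (\1_B x * rho m x)%:E).

Definition determinantal (P : probability T R) (n : nat)
    (X : 'I_n -> {RV P >-> E}) (mu : {measure set E -> \bar R})
    (K : E -> E -> R) : Prop :=
  joint_intensities X mu
    (fun m x => \det (\matrix_(i < m, j < m) K (tnth x i) (tnth x j))).

End PointProcess.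

Section Harmonic.
Context {R : realType}.

(* Rodrigues' formula *)
Definition legendre (l : nat) : {poly R} :=
  (2 ^+ l * l`!%:R)^-1 *: (('X ^+ 2 - 1) ^+ l)^`(l).

Definition harmonic_kernel (L : nat) (x y : 3.-tuple R) : R :=
  (4 * pi)^-1 * \sum_(l < L.+1) (l.*2.+1)%:R * (legendre l).[dot x y].

Definition harmonic_ensemble (d : measure_display) (T : measurableType d)
    (P : probability T R) (L : nat)
    (Y : 'I_(L.+1 ^ 2) -> {RV P >-> 3.-tuple R}) : Prop :=
  (forall i w, unit_sphere 3 (Y i w)) /\
  determinantal Y surface_measure (harmonic_kernel L).

Lemma twopi_gt0 : 0 < 2 * pi :> R.
Proof. by rewrite mulr_gt0 // pi_gt0. Qed.

(* Each phase is uniform on an interval of length 2 pi, and the phases and the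
   vector (Y_1, ..., Y_r) are mutually independent (taking some of the B_i or A
   to be the whole space gives the product rule for subfamilies). *)
Definition random_phases (d : measure_display) (T : measurableType d)
    (P : probability T R) (r : nat) (Y : 'I_r -> {RV P >-> 3.-tuple R})
    (theta : 'I_r -> {RV P >-> R}) : Prop :=
  (forall i (B : set R), measurable B ->
     distribution P (theta i) B = uniform_prob twopi_gt0 B) /\
  (forall (A : set (r.-tuple (3.-tuple R))) (B : 'I_r -> set R),
     measurable A -> (forall i, measurable (B i)) ->
     P ([set w | A [tuple Y i w | i < r]] `&`
        [set w | forall i, B i (theta i w)]) =
     (P [set w | A [tuple Y i w | i < r]] *
      \prod_(i < r) P (theta i @^-1` B i))%E).

End Harmonic.

Definition roots_per_fibre (R : realType) (r : nat) : nat :=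
  Num.truncn (Num.sqrt r%:R / ln r%:R : R).

(* Main.v *)
Require Import Defs.
From HB Require Import structures.
From mathcomp Require Import all_boot all_order all_algebra.
From mathcomp Require Import all_classical all_reals all_analysis.
From mathcomp Require Import measurable_realfun.
From mathcomp Require Import ring lra.
From mathcomp Require polyrcf complex.
Import Order.TTheory GRing.Theory Num.Theory.
Import numFieldNormedType.Exports.

(* Write n = L + 1, r = n^2 and Q = sum_(l <= L) (2l+1) P_l, so that the kernel is
   Q / (4 pi).  The k points of one fibre contribute - k ln k, because the chords
   from one k-th root of unity to the others have product k.  For points p, q on
   different fibres the squared distance is 2 - 2 a cos t - 2 b sin t in the
   relative phase t, with a^2 + b^2 = (1 + u) / 2 where u is the scalar product of
   the base points.  Since ln |1 - c z| has mean zero over |z| = 1 when |c| < 1,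
   the phase average of ln (1 / |p - q|) is - ln (1 + x) / 2 with
   x = sqrt ((1 - u) / 2).  The two-point intensity
   (n^4 - Q(u)^2) / (16 pi^2) of the ensemble and zonal integration then give
     E[E_0] = - N^2 / 4 - N ln k + k^2 J,
     J = int_0^1 Q(1 - 2x^2)^2 x ln (1 + x) dx <= int_0^1 Q(1 - 2x^2)^2 x^2 dx.
   The last integral is O(n ln n): the differential equation of Q(1 - 2x^2) yields
   an increasing quadratic form, hence x^3 Q(1 - 2x^2)^2 = O(n) for x >= 1/n, and
   int_0^1 Q(1 - 2x^2)^2 x dx = n^2 / 2 controls the range x < 1/n.  As
   k ~ n / (2 ln n), k^2 J = O(N) and ln k = (1/3) ln N - (2/3) ln ln N + O(1). *)

Set Implicit Arguments.
Unset Strict Implicit.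
Unset Printing Implicit Defensive.

Local Open Scope classical_set_scope.
Local Open Scope ring_scope.

(** * The kernel polynomial Q and its second moment *)

(** The logarithm is singular at coincident points, and the intensity is nonnegative only on the
    sphere. Every pair term is therefore shifted by ln 2, the largest value of the logarithm of a
    chord: the shifted terms are nonnegative, sums and expectations go through Tonelli, and the
    shift is subtracted at the end, which also yields integrability. The surface measure is given in
    spherical coordinates. Instead of its rotation invariance, the proof differentiates a zonal
    integral in the polar angle of the pole; the derivative of the integrand is a divergence. The
    mean value property of ln |1 - c z| is obtained in the same way, by differentiating in a
    dilation factor. The phase average requires distinct fibres. Coincidences of base points have
    probability zero because the two-point intensity vanishes on the diagonal. For J an upper bound
    is enough, and no asymptotics of Jacobi polynomials enter: the moments of Q(1 - 2x^2)^2 against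
    x and x^3 are exact, and the monotone form turns them into pointwise decay. The choice of k
    balances the error: k^2 n ln n is N times k ln n / n, which is bounded. *)

Section LegendreAlgebra.
Context {R : realType}.
Implicit Types (n : nat) (p q : {poly R}).

(** The polynomial of Rodrigues' formula before its n-fold differentiation. The relations [deriv_v]
    and [vS] between consecutive terms give both recurrences of this section by Leibniz' rule. *)
Let v n : {poly R} := (2 ^+ n * n`!%:R)^-1 *: ('X ^+ 2 - 1) ^+ n.

Let legendreE n : legendre n = (v n)^`(n).
Proof. by rewrite /legendre /v derivnZ. Qed.

Let coef_v n : (2 ^+ n.+1 * (n.+1)`!%:R)^-1 = (2 ^+ n * n`!%:R)^-1 * (2 * n.+1%:R)^-1 :> R.
Proof.
have n0 : n`!%:R != 0 :> R by rewrite pnatr_eq0 -lt0n fact_gt0.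
have nn : n.+1%:R != 0 :> R by rewrite pnatr_eq0.
rewrite factS natrM exprS; field.
by rewrite n0 addrC natr1 nn expf_neq0.
Qed.

Let deriv_v n : (v n.+1)^`() = v n * 'X.
Proof.
rewrite /v derivZ deriv_exp derivB derivXn derivC subr0 /= expr1.
rewrite coef_v -scalerAl -!mul_polyC polyCM -mulrA; congr (_ * _).
have -> : 'X *+ 2 * ('X^2 - 1) ^+ n *+ n.+1 = (2 * n.+1%:R)%:P * (('X^2 - 1) ^+ n * 'X) :> {poly R}.
  by rewrite polyCM !polyC_natr -(mulr_natl (_ *+ 2 * _) n.+1); ring.
rewrite [LHS]mulrA -[in LHS]polyCM mulVf ?mul1r// mulf_neq0 ?pnatr_eq0//.
Qed.

Let vS n : ('X ^+ 2 - 1) * v n = (2 * n.+1%:R) *: v n.+1.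
Proof.
rewrite /v coef_v scalerA mulrCA mulfV ?mulr1 ?mulf_neq0 ?pnatr_eq0//.
by rewrite -scalerAr -exprS.
Qed.

Let leibX m p : (p * 'X)^`(m.+1) = p^`(m) *+ m.+1 + p^`(m.+1) * 'X.
Proof. by have := derivnMXaddC m p 0; rewrite addr0. Qed.

Lemma legendre_derivS n :
  (@legendre R n.+1)^`() = 'X * (legendre n)^`() + n.+1%:R * legendre n.
Proof.
rewrite !legendreE -derivnS derivSn deriv_v leibX -derivnS.
by rewrite mulr_natl addrC mulrC.
Qed.

Lemma legendre_rec n :
  n.+1%:R * @legendre R n.+1 = ('X ^+ 2 - 1) * (legendre n)^`() + n.+1%:R * 'X * legendre n.
Proof.
(* [w] is the Leibniz remainder common to two expansions of [legendre n.+1], from [v n * 'X] and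
   from [('X ^+ 2 - 1) * v n]; eliminating it gives the claim. For n = 0 the factor n makes the
   truncated [n.-1] harmless. *)
set w := (v n)^`(n.-1) *+ n.
have h1 : legendre n.+1 = 'X * legendre n + w.
  rewrite !legendreE derivSn deriv_v /w; case: (n) => [|m].
    by rewrite !derivn0 mulr0n addr0 mulrC.
  by rewrite leibX addrC mulrC.
have h2 : 2 * n.+1%:R * legendre n.+1 = ('X ^+ 2 - 1) * (legendre n)^`() +
    2 * n.+1%:R * 'X * legendre n + n.+1%:R * w.
  have -> : 2 * n.+1%:R * legendre n.+1 = ((2 * n.+1%:R) *: v n.+1)^`(n.+1) :> {poly R}.
    by rewrite derivnZ -legendreE -mul_polyC polyCM !polyC_natr.
  rewrite -vS; have -> : ('X ^+ 2 - 1) * v n = v n * 'X * 'X - v n by ring.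
  rewrite derivnB leibX.
  rewrite legendreE -derivnS leibX.
  have -> : (v n * 'X)^`(n) = w + (v n)^`(n) * 'X.
    rewrite /w; case: (n) => [|m]; first by rewrite !derivn0 mulr0n add0r.
    by rewrite leibX.
  rewrite -(mulr_natl (_ + _) n.+1) -(mulr_natl (_^`(n)) n.+1).
  by ring.
have h3 : n.+1%:R * legendre n.+1 = n.+1%:R * 'X * legendre n + n.+1%:R * w.
  by rewrite h1; ring.
apply: (@addrI _ (n.+1%:R * legendre n.+1)).
transitivity (2 * n.+1%:R * @legendre R n.+1); first by ring.
by rewrite h2 h3; ring.
Qed.

End LegendreAlgebra.

(** * Legendre recurrences and the differential equation of Q *)

Section LegendreRelations.
Context {R : realType}.
Implicit Types (n l L : nat) (p q : {poly R}).

Local Notation P := (@legendre R).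

Lemma legendre0 : P 0 = 1.
Proof. by rewrite /legendre expr0 derivn0 expr0 mul1r fact0 invr1 scale1r. Qed.

Lemma legendre_derivP n :
  (1 - 'X ^+ 2) * (P n.+1)^`() = n.+1%:R * (P n - 'X * P n.+1).
Proof.
have e : n.+1%:R * ('X * P n.+1) = 'X * (n.+1%:R * P n.+1) by ring.
rewrite mulrBr e legendre_rec legendre_derivS; ring.
Qed.

Let subX2_neq0 : 1 - 'X ^+ 2 != 0 :> {poly R}.
Proof.
rewrite -size_poly_eq0 -opprB size_polyN size_XnsubC//.
Qed.

Lemma legendre_deriv_down n :
  (P n)^`() = 'X * (P n.+1)^`() - n.+1%:R * P n.+1.
Proof.
apply: (mulfI subX2_neq0); rewrite mulrBr mulrCA legendre_derivP.
rewrite [in RHS](mulrCA (1 - _)).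
have -> : (1 - 'X ^+ 2) * (P n)^`() = n.+1%:R * 'X * P n - n.+1%:R * P n.+1.
  by rewrite legendre_rec; ring.
ring.
Qed.

Lemma legendre_ode n :
  (1 - 'X ^+ 2) * (P n)^`(2) = 2 * 'X * (P n)^`() - n%:R * n.+1%:R * P n.
Proof.
have h := congr1 (@deriv R) (@legendre_rec R n).
rewrite /= derivM derivD !derivM derivB derivXn derivX derivC subr0 legendre_derivS /= in h.
rewrite -!polyC_natr !derivC in h.
rewrite derivnS derivn1.
have -> : n.+1%:R = 1 + n%:R :> {poly R} by rewrite -natr1 addrC.
rewrite !polyC_natr -natr1 expr1 in h.
apply/eqP; rewrite -subr_eq0; apply/eqP.
move: h => /eqP; rewrite -subr_eq0 => /eqP h.
by rewrite -[RHS]h; ring.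
Qed.

Lemma legendre_horner1 n : (P n).[1] = 1.
Proof.
elim: n => [|n]; first by rewrite legendre0 hornerC.
have := congr1 (horner^~ 1) (@legendre_rec R n); move: (P n.+1) (P n) => p1 p0.
rewrite /= -!polyC_natr !(hornerE, hornerXn) => h ih.
by apply/(@mulfI _ n.+1%:R); [rewrite pnatr_eq0 | rewrite h ih; ring].
Qed.

Lemma legendre_hornerN1 n : (P n).[-1] = (-1) ^+ n.
Proof.
elim: n => [|n]; first by rewrite legendre0 hornerC.
have := congr1 (horner^~ (-1)) (@legendre_rec R n); move: (P n.+1) (P n) => p1 p0.
rewrite /= -!polyC_natr !(hornerE, hornerXn) => h ih.
by apply/(@mulfI _ n.+1%:R); [rewrite pnatr_eq0 | rewrite h ih (exprS _ n); ring].
Qed.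

(** The polynomial Q of the overview, which is L + 1 times the Jacobi polynomial P_L^(1,0). *)
Definition legendre_sum L : {poly R} := \sum_(l < L.+1) (l.*2.+1)%:R *: P l.

(** Telescoping: subtracting [legendre_deriv_down] from [legendre_derivS] gives P_{l+1}' - P_{l-1}'
    = (2l + 1) P_l. *)
Lemma legendre_sumE L : legendre_sum L = (P L.+1)^`() + (P L)^`().
Proof.
elim: L => [|L ih].
  rewrite /legendre_sum big_ord1 legendre_derivS legendre0 -polyC1 derivC.
  by rewrite scale1r mulr0 mulr1 add0r addr0.
rewrite /legendre_sum big_ord_recr /= -/(legendre_sum L) ih (legendre_derivS L.+1).
rewrite [(P L)^`()]legendre_deriv_down -mul_polyC polyC_natr.
have -> : (L.+1.*2.+1)%:R = 1 + 2 * L.+1%:R :> {poly R}.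
  by rewrite -addn1 -muln2 natrD natrM; ring.
have -> : L.+2%:R = 1 + L.+1%:R :> {poly R} by rewrite -natr1 addrC.
ring.
Qed.

Lemma deriv_legendreD L : (P L.+1 + P L)^`() = legendre_sum L.
Proof. by rewrite derivD legendre_sumE. Qed.

Lemma legendre_sum_christoffel_darboux L :
  (1 - 'X) * legendre_sum L = - (L.+1%:R * (P L.+1 - P L)).
Proof.
have X0 : 1 + 'X != 0 :> {poly R} by rewrite addrC -polyC1 -size_poly_eq0 size_XaddC.
apply: (mulfI X0); rewrite mulrA legendre_sumE.
have e : (1 - 'X ^+ 2) * (P L)^`() = L.+1%:R * 'X * P L - L.+1%:R * P L.+1.
  by rewrite legendre_rec; ring.
transitivity ((1 - 'X ^+ 2) * (P L.+1)^`() + (1 - 'X ^+ 2) * (P L)^`()); first by ring.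
by rewrite e legendre_derivP; ring.
Qed.

(** For the sum s and the difference d of P_{L+1} and P_L, this closes a first-order system with s'
    = Q and the Christoffel-Darboux identity (1 - X) Q = - (L + 1) d. Eliminating s and d gives Q(1)
    and the equation of Q. *)
Lemma legendre_darboux_deriv L :
  (1 + 'X) * (P L.+1 - P L)^`() = L.+1%:R * (P L.+1 + P L).
Proof.
have X0 : 1 - 'X != 0 :> {poly R} by rewrite -opprB oppr_eq0 -polyC1 polyXsubC_eq0.
apply: (mulfI X0); rewrite derivB.
have e : (1 - 'X ^+ 2) * (P L)^`() = L.+1%:R * 'X * P L - L.+1%:R * P L.+1.
  by rewrite legendre_rec; ring.
transitivity ((1 - 'X ^+ 2) * (P L.+1)^`() - (1 - 'X ^+ 2) * (P L)^`()); first by ring.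
by rewrite e legendre_derivP; ring.
Qed.

Lemma legendre_sum_horner1 L : (legendre_sum L).[1] = L.+1%:R ^+ 2.
Proof.
have := congr1 (horner^~ 1) (congr1 (@deriv R) (legendre_sum_christoffel_darboux L)).
have := congr1 (horner^~ 1) (legendre_darboux_deriv L).
have h0 := legendre_horner1 L; have h1 := legendre_horner1 L.+1.
move: (legendre_sum L) (P L.+1) (P L) h0 h1 => q p1 p0 h0 h1.
rewrite /= -!polyC_natr derivN !derivM !(derivB, derivX, derivC) !(hornerE, h0, h1) => h2 h3.
nra.
Qed.

(** Jacobi's equation for the parameters (1, 0). [e1] and [e2] come from the first two derivatives
    of the Christoffel-Darboux identity, [e3] from the derivative of [legendre_darboux_deriv];
    substituting leaves Q alone. *)
Lemma legendre_sum_ode L :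
  (1 - 'X ^+ 2) * (legendre_sum L)^`(2) =
   (1 + 3 * 'X) * (legendre_sum L)^`() - (L%:R * L.+2%:R) * legendre_sum L.
Proof.
rewrite derivnS derivn1; have h1 := congr1 (@deriv R) (legendre_sum_christoffel_darboux L).
have h2 := congr1 (@deriv R) h1.
have h3 := congr1 (@deriv R) (legendre_darboux_deriv L).
have h4 := deriv_legendreD L.
move: (legendre_sum L) (P L.+1 + P L) (P L.+1 - P L) h1 h2 h3 h4 => q s d.
rewrite /= -!polyC_natr !(derivN, derivM, derivB, derivD, derivX, derivC) !polyC_natr => h1 h2 h3 h4.
have e1 : L.+1%:R * d^`() = q - (1 - 'X) * q^`().
  apply/eqP; rewrite -subr_eq0; apply/eqP; move/eqP: h1; rewrite -subr_eq0 => /eqP h1.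
  by rewrite -[RHS]h1; ring.
have e2 : L.+1%:R * d^`()^`() = 2 * q^`() - (1 - 'X) * q^`()^`().
  apply/eqP; rewrite -subr_eq0; apply/eqP; move/eqP: h2; rewrite -subr_eq0 => /eqP h2.
  by rewrite -[RHS]h2; ring.
have e3 : L.+1%:R * L.+1%:R * q = L.+1%:R * d^`() + (1 + 'X) * (L.+1%:R * d^`()^`()).
  rewrite -mulrA -h4; apply/eqP; rewrite -subr_eq0; apply/eqP; move/eqP: h3; rewrite -subr_eq0 => /eqP h3.
  by rewrite -[RHS](mulr0 (- L.+1%:R)) -h3; ring.
move: e3; rewrite e1 e2 => e3.
have -> : L.+2%:R = 2 + L%:R :> {poly R} by rewrite -natrD.
move: e3; have -> : L.+1%:R = 1 + L%:R :> {poly R} by rewrite -natr1 addrC.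
move/eqP; rewrite -subr_eq0 => /eqP e3.
by apply/eqP; rewrite -subr_eq0; apply/eqP; rewrite -[RHS]e3; ring.
Qed.

Lemma size_legendre n : (size (P n) <= n.+1)%N.
Proof.
have size_deriv_le (p : {poly R}) k : (size p <= k)%N -> (size p^`() <= k.-1)%N.
  move=> pk; apply/leq_sizeP => j jk; rewrite coef_deriv nth_default ?mul0rn//.
  by rewrite (leq_trans pk)//; case: (k) jk.
have sz k m (p : {poly R}) : (size p <= m)%N -> (size p^`(k) <= m - k)%N.
  elim: k => [|k ih] pm; first by rewrite derivn0 subn0.
  by rewrite derivnS subnS size_deriv_le// ih.
rewrite /legendre (leq_trans (size_scale_leq _ _))//.
have -> : (n.+1 = n.*2.+1 - n)%N by rewrite subSn -addnn ?leq_addr// addnK.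
apply: sz; rewrite (leq_trans (size_exp_leq _ _))//.
by rewrite size_XnsubC//= mul2n.
Qed.

End LegendreRelations.

(** * Integration of polynomials by formal primitives *)

Section PolyIntegral.
Context {R : realType}.
Implicit Types (p q : {poly R}) (a b c : R).

(** At i = 0 the division by zero yields 0, so this is the primitive without constant term. *)
Definition pprimitive p : {poly R} := \poly_(i < (size p).+1) (p`_i.-1 / i%:R).

Lemma deriv_pprimitive p : (pprimitive p)^`() = p.
Proof.
apply/polyP => i; rewrite coef_deriv coef_poly ltnS /=.
case: ltnP => [_|pi]; last by rewrite mul0rn nth_default.
by rewrite -(mulr_natr (_ / _)) divfK// pnatr_eq0.
Qed.

(** The integral over [a, b] in algebraic form: no measurability or integrability enters the
    estimates on Q. *)
Definition pint a b p : R := (pprimitive p).[b] - (pprimitive p).[a].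

Lemma deriv_eq0_horner p a b : p^`() = 0 -> p.[a] = p.[b].
Proof.
move=> p0; suff -> : p = (p`_0)%:P by rewrite !hornerC.
apply/polyP => -[|i]; rewrite coefC//=.
have := congr1 (fun q => q`_i) p0; rewrite coef_deriv coef0 => /eqP.
by rewrite mulrn_eq0 => /eqP.
Qed.

Lemma pint_deriv a b p : pint a b p^`() = p.[b] - p.[a].
Proof.
rewrite /pint; have := @deriv_eq0_horner (pprimitive p^`() - p) a b.
rewrite derivB deriv_pprimitive subrr => /(_ erefl); rewrite !(hornerD, hornerN); lra.
Qed.

Lemma pintE a b p q : q^`() = p -> pint a b p = q.[b] - q.[a].
Proof. by move=> <-; rewrite pint_deriv. Qed.

Lemma pintD a b p q : pint a b (p + q) = pint a b p + pint a b q.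
Proof.
rewrite (@pintE _ _ _ (pprimitive p + pprimitive q)) ?derivD ?deriv_pprimitive//.
by rewrite /pint !hornerD; ring.
Qed.

Lemma pintZ a b c p : pint a b (c *: p) = c * pint a b p.
Proof.
rewrite (@pintE _ _ _ (c *: pprimitive p)) ?derivZ ?deriv_pprimitive//.
by rewrite /pint !hornerZ; ring.
Qed.

Lemma pint0 a b : pint a b 0 = 0.
Proof. by rewrite -(scale0r 0) pintZ mul0r. Qed.

Lemma pintN a b p : pint a b (- p) = - pint a b p.
Proof. by rewrite -scaleN1r pintZ mulN1r. Qed.

Lemma pintB a b p q : pint a b (p - q) = pint a b p - pint a b q.
Proof. by rewrite pintD pintN. Qed.

Lemma pint_parts a b p q :
  pint a b (p^`() * q) = p.[b] * q.[b] - p.[a] * q.[a] - pint a b (p * q^`()).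
Proof.
have := pint_deriv a b (p * q); rewrite derivM pintD !hornerM; lra.
Qed.

Lemma pint_cat a b c p : pint a c p = pint a b p + pint b c p.
Proof. by rewrite /pint; ring. Qed.

Lemma pint_ge0 a b p : a <= b -> (forall x, a <= x <= b -> 0 <= p.[x]) ->
  0 <= pint a b p.
Proof.
rewrite le_eqVlt => /predU1P[->|ab p0]; first by rewrite /pint subrr.
rewrite /pint; have [c cab ->] := polyrcf.poly_mvt (pprimitive p) ab.
rewrite deriv_pprimitive mulr_ge0 ?subr_ge0 ?(ltW ab)// p0//.
by move: cab; rewrite in_itv/= => /andP[/ltW -> /ltW ->].
Qed.

Lemma ler_pint a b p q : a <= b -> (forall x, a <= x <= b -> p.[x] <= q.[x]) ->
  pint a b p <= pint a b q.
Proof.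
move=> ab pq; rewrite -subr_ge0 -pintB pint_ge0// => x /pq.
by rewrite !hornerE subr_ge0.
Qed.

Lemma pint_comp a b p q :
  pint a b ((p \Po q) * q^`()) = pint q.[a] q.[b] p.
Proof.
rewrite (@pintE _ _ _ (pprimitive p \Po q)) ?deriv_comp ?deriv_pprimitive//.
by rewrite !horner_comp.
Qed.

End PolyIntegral.

(** * Orthogonality, reproducing property and bounds on [-1, 1] *)

Section LegendreOrthogonality.
Context {R : realType}.
Implicit Types (n l L : nat) (p q : {poly R}).
Local Notation P := (@legendre R).

Let deriv_rodrigues n j : (j <= n)%N ->
  exists g : {poly R}, (('X ^+ 2 - 1) ^+ n)^`(j) = ('X ^+ 2 - 1) ^+ (n - j) * g.
Proof.
elim: j => [|j ih] jn; first by exists 1; rewrite derivn0 subn0 mulr1.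
have [g hg] := ih (ltnW jn).
exists ((n - j)%:R * ('X ^+ 2 - 1)^`() * g + ('X ^+ 2 - 1) * g^`()).
rewrite derivnS hg derivM deriv_exp.
have -> : (n - j = (n - j.+1).+1)%N by rewrite subnSK.
rewrite (exprS _ (n - j.+1)) /= -(mulr_natl (_ * _)); ring.
Qed.

Let horner_rodrigues n j (x : R) : (j < n)%N -> x ^+ 2 = 1 ->
  (('X ^+ 2 - 1) ^+ n)^`(j).[x] = 0.
Proof.
move=> jn x1; have [g ->] := deriv_rodrigues (ltnW jn).
by rewrite hornerM horner_exp !(hornerE, hornerXn) x1 subrr expr0n subn_eq0 leqNgt jn mul0r.
Qed.

(** By n integrations by parts: the inner induction lowers the order of the derivative and the
    degree of the cofactor together. Boundary terms vanish because -1 and 1 are zeros of order n of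
    (X^2 - 1)^n. *)
Lemma legendre_orthogonal n p : (size p <= n)%N -> pint (-1) 1 (P n * p) = 0.
Proof.
move=> pn; rewrite /legendre -scalerAl pintZ.
suff : forall j, (j <= n)%N -> forall q : {poly R}, (size q <= j)%N ->
    pint (-1) 1 ((('X ^+ 2 - 1) ^+ n)^`(j) * q) = 0 by move=> ->//; rewrite mulr0.
elim => [_ q|j ih jn q qj]; first by rewrite leqn0 size_poly_eq0 => /eqP ->; rewrite mulr0 pint0.
rewrite derivnS pint_parts !horner_rodrigues ?sqrrN ?expr1n// ih ?(ltnW jn)//.
  by rewrite !mul0r !subr0.
apply/leq_sizeP => i ij; rewrite coef_deriv nth_default ?mul0rn//.
by rewrite (leq_trans qj).
Qed.

Lemma size_legendre_sum L : (size (@legendre_sum R L) <= L.+1)%N.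
Proof.
rewrite (leq_trans (size_sum _ _ _))//; apply/bigmax_leqP => l _.
by rewrite (leq_trans (size_scale_leq _ _))// (leq_trans (size_legendre _)).
Qed.

(** Integrate Q = (P_{L+1} + P_L)' by parts. The two polynomials have opposite values at -1, and the
    remaining integral vanishes by orthogonality, p' having degree below L. *)
Lemma legendre_sum_reproducing L p : (size p <= L.+1)%N ->
  pint (-1) 1 (legendre_sum L * p) = 2 * p.[1].
Proof.
move=> pL; rewrite -deriv_legendreD pint_parts mulrDl pintD.
have sp : (size p^`() <= L)%N.
  apply/leq_sizeP => i ij; rewrite coef_deriv nth_default ?mul0rn//.
  by rewrite (leq_trans pL).
rewrite !legendre_orthogonal ?(leq_trans sp)// !hornerD !legendre_horner1 !legendre_hornerN1.
by rewrite exprS; ring.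
Qed.

Lemma pint_legendre_sum_sqr L :
  pint (-1) 1 (legendre_sum L * legendre_sum L) = 2 * L.+1%:R ^+ 2 :> R.
Proof. by rewrite legendre_sum_reproducing ?size_legendre_sum// legendre_sum_horner1. Qed.

(** Christoffel-Darboux replaces (1 - X) Q by a multiple of P_{L+1}, orthogonal to Q, minus P_L,
    whose value at 1 is reproduced. The weight lowers the order from n^2 to n: this is where the
    concentration of Q near the diagonal is seen. *)
Lemma pint_legendre_sum_sqr_weight L :
  pint (-1) 1 (legendre_sum L * legendre_sum L * (1 - 'X)) = 2 * L.+1%:R :> R.
Proof.
rewrite -mulrA (mulrC _ (1 - 'X)) legendre_sum_christoffel_darboux.
have -> : - (L.+1%:R * (P L.+1 - P L)) = (- L.+1%:R) *: (P L.+1 - P L).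
  by rewrite -mul_polyC polyCN polyC_natr mulNr.
rewrite -scalerAr pintZ (mulrBr (legendre_sum L)) pintB (@legendre_sum_reproducing L (P L)); last exact: size_legendre.
rewrite (mulrC (legendre_sum L)) legendre_orthogonal ?size_legendre_sum// legendre_horner1; ring.
Qed.

Lemma legendre_le1 n (x : R) : -1 <= x <= 1 -> `|(P n).[x]| <= 1.
Proof.
case: n => [|n] x1; first by rewrite legendre0 hornerC normr1.
pose l : R := n.+1%:R * n.+2%:R.
have l0 : 0 < l by rewrite mulr_gt0 ?ltr0n.
(* [F] equals l at both endpoints, where |P| = 1, and F' = 2 X P'^2 makes it decrease on [-1, 0] and
   increase on [0, 1]; hence l P^2 <= F <= l. *)
pose F : {poly R} := l *: (P n.+1 ^+ 2) + (1 - 'X ^+ 2) * ((P n.+1)^`()) ^+ 2.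
have F' : F^`() = 2 * 'X * (P n.+1)^`() ^+ 2.
  rewrite /F !expr2 derivD derivZ !derivM derivB !derivM derivX -polyC1 derivC polyC1.
  have h := @legendre_ode R n.+1; rewrite derivnS derivn1 in h.
  rewrite -mul_polyC /l polyCM !polyC_natr.
  move: (P n.+1) h => p h.
  move/eqP: h; rewrite -subr_eq0 => /eqP h.
  apply/eqP; rewrite -subr_eq0; apply/eqP.
  by move: h; set h0 := (X in X = 0) => h; transitivity (2 * p^`() * h0); [rewrite /h0; ring | rewrite h mulr0].
have Fx y : F.[y] = l * (P n.+1).[y] ^+ 2 + (1 - y ^+ 2) * (P n.+1)^`().[y] ^+ 2.
  by rewrite /F !(hornerE, horner_exp, hornerXn).
have F'x y : F^`().[y] = y * (2 * (P n.+1)^`().[y] ^+ 2).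
  by rewrite F' expr2 !hornerM hornerX -polyC_natr hornerC; ring.
have F1 : F.[x] <= l.
  case/andP: x1 => Nx1 x1; have [x0|x0] := leP 0 x.
    have -> : l = F.[1] by rewrite Fx legendre_horner1; ring.
    rewrite -subr_ge0 -pint_deriv; apply: pint_ge0 => // y /andP[xy _].
    by rewrite F'x; apply: mulr_ge0; [exact: le_trans xy | rewrite mulr_ge0 ?sqr_ge0].
  have -> : l = F.[-1].
    by rewrite Fx legendre_hornerN1 -exprM mulnC exprM sqrrN !expr1n; ring.
  rewrite -subr_le0 -pint_deriv -oppr_ge0 -pintN; apply: pint_ge0 => // y /andP[_ xy].
  rewrite hornerN F'x oppr_ge0; apply: mulr_le0_ge0; first exact: le_trans (ltW x0).
  by rewrite mulr_ge0 ?sqr_ge0.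
have lP : l * (P n.+1).[x] ^+ 2 <= l * 1.
  rewrite mulr1 (le_trans _ F1)// Fx lerDl mulr_ge0 ?sqr_ge0//.
  by case/andP: x1 => ? ?; nra.
by move: lP; rewrite ler_pM2l// => lP; rewrite ler_norml; apply/andP; split; nra.
Qed.

(** Each |P_l| is at most 1 = P_l(1). This makes n^4 - Q^2, hence the two-point intensity,
    nonnegative. *)
Lemma legendre_sum_le L (x : R) : -1 <= x <= 1 ->
  `|(legendre_sum L).[x]| <= L.+1%:R ^+ 2.
Proof.
move=> x1; rewrite -legendre_sum_horner1 /legendre_sum !horner_sum.
rewrite (le_trans (ler_norm_sum _ _ _))// ler_sum// => l _.
rewrite !(hornerZ _ (P l)) legendre_horner1 normrM normr_nat ler_wpM2l// ?ler0n//.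
exact: legendre_le1.
Qed.

End LegendreOrthogonality.

Lemma pint_le_ln (R : realType) (p : {poly R}) (c a b : R) : 0 < a -> a <= b ->
  (forall x, a <= x <= b -> p.[x] <= c / x) -> pint a b p <= c * (ln b - ln a).
Proof.
move=> a0 ab pc; pose f (x : R) := c * ln x - (pprimitive p).[x].
have fd (x : R) : 0 < x -> is_derive x 1 f (c / x - p.[x]).
  move=> x0; rewrite /f; have h1 := is_derive1_ln x0.
  have h2 : is_derive x 1 (horner (pprimitive p)) p.[x].
    by have := is_derive_poly (pprimitive p) x; rewrite deriv_pprimitive.
  have -> : c / x - p.[x] = (c *: x^-1) - p.[x] by [].
  exact: (is_deriveB (is_deriveZ c h1) h2).
suff : f a <= f b by rewrite /f /pint; lra.
have dx x : x \in `]a, b[ -> 0 < x by rewrite in_itv/= => /andP[/(lt_trans a0)].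
apply: (@ger0_derive1_ndecr _ f a b) => // [x xab|x xab|].
- by have [] := fd _ (dx _ xab).
- have [_] := fd _ (dx _ xab); rewrite derive1E => ->; rewrite subr_ge0 pc//.
  by move: xab; rewrite in_itv/= => /andP[/ltW -> /ltW ->].
- apply: derivable_within_continuous => x; rewrite in_itv/= => /andP[xa _].
  by have [] := fd _ (lt_le_trans a0 xa).
Qed.

(** * Decay of Q(1 - 2x^2) away from x = 0 *)

Section DiagonalDecay.
Context {R : realType}.
Variable L : nat.
Implicit Types (s x : R).
Local Notation Q := (@legendre_sum R L).

Let n : R := L.+1%:R.
Let g : {poly R} := 1 - 2%:P * 'X ^+ 2.
(** In this variable, x is half the chord between two points of the 2-sphere with scalar product 1 -
    2x^2. *)
Let q : {poly R} := Q \Po g.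
Let lam : R := n ^+ 2 - 1.

Let deriv_g : g^`() = - 4%:P * 'X.
Proof.
by rewrite /g expr2 derivB !derivM derivX -polyC1 !derivC !(polyC_natr, polyC1); ring.
Qed.

Let q_ode : 'X * (1 - 'X ^+ 2) * q^`()^`() =
  - ((3%:P - 5%:P * 'X ^+ 2) * q^`()) - (4 * lam)%:P * 'X * q.
Proof.
have := congr1 (fun p => p \Po g) (@legendre_sum_ode R L).
have -> : 1 + 3 * 'X = 1 + 3%:P * 'X :> {poly R} by rewrite polyC_natr.
have -> : L%:R * L.+2%:R = lam%:P :> {poly R}.
  rewrite -!polyC_natr -polyCM; congr (_%:P); rewrite /lam /n -(addn2 L) -(addn1 L) !natrD; ring.
rewrite derivnS derivn1 /= expr2 !(comp_polyB, comp_polyM) !comp_polyD !comp_polyM !comp_polyX -polyC1 !comp_polyC polyC1 -/q.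
have -> : q^`() = (Q^`() \Po g) * (- 4%:P * 'X) by rewrite /q deriv_comp deriv_g.
have -> : ((Q^`() \Po g) * (- 4%:P * 'X))^`() =
   (Q^`()^`() \Po g) * (- 4%:P * 'X) * (- 4%:P * 'X) - 4%:P * (Q^`() \Po g).
  by rewrite !derivM deriv_comp deriv_g derivN derivX !derivC; ring.
move: (Q^`()^`() \Po g) (Q^`() \Po g) => q2 q1.
rewrite /g polyCM !polyC_natr => h.
transitivity (4 * 'X * ((1 - (1 - 2 * 'X^2) * (1 - 2 * 'X^2)) * q2) - (4 * 'X * (1 - 'X ^+ 2)) * q1).
  by ring.
by rewrite h; ring.
Qed.

Let g0 : g.[0] = 1. Proof. by rewrite /g expr2 -polyC1 !(hornerD, hornerN, hornerM, hornerX, hornerC); ring. Qed.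
Let g1 : g.[1] = -1. Proof. by rewrite /g expr2 -polyC1 !(hornerD, hornerN, hornerM, hornerX, hornerC); ring. Qed.

Let pint_swap a b (p : {poly R}) : pint a b p = - pint b a p.
Proof. by rewrite /pint opprB. Qed.

Let intA : pint 0 1 (q ^+ 2 * 'X) = n ^+ 2 / 2.
Proof.
have := pint_comp 0 1 (Q * Q) g; rewrite comp_polyM -/q g0 g1 deriv_g (pint_swap 1 (-1)).
rewrite pint_legendre_sum_sqr -/n.
have -> : q * q * (- 4%:P * 'X) = (- 4) *: (q ^+ 2 * 'X).
  by rewrite -mul_polyC polyCN !polyC_natr; ring.
by rewrite pintZ => h; lra.
Qed.

Let intB : pint 0 1 (q ^+ 2 * 'X ^+ 3) = n / 4.
Proof.
have := pint_comp 0 1 (Q * Q * (1 - 'X)) g.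
rewrite !comp_polyM !comp_polyB !comp_polyX -polyC1 comp_polyC polyC1 -/q g0 g1 deriv_g (pint_swap 1 (-1)).
rewrite pint_legendre_sum_sqr_weight -/n.
have -> : q * q * (1 - g) * (- 4%:P * 'X) = (- 8) *: (q ^+ 2 * 'X ^+ 3).
  by rewrite /g -mul_polyC polyCN !polyC_natr; ring.
by rewrite pintZ => h; lra.
Qed.

(** Energy identity of the self-adjoint form (x^3 (1 - x^2) q')' = - 4 lam x^3 q of [q_ode]:
    multiply by q and integrate by parts; the weight vanishes at 0 and 1. *)
Let intC : pint 0 1 ('X ^+ 3 * (1 - 'X ^+ 2) * q^`() ^+ 2) = lam * n.
Proof.
have := pint_parts 0 1 ('X ^+ 3 * (1 - 'X ^+ 2) * q^`()) q.
have -> : ('X ^+ 3 * (1 - 'X ^+ 2) * q^`())^`() * q = (- 4 * lam) *: (q ^+ 2 * 'X ^+ 3).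
  have h := q_ode; rewrite -mul_polyC.
  have -> : ('X ^+ 3 * (1 - 'X ^+ 2) * q^`())^`() =
    'X ^+ 2 * ('X * (1 - 'X ^+ 2) * q^`()^`()) + 'X ^+ 2 * (3%:P - 5%:P * 'X ^+ 2) * q^`().
    by rewrite !exprS expr0 mulr1 !derivM derivB !derivM derivX -polyC1 derivC polyC1 !polyC_natr; ring.
  by rewrite h !polyCM polyCN !polyC_natr; ring.
have b1 : ('X ^+ 3 * (1 - 'X ^+ 2) * q^`()).[1] = 0.
  by rewrite 2!hornerM hornerD hornerN !hornerXn -polyC1 hornerC !expr1n subrr mulr0 mul0r.
have b0 : ('X ^+ 3 * (1 - 'X ^+ 2) * q^`()).[0] = 0.
  by rewrite 2!hornerM hornerXn expr0n !mul0r.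
rewrite pintZ intB b1 b0 !mul0r subr0 sub0r => h.
have -> : 'X ^+ 3 * (1 - 'X ^+ 2) * q^`() ^+ 2 = 'X ^+ 3 * (1 - 'X ^+ 2) * q^`() * q^`() by ring.
by apply: oppr_inj; rewrite -h; field.
Qed.

(* Twice the Sonin function: a quadratic form in [(q, q')] whose derivative along
   the differential equation [q_ode] keeps only nonnegative terms on [0, 1/2]. *)
Let E : {poly R} := 2%:P * 'X ^+ 3 * (1 - 'X ^+ 2) * q^`() ^+ 2
  + 6%:P * 'X ^+ 2 * (1 - 'X ^+ 2) * q * q^`()
  + ((8 * lam)%:P * 'X ^+ 3 + 3%:P * ('X - 'X ^+ 3)) * q ^+ 2.

Let deriv_E : E^`() = 4%:P * 'X ^+ 4 * q^`() ^+ 2 + 3%:P * (1 - 3%:P * 'X ^+ 2) * q ^+ 2.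
Proof.
have h := q_ode; move/eqP: h; rewrite -subr_eq0; set z := (X in X == 0) => /eqP h.
(* The multiplier of the defect [z] of the equation is the coefficient of q'' in E', divided by x (1
   - x^2). *)
have -> : E^`() = (4%:P * 'X ^+ 2 * q^`() + 6%:P * 'X * q) * z + (4%:P * 'X ^+ 4 * q^`() ^+ 2 + 3%:P * (1 - 3%:P * 'X ^+ 2) * q ^+ 2).
  rewrite /E /z !exprS !expr0 !mulr1.
  rewrite !(derivD, derivN, derivM) derivX -polyC1 !derivC polyC1 !polyCM !polyC_natr; ring.
by rewrite h mulr0 add0r.
Qed.

Let qx x : R := q.[x].
Let dq x : R := q^`().[x].

Let E_horner x : E.[x] = 2 * x ^+ 3 * (1 - x ^+ 2) * dq x ^+ 2
  + 6 * x ^+ 2 * (1 - x ^+ 2) * qx x * dq x + (8 * lam * x ^+ 3 + 3 * (x - x ^+ 3)) * qx x ^+ 2.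
Proof.
rewrite /E /qx /dq; move: q^`() q => q1 q0.
by rewrite !exprS !expr0 !mulr1 -polyC1 !(hornerD, hornerN, hornerM, hornerX, hornerC).
Qed.

Let dE_ge0 x : 0 <= x <= 2^-1 -> 0 <= E^`().[x].
Proof.
move=> /andP[x0 x1]; rewrite deriv_E.
have -> : (4%:P * 'X ^+ 4 * q^`() ^+ 2 + 3%:P * (1 - 3%:P * 'X ^+ 2) * q ^+ 2).[x] =
   4 * x ^+ 4 * dq x ^+ 2 + 3 * (1 - 3 * x ^+ 2) * qx x ^+ 2.
  rewrite /qx /dq; move: q^`() q => q1 q0.
  by rewrite !exprS !expr0 !mulr1 -polyC1 !(hornerD, hornerN, hornerM, hornerX, hornerC).
have hx : x ^+ 2 <= 4^-1.
  have -> : 4^-1 = 2^-1 ^+ 2 :> R by field.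
  by rewrite ler_pXn2r ?nnegrE ?invr_ge0//.
have hx1 : 0 <= 1 - 3 * x ^+ 2 by lra.
by rewrite addr_ge0// mulr_ge0 ?sqr_ge0// mulr_ge0 ?exprn_ge0//.
Qed.

Let E_mono x y : 0 <= x -> x <= y -> y <= 2^-1 -> E.[x] <= E.[y].
Proof.
move=> x0 xy y1; rewrite -subr_ge0 -pint_deriv; apply: pint_ge0 => // z /andP[xz zy].
by apply: dE_ge0; rewrite (le_trans x0 xz) (le_trans zy).
Qed.

Hypothesis L3 : (3 <= L)%N.
Let n4 : 4 <= n. Proof. by rewrite /n ler_nat. Qed.

(** Both terms of the bound have known integrals over [0, 1]. By 2 |ab| <= a^2 + b^2 and 1 <= 4x the
    cross term costs 12 x^3 in a^2 and in b^2, and 3x <= 48 x^3; hence 14 = 2 + 12 and 60 = 12 +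
    48. *)
Let E_le_mid x : 4^-1 <= x <= 2^-1 ->
  E.[x] <= 14 * (x ^+ 3 * (1 - x ^+ 2) * dq x ^+ 2) + (8 * lam + 60) * (x ^+ 3 * qx x ^+ 2).
Proof.
move=> /andP[x4 x2]; rewrite E_horner.
set a := qx x; set b := dq x; set c := 1 - x ^+ 2.
have c0 : 0 <= c <= 1.
  have : x ^+ 2 <= 1 by rewrite expr_le1// ?(le_trans x2) ?invf_le1 ?ler1n// (le_trans _ x4)// invr_ge0.
  by have := sqr_ge0 x; rewrite /c; lra.
have [c0' c1] := andP c0.
have x0 : 0 <= x by rewrite (le_trans _ x4)// invr_ge0.
have x4' : 0 <= 4 * x - 1 by lra.
have h1 : 0 <= x ^+ 2 * c * (4 * x - 1) * (a ^+ 2 + b ^+ 2).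
  by rewrite mulr_ge0 ?addr_ge0 ?sqr_ge0// mulr_ge0// mulr_ge0 ?sqr_ge0.
have h2 : 0 <= x ^+ 2 * c * (a - b) ^+ 2 by rewrite mulr_ge0 ?sqr_ge0// mulr_ge0 ?sqr_ge0.
have h3 : 0 <= x ^+ 3 * x ^+ 2 * a ^+ 2 by rewrite mulr_ge0 ?sqr_ge0// mulr_ge0 ?exprn_ge0.
have h4 : 0 <= x * (16 * x ^+ 2 - 1) * a ^+ 2.
  rewrite mulr_ge0 ?sqr_ge0// mulr_ge0//.
  have -> : 16 * x ^+ 2 - 1 = (4 * x - 1) * (4 * x + 1) by ring.
  by rewrite mulr_ge0//; lra.
have h5 : 0 <= x ^+ 3 * a ^+ 2 by rewrite mulr_ge0 ?sqr_ge0// ?exprn_ge0.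
rewrite -subr_ge0.
have -> : 14 * (x ^+ 3 * c * b ^+ 2) + (8 * lam + 60) * (x ^+ 3 * a ^+ 2) -
  (2 * x ^+ 3 * c * b ^+ 2 + 6 * x ^+ 2 * c * a * b + (8 * lam * x ^+ 3 + 3 * (x - x ^+ 3)) * a ^+ 2)
  = 3 * (x ^+ 2 * c * (4 * x - 1) * (a ^+ 2 + b ^+ 2)) + 3 * (x ^+ 2 * c * (a - b) ^+ 2)
  + 12 * (x ^+ 3 * x ^+ 2 * a ^+ 2) + 3 * (x * (16 * x ^+ 2 - 1) * a ^+ 2) + 3 * (x ^+ 3 * a ^+ 2).
  by rewrite /c; ring.
do 4 (apply: addr_ge0; last by rewrite mulr_ge0).
by rewrite mulr_ge0.
Qed.

Let dE_int : pint 4^-1 2^-1 E <= 22 * lam * n.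
Proof.
set f : {poly R} := 14 *: ('X ^+ 3 * (1 - 'X ^+ 2) * q^`() ^+ 2) + (8 * lam + 60) *: (q ^+ 2 * 'X ^+ 3).
have fx x : f.[x] = 14 * (x ^+ 3 * (1 - x ^+ 2) * dq x ^+ 2) + (8 * lam + 60) * (x ^+ 3 * qx x ^+ 2).
  rewrite /f /qx /dq; move: q^`() q => q1 q0.
  by rewrite !exprS !expr0 !mulr1 -polyC1 !(hornerD, hornerN, hornerZ, hornerM, hornerX, hornerC); ring.
have lam15 : 15 <= lam by rewrite /lam; have := n4; nra.
have f_ge0 x : 0 <= x <= 1 -> 0 <= f.[x].
  move=> /andP[x0 x1]; have x2 : 0 <= 1 - x ^+ 2 by rewrite subr_ge0 expr_le1.
  rewrite fx; apply: addr_ge0; first by do 3 (rewrite mulr_ge0 ?sqr_ge0 ?exprn_ge0//).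
  by rewrite mulr_ge0//; [lra | rewrite mulr_ge0 ?sqr_ge0 ?exprn_ge0].
have e : pint 0 1 f = 16 * lam * n + 15 * n.
  by rewrite /f pintD !pintZ intB intC; field.
move: e; rewrite (@pint_cat _ 0 4^-1) (@pint_cat _ 4^-1 2^-1) => e.
have h1 : pint 4^-1 2^-1 E <= pint 4^-1 2^-1 f.
  by apply: ler_pint => [|y yy]; [lra | rewrite fx E_le_mid].
have h2 : 0 <= pint 0 4^-1 f.
  by apply: pint_ge0 => [|y /andP[ya yb]]; [lra | apply: f_ge0; apply/andP; split; lra].
have h3 : 0 <= pint 2^-1 1 f.
  by apply: pint_ge0 => [|y /andP[ya yb]]; [lra | apply: f_ge0; apply/andP; split; lra].
have := n4; nra.
Qed.

(** E increases up to 1/2, so its value at x <= 1/4 is at most its mean over [1/4, 1/2], an interval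
    of length 1/4: 88 = 4 * 22. *)
Let E_le x : 0 <= x <= 4^-1 -> E.[x] <= 88 * lam * n.
Proof.
move=> /andP[x0 x1].
have : pint 4^-1 2^-1 (E.[x])%:P <= pint 4^-1 2^-1 E.
  apply: ler_pint => [|y /andP[ya yb]]; first lra.
  by rewrite hornerC E_mono// (le_trans x1).
rewrite (@pintE _ _ _ _ (E.[x] *: 'X)); last by rewrite derivZ derivX -mul_polyC mulr1.
by rewrite !hornerZ !hornerX; have := dE_int; lra.
Qed.

(** Completing the square in q' leaves E >= (8 lam x^3 - 3x/2) q^2. For x >= 1/n one has lam x^2 >=
    3/4, so this is at least 6 lam x^3 q^2, and 88 / 6 < 15. *)
Let q_le x : n^-1 <= x <= 4^-1 -> x ^+ 3 * qx x ^+ 2 <= 15 * n.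
Proof.
move=> /andP[xn x1].
have n0 : 0 < n by have := n4; lra.
have x0 : 0 < x by rewrite (lt_le_trans _ xn)// invr_gt0.
have nx : 1 <= n * x by rewrite mulrC -ler_pdivrMr// div1r.
have lx : 3 / 4 <= lam * x ^+ 2 by rewrite /lam; have := n4; nra.
have : E.[x] <= 88 * lam * n by rewrite E_le// (ltW x0).
rewrite E_horner; set a := qx x; set b := dq x => hE.
have h1 : 0 <= x * (1 - x ^+ 2) * (2 * x * b + 3 * a) ^+ 2.
  rewrite mulr_ge0 ?sqr_ge0// mulr_ge0 ?(ltW x0)// subr_ge0 expr_le1 ?(ltW x0)//; lra.
have h2 : 0 <= (lam * x ^+ 2 - 3 / 4) * x * a ^+ 2.
  by rewrite mulr_ge0 ?sqr_ge0// mulr_ge0 ?(ltW x0)// subr_ge0.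
have h3 : 0 <= x ^+ 3 * a ^+ 2 by rewrite mulr_ge0 ?sqr_ge0// exprn_ge0// ltW.
have lam0 : 0 < lam by rewrite /lam; have := n4; nra.
rewrite -(ler_pM2l lam0); nra.
Qed.

(* Second moment of the kernel against the distance: this is where the logarithm
   in the number variance enters. *)
Lemma pint_legendre_sum_chord :
  pint 0 1 ((Q \Po (1 - 2%:P * 'X ^+ 2)) ^+ 2 * 'X ^+ 2) <= 2 * n + 15 * n * ln n.
Proof.
rewrite -/g -/q.
have n0 : 0 < n by have := n4; lra.
have ni : n^-1 <= 4^-1 by rewrite lef_pV2 ?posrE// n4.
have ni0 : 0 < n^-1 by rewrite invr_gt0.
have px k x : (q ^+ 2 * 'X ^+ k).[x] = x ^+ k * qx x ^+ 2.
  by rewrite hornerM hornerXn expr2 hornerM mulrC.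
have p1 x : (q ^+ 2 * 'X).[x] = x * qx x ^+ 2 by rewrite hornerM hornerX expr2 hornerM mulrC.
(* On [0, 1/n] one factor x is at most 1/n and [intA] remains; on [1/4, 1] the bound 1 <= 4x leaves
   [intB]; in between x^2 q^2 <= 15 n / x, the only source of the logarithm. *)
rewrite (@pint_cat _ 0 n^-1) (@pint_cat _ n^-1 4^-1).
have hA : pint 0 n^-1 (q ^+ 2 * 'X ^+ 2) <= n / 2.
  have : pint 0 n^-1 (q ^+ 2 * 'X ^+ 2) <= pint 0 n^-1 (n^-1 *: (q ^+ 2 * 'X)).
    apply: ler_pint => [|x /andP[x0 xn]]; first exact: ltW.
    rewrite hornerZ px p1 [leRHS]mulrA ler_wpM2r ?sqr_ge0//.
    by rewrite [x ^+ 2]expr2 ler_wpM2r.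
  move=> /le_trans; apply; rewrite pintZ.
  have -> : n / 2 = n^-1 * (n ^+ 2 / 2) by field; rewrite gt_eqF.
  rewrite ler_pM2l// -intA (@pint_cat _ 0 n^-1 1) lerDl; apply: pint_ge0.
    by rewrite (le_trans ni)// invf_le1 ?ler1n.
  move=> x /andP[xn _]; rewrite p1 mulr_ge0 ?sqr_ge0//.
  by rewrite (le_trans _ xn)// ltW.
have hC : pint 4^-1 1 (q ^+ 2 * 'X ^+ 2) <= n.
  have : pint 4^-1 1 (q ^+ 2 * 'X ^+ 2) <= pint 4^-1 1 (4 *: (q ^+ 2 * 'X ^+ 3)).
    apply: ler_pint => [|x /andP[x0 xn]]; first by rewrite invf_le1 ?ler1n.
    rewrite hornerZ !px [leRHS]mulrA ler_wpM2r ?sqr_ge0//.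
    by rewrite [x ^+ 3]exprS mulrA ler_peMl ?sqr_ge0//; lra.
  move=> /le_trans; apply; rewrite pintZ.
  have -> : n = 4 * (n / 4) by field.
  rewrite ler_pM2l// -intB (@pint_cat _ 0 4^-1 1) lerDr; apply: pint_ge0 => [|x /andP[x0 _]].
    by rewrite invr_ge0.
  by rewrite px mulr_ge0 ?sqr_ge0// exprn_ge0.
have hB : pint n^-1 4^-1 (q ^+ 2 * 'X ^+ 2) <= 15 * n * ln n.
  have -> : 15 * n * ln n = 15 * n * (ln 4^-1 - ln n^-1) + 15 * n * ln 4.
    by rewrite !lnV ?posrE//; ring.
  have : 0 <= 15 * n * ln 4 by rewrite mulr_ge0 ?ln_ge0 ?ler1n// mulr_ge0// ltW.
  suff : pint n^-1 4^-1 (q ^+ 2 * 'X ^+ 2) <= 15 * n * (ln 4^-1 - ln n^-1) by lra.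
  apply: pint_le_ln => // x xx.
  have x0 : 0 < x by case/andP: xx => xn _; rewrite (lt_le_trans _ xn).
  by rewrite ler_pdivlMr// px mulrC [leLHS]mulrA -exprS q_le.
by lra.
Qed.

End DiagonalDecay.

(** * Zonal integrals over the sphere *)

(* Pointwise forms of the differentiation rules, whose conclusions unify with
   lambda-abstractions. *)
Section PointwiseDerivative.
Context {R : realType}.
Implicit Types (f g : R -> R) (x a b c : R).

Lemma is_derive1D f g x a b : is_derive x 1 f a -> is_derive x 1 g b ->
  is_derive x 1 (fun y => f y + g y) (a + b).
Proof. by move=> ? ?; exact: (@is_deriveD _ _ _ f g). Qed.

Lemma is_derive1B f g x a b : is_derive x 1 f a -> is_derive x 1 g b ->
  is_derive x 1 (fun y => f y - g y) (a - b).
Proof. by move=> ? ?; exact: (@is_deriveB _ _ _ f g). Qed.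

Lemma is_derive1N f x a : is_derive x 1 f a -> is_derive x 1 (fun y => - f y) (- a).
Proof. by move=> ?; exact: (@is_deriveN _ _ _ f). Qed.

Lemma is_derive1M f g x a b : is_derive x 1 f a -> is_derive x 1 g b ->
  is_derive x 1 (fun y => f y * g y) (a * g x + f x * b).
Proof.
move=> fa gb; have := @is_deriveM _ _ f g x 1 _ _ fa gb.
by move/is_derive_eq; apply; rewrite addrC; congr (_ + _); rewrite /GRing.scale/= mulrC.
Qed.

Lemma is_derive1_cst c x : is_derive x 1 (fun=> c) 0.
Proof. exact: is_derive_cst. Qed.

Lemma is_derive1_id x : is_derive x 1 (fun y : R => y) 1.
Proof. exact: is_derive_id. Qed.

Lemma is_derive1Mr f c x a : is_derive x 1 f a -> is_derive x 1 (fun y => f y * c) (a * c).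
Proof.
by move=> fa; apply: (is_derive_eq (is_derive1M fa (is_derive1_cst c x))); rewrite mulr0 addr0.
Qed.

Lemma is_derive1Ml f c x a : is_derive x 1 f a -> is_derive x 1 (fun y => c * f y) (c * a).
Proof.
by move=> fa; apply: (is_derive_eq (is_derive1M (is_derive1_cst c x) fa)); rewrite mul0r add0r.
Qed.

Lemma is_derive1_chain f g x a b : is_derive (g x) 1 f a -> is_derive x 1 g b ->
  is_derive x 1 (fun y => f (g y)) (a * b).
Proof. by move=> ? ?; exact: (@is_derive1_comp _ f g). Qed.

Lemma is_derive1_continuous f x a : is_derive x 1 f a -> {for x, continuous f}.
Proof. by case=> fx _; apply/differentiable_continuous/derivable1_diffP. Qed.

Lemma continuous_at1D f g x : {for x, continuous f} -> {for x, continuous g} ->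
  {for x, continuous (fun y => f y + g y)}.
Proof. by move=> ? ?; exact: (@continuousD _ _ _ f g). Qed.

Lemma continuous_at1M f g x : {for x, continuous f} -> {for x, continuous g} ->
  {for x, continuous (fun y => f y * g y)}.
Proof. by move=> ? ?; exact: (@continuousM _ _ f g). Qed.

Lemma continuous_at1_chain f g x : {for g x, continuous f} -> {for x, continuous g} ->
  {for x, continuous (fun y => f (g y))}.
Proof. by move=> ? ?; exact: (@continuous_comp _ _ _ g f). Qed.

End PointwiseDerivative.

(** * General tools: densities, parameters, iterated integrals *)

Section DensityPushforward.
Local Open Scope ereal_scope.
Context d1 d2 (T1 : measurableType d1) (T2 : measurableType d2) (R : realType).
Variables (mu : {measure set T1 -> \bar R}) (m : {measure set T2 -> \bar R}).
Variables (D : set T1) (phi : T1 -> T2) (g : T1 -> R).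
Hypotheses (mD : measurable D) (mphi : measurable_fun setT phi).
Hypotheses (mg : measurable_fun D g) (g0 : forall x, D x -> (0 <= g x)%R).
Hypothesis mE : forall B, measurable B ->
  m B = \int[mu]_(x in D) (\1_B (phi x) * g x)%:E.

Import HBNNSimple.

Let integral_density_nnsfun (h : {nnsfun T2 >-> R}) :
  \int[m]_y (h y)%:E = \int[mu]_(x in D) (h (phi x) * g x)%:E.
Proof.
under eq_integral do rewrite fimfunE -fsumEFin//.
rewrite ge0_integral_fsum//; last 2 first.
  - by move=> r; apply/measurable_EFinP/measurable_funM.
  - by move=> r y _; rewrite EFinM nnfun_muleindic_ge0.
under [RHS]eq_integral => x xD.
  rewrite fimfunE mulrC mulr_fsumr// -fsumEFin//; over.
rewrite ge0_integral_fsum//; last 2 first.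
  - move=> r; apply: measurableT_comp => //; apply: measurable_funM => //.
    apply: measurable_funM => //; apply: measurable_funTS.
    exact: measurableT_comp.
  - move=> r x Dx; rewrite lee_fin mulr_ge0 ?g0//.
    have := nnfun_muleindic_ge0 h r (phi x); by rewrite lee_fin.
apply: eq_fsbigr => r _.
have mr : measurable (h @^-1` [set r]) by exact: measurable_sfunP.
have [->|r0] := eqVneq r 0%R.
  by rewrite !integral0_eq// => x _; rewrite ?mul0r ?mulr0.
have [rn|rn] := ltP r 0%R.
  rewrite preimage_nnfun0//.
  by rewrite !integral0_eq// => x _; rewrite indic0 ?mul0r ?mulr0.
under eq_integral do rewrite EFinM.
rewrite ge0_integralZl//; last exact/measurable_EFinP.
rewrite integral_indic// setIT mE//.
rewrite -ge0_integralZl//; last 2 first.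
  - apply/measurable_EFinP/measurable_funM => //; apply: measurable_funTS.
    exact: measurableT_comp.
  - by move=> x Dx; rewrite lee_fin mulr_ge0 ?g0.
by apply: eq_integral => x _; rewrite -EFinM; congr (_%:E); ring.
Qed.

(** From indicators to simple functions to monotone limits. It serves twice: for the surface measure
    in spherical coordinates, and for the measure of pairs of points with the two-point intensity as
    density. *)
Lemma ge0_integral_density (f : T2 -> \bar R) :
  measurable_fun setT f -> (forall y, 0 <= f y) ->
  \int[m]_y f y = \int[mu]_(x in D) (f (phi x) * (g x)%:E).
Proof.
move=> mf f0; pose f_ := nnsfun_approx measurableT mf.
transitivity (limn (fun n => \int[m]_y (f_ n y)%:E)).
  rewrite -monotone_convergence//.
  - apply: eq_integral => y _; apply/esym/cvg_lim => //.
    by apply: cvg_nnsfun_approx => // *; apply: f0.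
  - by move=> n; exact/measurable_EFinP.
  - by move=> n y _; rewrite lee_fin.
  - by move=> y _ a b ab; rewrite lee_fin; exact/lefP/nd_nnsfun_approx.
under eq_fun do rewrite integral_density_nnsfun.
rewrite -monotone_convergence//.
- apply: eq_integral => x /[!inE] Dx; apply/cvg_lim => //.
  under eq_fun do rewrite EFinM.
  apply: cvgeZr => //; apply: cvg_nnsfun_approx => // *; exact: f0.
- move=> n; apply/measurable_EFinP/measurable_funM => //; apply: measurable_funTS.
  exact: measurableT_comp.
- by move=> n x Dx; rewrite lee_fin mulr_ge0 ?g0.
- move=> x Dx a b ab; rewrite lee_fin ler_wpM2r ?g0//; exact/lefP/nd_nnsfun_approx.
Qed.

End DensityPushforward.

(** On a set of finite measure the constant C dominates the derivative, so the integral may be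
    differentiated and has derivative 0. The parameter will be the polar angle of a pole, then the
    dilation factor of a circle. *)
Lemma Rintegral_parameter_cst d (Y : measurableType d) (R : realType)
    (mu : {measure set Y -> \bar R}) (B : set Y) (f df : R -> Y -> R) (u v C : R) :
  measurable B -> (mu B < +oo)%E ->
  (forall x, x \in `]u, v[ -> measurable_fun B (f x)) ->
  (forall x y, x \in `]u, v[ -> B y -> `|f x y| <= C) ->
  (forall x y, x \in `]u, v[ -> B y -> is_derive x 1 (f^~ y) (df x y)) ->
  (forall x y, x \in `]u, v[ -> B y -> `|df x y| <= C) ->
  (forall x, x \in `]u, v[ -> \int[mu]_(y in B) df x y = 0) ->
  forall a b, a \in `]u, v[ -> b \in `]u, v[ ->
  \int[mu]_(y in B) f a y = \int[mu]_(y in B) f b y.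
Proof.
move=> mB Boo mf fC fd dfC df0.
have intf x : x \in `]u, v[ -> mu.-integrable B (EFin \o f x).
  move=> xuv; apply: measurable_bounded_integrable => //; first exact: mf.
  exists C; split; first exact: num_real.
  by move=> M CM y By /=; apply: (le_trans (fC _ _ xuv By)); exact: ltW.
have intC : mu.-integrable B (EFin \o cst `|C|).
  by apply: measurable_bounded_integrable => //; exact: bounded_cst.
have df1 x y : x \in `]u, v[ -> B y -> (f^~ y)^`()%classic x = df x y.
  by move=> xuv By; have [_] := fd _ _ xuv By; rewrite derive1E.
have F x : x \in `]u, v[ -> is_derive x 1 (fun x => \int[mu]_(y in B) f x y) 0.
  move=> xuv.
  have h1 : forall x, `]u, v[%classic x -> mu.-integrable B (EFin \o f x) by move=> z zz; exact: intf.
  have h2 : forall x y, `]u, v[%classic x -> B y -> derivable (f^~ y) x 1.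
    by move=> z y zz By; have [] := fd _ _ zz By.
  have h3 : forall x y, `]u, v[%classic x -> B y -> `|(f^~ y)^`()%classic x| <= cst `|C| y.
    by move=> z y zz By; rewrite df1// (le_trans (dfC _ _ zz By))// ler_norm.
  have h4 (y : Y) : 0 <= cst `|C| y :> R by rewrite normr_ge0.
  apply: DeriveDef; first exact: (derivable_under_integral mB xuv h1 h2 h4 intC h3).
  rewrite -derive1E (differentiation_under_integral mB xuv h1 h2 h4 intC h3).
  rewrite -(df0 x xuv); apply: eq_Rintegral => y; rewrite inE => By.
  by rewrite partial1of2E -derive1E df1.
have main a b : a <= b -> a \in `]u, v[ -> b \in `]u, v[ ->
    \int[mu]_(y in B) f a y = \int[mu]_(y in B) f b y.
  move=> ab; rewrite !in_itv/= => /andP[ua av] /andP[ub bv].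
  have ii x : x \in `[a, b] -> x \in `]u, v[.
    by rewrite !in_itv/= => /andP[/(lt_le_trans ua) -> /le_lt_trans ->].
  have cF : {within `[a, b], continuous (fun x => \int[mu]_(y in B) f x y)}.
    by apply: derivable_within_continuous => x xab; have [] := F _ (ii _ xab).
  have dF x : x \in `]a, b[ -> is_derive x 1 (fun x => \int[mu]_(y in B) f x y) ((fun=> 0) x).
    by move=> xab; apply: F; apply: ii; exact: subset_itv_oo_cc xab.
  have [c _] := MVT_segment ab dF cF.
  by rewrite mul0r => /eqP; rewrite subr_eq0 => /eqP ->.
move=> a b aI bI; have [ab|/ltW ba] := leP a b; first exact: main.
by apply/esym/main.
Qed.

Section IntervalFTC.
Context {R : realType}.
Notation mu := (@lebesgue_measure R).

Lemma integral_itv_derive (f F : R -> R) (a b : R) : a < b ->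
  (forall x, a <= x <= b -> is_derive x 1 F (f x)) ->
  (forall x, a <= x <= b -> {for x, continuous f}) ->
  (\int[mu]_(x in `[a, b]) (f x)%:E = (F b - F a)%:E)%E.
Proof.
move=> ab dF cf.
have cF x : a <= x <= b -> {for x, continuous F}.
  by move=> xab; apply/differentiable_continuous/derivable1_diffP; have [] := dF x xab.
rewrite (@continuous_FTC2 R f F a b) ?EFinB//.
- apply: continuous_in_subspaceT => x; rewrite inE/= in_itv/= => xab; exact: cf.
- split.
  + move=> x; rewrite in_itv/= => /andP[/ltW xa /ltW xb].
    have xab : a <= x <= b by rewrite xa xb.
    by have [] := dF x xab.
  + by apply: cvg_at_right_filter; apply: cF; rewrite lexx ltW.
  + by apply: cvg_at_left_filter; apply: cF; rewrite lexx ltW.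
- move=> x; rewrite in_itv/= => /andP[/ltW xa /ltW xb]; rewrite derive1E.
  have xab : a <= x <= b by rewrite xa xb.
  by have [_ ->] := dF x xab.
Qed.

Lemma Rintegral_itv_derive (f F : R -> R) (a b : R) : a < b ->
  (forall x, a <= x <= b -> is_derive x 1 F (f x)) ->
  (forall x, a <= x <= b -> {for x, continuous f}) ->
  \int[mu]_(x in `[a, b]) f x = F b - F a.
Proof. by move=> *; rewrite /Rintegral (@integral_itv_derive f F). Qed.

End IntervalFTC.

Section IntegralSetX.
Local Open Scope ereal_scope.
Context d1 d2 (T1 : measurableType d1) (T2 : measurableType d2) (R : realType).
Variable m1 : {sigma_finite_measure set T1 -> \bar R}.
Variable m2 : {sigma_finite_measure set T2 -> \bar R}.
Variables (A : set T1) (B : set T2) (h : T1 * T2 -> \bar R).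
Hypotheses (mA : measurable A) (mB : measurable B).

Let patch_setX x y :
  (h \_ (A `*` B)) (x, y) = if x \in A then ((fun z => h (x, z)) \_ B) y else 0.
Proof.
rewrite !patchE; have [xA|xA] := boolP (x \in A).
  congr (if _ then _ else _); apply/idP/idP => [/set_mem[_ By]|/set_mem By]; apply/mem_set => //.
  by split => //; exact/set_mem.
rewrite memNset// => -[/= Ax _]; by move: xA; rewrite mem_set.
Qed.

Let patch_setX' x y :
  (h \_ (A `*` B)) (x, y) = if y \in B then ((fun z => h (z, y)) \_ A) x else 0.
Proof.
rewrite !patchE; have [yB|yB] := boolP (y \in B).
  congr (if _ then _ else _); apply/idP/idP => [/set_mem[Ax _]|/set_mem Ax]; apply/mem_set => //.
  by split => //; exact/set_mem.
rewrite memNset// => -[/= _ By]; by move: yB; rewrite mem_set.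
Qed.

Hypothesis ih : (m1 \x m2).-integrable (A `*` B) h.

Let ihp : (m1 \x m2).-integrable setT (h \_ (A `*` B)).
Proof. by apply/(integrable_mkcond _ (measurableX mA mB)). Qed.

Lemma integral_setX1 :
  \int[m1 \x m2]_(p in A `*` B) h p = \int[m1]_(x in A) \int[m2]_(y in B) h (x, y).
Proof.
rewrite integral_mkcond -(integral12_prod_meas1 ihp) [RHS]integral_mkcond.
apply: eq_integral => x _; rewrite /fubini_F patchE.
under eq_integral do rewrite patch_setX.
by case: ifPn => _; [rewrite -integral_mkcond | rewrite integral0].
Qed.

Lemma integral_setX2 :
  \int[m1 \x m2]_(p in A `*` B) h p = \int[m2]_(y in B) \int[m1]_(x in A) h (x, y).
Proof.
rewrite integral_mkcond -(integral21_prod_meas1 ihp) [RHS]integral_mkcond.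
apply: eq_integral => y _; rewrite /fubini_G patchE.
under eq_integral do rewrite patch_setX'.
by case: ifPn => _; [rewrite -integral_mkcond | rewrite integral0].
Qed.

End IntegralSetX.

(** * The surface measure in spherical coordinates *)

Section SurfaceIntegral.
Context {R : realType}.
Local Notation mu := (@lebesgue_measure R).
Local Notation mu2 := (mu \x mu)%E.

Lemma measurable_sin : measurable_fun setT (@sin R).
Proof. by apply: continuous_measurable_fun; exact: continuous_sin. Qed.

Lemma measurable_cos : measurable_fun setT (@cos R).
Proof. by apply: continuous_measurable_fun; exact: continuous_cos. Qed.

Let mfst (f : R -> R) : measurable_fun setT f -> measurable_fun setT (fun p : R * R => f p.1).
Proof. by move=> mf; exact: measurableT_comp. Qed.

Let msnd (f : R -> R) : measurable_fun setT f -> measurable_fun setT (fun p : R * R => f p.2).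
Proof. by move=> mf; exact: measurableT_comp. Qed.

Lemma measurable_spherical : measurable_fun setT (@spherical R).
Proof.
have msin := measurable_sin; have mcos := measurable_cos.
apply: measurable_cons; first by apply: measurable_funM; [exact: mfst|exact: msnd].
apply: measurable_cons; first by apply: measurable_funM; [exact: mfst|exact: msnd].
by apply: measurable_cons; [exact: mfst | exact: measurable_cst].
Qed.

Lemma measurable_spherical_dom : measurable (@spherical_dom R).
Proof. exact: measurableX. Qed.

Lemma sin_spherical_dom_ge0 (p : R * R) : spherical_dom p -> 0 <= sin p.1.
Proof. by case=> + _; rewrite /= in_itv/=; exact: sin_ge0_pi. Qed.

Lemma spherical_unit (p : R * R) : unit_sphere 3 (spherical p).
Proof.
rewrite /unit_sphere /= /dot !big_ord_recl !big_ord0 !(tnth_nth 0) /=.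
have h1 := cos2Dsin2 p.1; have h2 := cos2Dsin2 p.2.
transitivity (sin p.1 ^+ 2 * (cos p.2 ^+ 2 + sin p.2 ^+ 2) + cos p.1 ^+ 2); first by ring.
by rewrite h2 mulr1 addrC.
Qed.

Lemma ge0_integral_surface (f : 3.-tuple R -> \bar R) :
  measurable_fun setT f -> (forall y, (0 <= f y)%E) ->
  (\int[surface_measure]_y f y =
   \int[mu2]_(p in spherical_dom) (f (spherical p) * (sin p.1)%:E))%E.
Proof.
move=> mf f0; apply: ge0_integral_density => //.
- exact: measurable_spherical_dom.
- exact: measurable_spherical.
- by apply: measurable_funTS; apply: mfst; exact: measurable_sin.
- by move=> p; exact: sin_spherical_dom_ge0.
- move=> B mB; transitivity (\int[mu2]_(p in spherical_dom)
    ((fun p : R * R => (sin p.1)%:E) \_ (spherical @^-1` B)) p)%E.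
    exact: integral_mkcondr.
  apply: eq_integral => p _; rewrite patchE indicE -[p \in _]/(spherical p \in B).
  by case: ifPn; rewrite (mul1r, mul0r).
Qed.

Lemma spherical_dom_measure : mu2 spherical_dom = (pi * (2 * pi))%:E.
Proof.
rewrite /spherical_dom product_measure1E//= !lebesgue_measure_itv/= !lte_fin pi_gt0.
by rewrite mulr_gt0 ?pi_gt0// !sube0 EFinM.
Qed.

(** Prepares the finite-measure instance below, through which Tonelli applies to pairs of points of
    the sphere. *)
Lemma surface_measure_fin : fin_num_fun (@surface_measure R).
Proof.
move=> B mB; rewrite ge0_fin_numE//.
apply: (@le_lt_trans _ _ (surface_measure [set: 3.-tuple R])).
  by apply: le_measure; rewrite ?inE.
rewrite -[X in (X < _)%E]mul1e -integral_cst// ge0_integral_surface//.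
apply: (@le_lt_trans _ _ (\int[mu2]_(p in spherical_dom) (cst 1%:E p))%E).
  apply: ge0_le_integral => //.
  - exact: measurable_spherical_dom.
  - by move=> p /sin_spherical_dom_ge0 p0; rewrite mul1e lee_fin.
  - apply: measurable_funTS; apply/measurable_EFinP; under eq_fun do rewrite mul1r; apply: mfst; exact: measurable_sin.
  - by move=> p _; rewrite mul1e lee_fin sin_le1.
rewrite integral_cst; last exact: measurable_spherical_dom.
by rewrite mul1e; exact: (eq_ind_r (fun z => (z < +oo)%E) (ltry _) spherical_dom_measure).
Qed.

HB.instance Definition _ := @Measure_isFinite.Build _ _ _ (@surface_measure R) surface_measure_fin.

End SurfaceIntegral.

Section SurfaceIntegralSigned.
Context {R : realType}.
Local Notation mu := (@lebesgue_measure R).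
Local Notation mu2 := (mu \x mu)%E.

(** Positivity on the sphere alone suffices because the surface measure lives there. The determinant
    of the ensemble is such an integrand: outside the sphere its sign is not controlled. *)
Lemma integral_surface (f : 3.-tuple R -> \bar R) :
  measurable_fun setT f -> (forall y, unit_sphere 3 y -> (0 <= f y)%E) ->
  (\int[surface_measure]_y f y =
   \int[mu2]_(p in spherical_dom) (f (spherical p) * (sin p.1)%:E))%E.
Proof.
move=> mf f0; rewrite integralE.
rewrite (@ge0_integral_surface R (f^\+)%E); last 2 first.
- exact: measurable_funepos.
- by move=> y; exact: funepos_ge0.
rewrite (@ge0_integral_surface R (f^\-)%E); last 2 first.
- exact: measurable_funeneg.
- by move=> y; exact: funeneg_ge0.
rewrite [X in (_ - X)%E]integral0_eq ?sube0; last first.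
  move=> p _; rewrite funenegE (max_idPr _) ?mul0e// oppe_le0 f0//.
  exact: spherical_unit.
apply: eq_integral => p _; congr (_ * _)%E; rewrite funeposE (max_idPl _)// f0//.
exact: spherical_unit.
Qed.

End SurfaceIntegralSigned.

(** * Zonal integrals do not depend on the pole *)

Section Zonal.
Context {R : realType}.
Local Notation mu := (@lebesgue_measure R).
Local Notation mu2 := (mu \x mu)%E.
Implicit Types (G : R -> R) (a psi : R) (p : R * R).

Lemma continuous_itv_bounded (g : R -> R) (a b : R) : a <= b ->
  (forall x, a <= x <= b -> {for x, continuous g}) ->
  exists M, forall x, a <= x <= b -> `|g x| <= M.
Proof.
move=> ab cg; have cg' : {within `[a, b], continuous (fun x => `|g x|)}.
  apply: continuous_in_subspaceT => x; rewrite inE/= in_itv/= => xab.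
  by apply: continuous_comp; [exact: cg | exact: norm_continuous].
have [c _ h] := EVT_max ab cg'.
by exists `|g c| => x xab; apply: h; rewrite in_itv.
Qed.

(* The cosine of the angle between the points with spherical coordinates
   [(a, psi)] and [p]. *)
Definition sph_cos a psi p : R :=
  sin a * (sin p.1 * cos (p.2 - psi)) + cos a * cos p.1.

Lemma dot_spherical (p' p : R * R) : dot (spherical p') (spherical p) = sph_cos p'.1 p'.2 p.
Proof.
rewrite /dot !big_ord_recl !big_ord0 !(tnth_nth 0) /= /sph_cos cosB; ring.
Qed.

Lemma sph_cos_bound a psi p : -1 <= sph_cos a psi p <= 1.
Proof.
rewrite /sph_cos; have h1 := cos2Dsin2 a; have h2 := cos2Dsin2 p.1.
have h3 := cos2Dsin2 (p.2 - psi).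
set c := cos (p.2 - psi) in h3 *; have c1 : c ^+ 2 <= 1 by rewrite -h3 lerDl sqr_ge0.
set u := sin p.1 in h2 *; set v := cos p.1 in h2 *; set s := sin a in h1 *; set t := cos a in h1 *.
have uc : (u * c) ^+ 2 + v ^+ 2 <= 1.
  by rewrite -h2 addrC lerD2l exprMn ler_piMr ?sqr_ge0.
have e : (s * (u * c) + t * v) ^+ 2 + (s * v - t * (u * c)) ^+ 2 = (u * c) ^+ 2 + v ^+ 2.
  by rewrite -[RHS]mul1r -h1; ring.
have := sqr_ge0 (s * v - t * (u * c)) => h4.
by apply/andP; split; nra.
Qed.

(** The derivative of [sph_cos] in a. It is [sph_cos] with a replaced by a + pi / 2, whence its
    bound. *)
Let du a psi p : R := cos a * (sin p.1 * cos (p.2 - psi)) - sin a * cos p.1.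

Let du_bound a psi p : `|du a psi p| <= 1.
Proof.
have := sph_cos_bound (a + pi / 2) psi p.
rewrite /sph_cos sinDpihalf cosDpihalf mulNr -/(du a psi p).
by rewrite ler_norml.
Qed.

Let is_derive_u a psi p : is_derive a 1 (fun a => sph_cos a psi p) (du a psi p).
Proof.
rewrite /sph_cos /du.
apply: (is_derive_eq (is_derive1D (is_derive1Mr _ (is_derive_sin a)) (is_derive1Mr _ (is_derive_cos a)))).
by rewrite mulNr.
Qed.


Variables (G G' : R -> R).
Hypothesis dG : forall t : R, -1 <= t <= 1 -> is_derive t 1 G (G' t).
Hypothesis cG' : forall t : R, -1 <= t <= 1 -> {for t, continuous G'}.

Let cG (t : R) : -1 <= t <= 1 -> {for t, continuous G}.
Proof. by move=> /dG /is_derive1_continuous. Qed.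

Let mfst (f : R -> R) : continuous f -> measurable_fun setT (fun p : R * R => f p.1).
Proof. by move=> /continuous_measurable_fun mf; exact: measurableT_comp. Qed.

Let m_u a psi : measurable_fun setT (sph_cos a psi).
Proof.
apply: measurable_funD; apply: measurable_funM => //.
  apply: measurable_funM; first exact: (mfst (@continuous_sin R)).
  apply: measurableT_comp; first exact: measurable_cos.
  by apply: measurable_funB => //; exact: measurable_snd.
exact: (mfst (@continuous_cos R)).
Qed.

Let m_itv (g : R -> R) a psi : (forall t : R, -1 <= t <= 1 -> {for t, continuous g}) ->
  measurable_fun setT (fun p => g (sph_cos a psi p)).
Proof.
move=> cg.
have mg : measurable_fun `[-1, (1 : R)]%classic g.
  apply: subspace_continuous_measurable_fun => //; apply: continuous_in_subspaceT => x.
  by rewrite inE/= in_itv/= => ?; exact: cg.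
have sub : sph_cos a psi @` setT `<=` `[-1, (1 : R)]%classic.
  by move=> _ [p _ <-]; rewrite /= in_itv/= sph_cos_bound.
exact: (measurable_comp _ sub mg (m_u a psi)).
Qed.

Let f a psi p := G (sph_cos a psi p) * sin p.1.
Let df a psi p := G' (sph_cos a psi p) * du a psi p * sin p.1.
Let c_ psi p := cos (p.2 - psi).
Let s_ psi p := sin (p.2 - psi).
Let A1 a psi p := G' (sph_cos a psi p) * (sin a * (cos p.1 * c_ psi p) - cos a * sin p.1) * (c_ psi p * sin p.1)
  + G (sph_cos a psi p) * (c_ psi p * cos p.1).
Let A2 a psi p := G' (sph_cos a psi p) * (- (sin a * (sin p.1 * s_ psi p))) * (cos p.1 * s_ psi p)
  + G (sph_cos a psi p) * (cos p.1 * c_ psi p).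

(* Rotating the pole moves the integrand along a divergence-free vector field. *)
Let dfE a psi p : df a psi p = A2 a psi p - A1 a psi p.
Proof.
rewrite /df /A1 /A2 /du -/(c_ psi p).
have : c_ psi p ^+ 2 + s_ psi p ^+ 2 = 1 by exact: cos2Dsin2.
move: (G' _) (G _) (c_ psi p) (s_ psi p) => g' g c s h.
transitivity (g' * sin p.1 * (cos a * sin p.1 * c - sin a * cos p.1 * (c ^+ 2 + s ^+ 2))); last by ring.
by rewrite h; ring.
Qed.

Let dom_fin : (mu2 (@spherical_dom R) < +oo)%E.
Proof. exact: (eq_ind_r (fun z => (z < +oo)%E) (ltry _) spherical_dom_measure). Qed.

Let bounded_integrable (g : R * R -> R) (M : R) : measurable_fun setT g ->
  (forall p, `|g p| <= M) -> mu2.-integrable spherical_dom (EFin \o g).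
Proof.
move=> mg gM; apply: measurable_bounded_integrable => //.
- exact: measurable_spherical_dom.
- exact: measurable_funTS.
- exists M; split; first exact: num_real.
  by move=> N MN p _ /=; apply: (le_trans (gM p)); exact: ltW.
Qed.

Let twopi_gt0 : 0 < 2 * pi :> R. Proof. by rewrite mulr_gt0 ?pi_gt0. Qed.

Let is_derive_shift psi (t : R) : is_derive t 1 (fun y : R => y - psi) 1.
Proof.
by apply: (is_derive_eq (is_derive1B (is_derive1_id t) (is_derive1_cst psi t))); rewrite subr0.
Qed.

Let c_derive psi (x y : R) : is_derive y 1 (fun y => c_ psi (x, y)) (- s_ psi (x, y)).
Proof.
apply: (is_derive_eq (@is_derive1_chain _ cos (fun y => y - psi) y _ _ (is_derive_cos _) (is_derive_shift psi y))).
by rewrite mulr1.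
Qed.

Let s_derive psi (x y : R) : is_derive y 1 (fun y => s_ psi (x, y)) (c_ psi (x, y)).
Proof.
apply: (is_derive_eq (@is_derive1_chain _ sin (fun y => y - psi) y _ _ (is_derive_sin _) (is_derive_shift psi y))).
by rewrite mulr1.
Qed.

Let u_derive1 a psi (x y : R) : is_derive x 1 (fun x => sph_cos a psi (x, y))
  (sin a * (cos x * c_ psi (x, y)) - cos a * sin x).
Proof.
rewrite /sph_cos /c_ /=.
apply: (is_derive_eq (is_derive1D (is_derive1Ml _ (is_derive1Mr _ (is_derive_sin x))) (is_derive1Ml _ (is_derive_cos x)))).
by rewrite mulrN.
Qed.

Let u_derive2 a psi (x y : R) : is_derive y 1 (fun y => sph_cos a psi (x, y))
  (- (sin a * (sin x * s_ psi (x, y)))).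
Proof.
have h := is_derive1D (is_derive1Ml (sin a) (is_derive1Ml (sin x) (c_derive psi x y))) (is_derive1_cst (cos a * cos x) y).
by apply: (is_derive_eq h); rewrite addr0 !mulrN.
Qed.

(** [A1] is the derivative along a meridian of a function with a factor sin, zero at both poles;
    [A2], treated next, is the derivative along a parallel of a function of period 2 pi. *)
Let int_A1 a psi (y : R) : (\int[mu]_(x in `[0%R, pi]) (A1 a psi (x, y))%:E = 0)%E.
Proof.
have dF (x : R) : 0 <= x <= pi -> is_derive x 1 (fun x => G (sph_cos a psi (x, y)) * (c_ psi (x, y) * sin x)) (A1 a psi (x, y)).
  move=> _; have h1 := @is_derive1_chain _ G (fun x => sph_cos a psi (x, y)) x _ _ (dG (sph_cos_bound a psi (x, y))) (u_derive1 a psi x y).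
  exact: (is_derive1M h1 (is_derive1Ml (c_ psi (x, y)) (is_derive_sin x))).
have cF (x : R) : 0 <= x <= pi -> {for x, continuous (fun x => A1 a psi (x, y))}.
  move=> _; have cu := is_derive1_continuous (u_derive1 a psi x y).
  have b := sph_cos_bound a psi (x, y).
  have cg' := @continuous_at1_chain _ G' (fun x => sph_cos a psi (x, y)) x (cG' b) cu.
  have cg := @continuous_at1_chain _ G (fun x => sph_cos a psi (x, y)) x (cG b) cu.
  have h1 := is_derive1_continuous (is_derive1B (is_derive1Ml (sin a) (is_derive1Mr (c_ psi (x, y)) (is_derive_cos x))) (is_derive1Ml (cos a) (is_derive_sin x))).
  have h2 := is_derive1_continuous (is_derive1Ml (c_ psi (x, y)) (is_derive_sin x)).
  have h3 := is_derive1_continuous (is_derive1Ml (c_ psi (x, y)) (is_derive_cos x)).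
  exact: (continuous_at1D (continuous_at1M (continuous_at1M cg' h1) h2) (continuous_at1M cg h3)).
rewrite (integral_itv_derive (pi_gt0 R) dF cF).
by rewrite sinpi sin0 !mulr0 subrr.
Qed.

Let int_A2 a psi (x : R) : (\int[mu]_(y in `[0%R, (2 * pi)%R]) (A2 a psi (x, y))%:E = 0)%E.
Proof.
have per (F : R -> R -> R) : F (cos (2 * pi - psi)) (sin (2 * pi - psi)) = F (cos (0 - psi)) (sin (0 - psi)).
  have -> : 2 * pi - psi = (0 - psi) + pi *+ 2 :> R by rewrite mulr2n; ring.
  by rewrite sinD2pi cosD2pi.
have dF (y : R) : 0 <= y <= 2 * pi -> is_derive y 1 (fun y => G (sph_cos a psi (x, y)) * (cos x * s_ psi (x, y))) (A2 a psi (x, y)).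
  move=> _; have h1 := @is_derive1_chain _ G (fun y => sph_cos a psi (x, y)) y _ _ (dG (sph_cos_bound a psi (x, y))) (u_derive2 a psi x y).
  exact: (is_derive1M h1 (is_derive1Ml (cos x) (s_derive psi x y))).
have cF (y : R) : 0 <= y <= 2 * pi -> {for y, continuous (fun y => A2 a psi (x, y))}.
  move=> _; have cu := is_derive1_continuous (u_derive2 a psi x y).
  have b := sph_cos_bound a psi (x, y).
  have cg' := @continuous_at1_chain _ G' (fun y => sph_cos a psi (x, y)) y (cG' b) cu.
  have cg := @continuous_at1_chain _ G (fun y => sph_cos a psi (x, y)) y (cG b) cu.
  have h1 := is_derive1_continuous (is_derive1N (is_derive1Ml (sin a) (is_derive1Ml (sin x) (s_derive psi x y)))).
  have h2 := is_derive1_continuous (is_derive1Ml (cos x) (s_derive psi x y)).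
  have h3 := is_derive1_continuous (is_derive1Ml (cos x) (c_derive psi x y)).
  exact: (continuous_at1D (continuous_at1M (continuous_at1M cg' h1) h2) (continuous_at1M cg h3)).
rewrite (integral_itv_derive twopi_gt0 dF cF).
rewrite /sph_cos /s_ /= (per (fun c s => G (sin a * (sin x * c) + cos a * cos x) * (cos x * s))).
by rewrite subrr.
Qed.

Let bounds : exists M, forall t : R, -1 <= t <= 1 -> `|G t| <= M /\ `|G' t| <= M.
Proof.
have N11 : -1 <= 1 :> R by lra.
have [M1 h1] := continuous_itv_bounded N11 cG.
have [M2 h2] := continuous_itv_bounded N11 cG'.
exists (Num.max M1 M2) => t t1; rewrite !le_max h1// h2// orbT; split => //.
Qed.

Let norm_sin (x : R) : `|sin x| <= 1.
Proof. by rewrite ler_norml sin_geN1 sin_le1. Qed.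
Let norm_cos (x : R) : `|cos x| <= 1.
Proof. by rewrite ler_norml cos_geN1 cos_le1. Qed.

Let norm_mul_le (x y M N : R) : `|x| <= M -> `|y| <= N -> `|x * y| <= M * N.
Proof. by move=> xM yN; rewrite normrM ler_pM. Qed.

Let norm_add_le (x y M N : R) : `|x| <= M -> `|y| <= N -> `|x + y| <= M + N.
Proof. by move=> xM yN; rewrite (le_trans (ler_normD _ _))// lerD. Qed.

Let m_c psi : measurable_fun setT (c_ psi).
Proof.
apply: measurableT_comp; first exact: measurable_cos.
by apply: measurable_funB => //; exact: measurable_snd.
Qed.

Let m_s psi : measurable_fun setT (s_ psi).
Proof.
apply: measurableT_comp; first exact: measurable_sin.
by apply: measurable_funB => //; exact: measurable_snd.
Qed.

Let m_sin1 : measurable_fun setT (fun p : R * R => sin p.1).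
Proof. exact: (mfst (@continuous_sin R)). Qed.
Let m_cos1 : measurable_fun setT (fun p : R * R => cos p.1).
Proof. exact: (mfst (@continuous_cos R)). Qed.

Let int_df a psi : \int[mu2]_(p in spherical_dom) df a psi p = 0.
Proof.
have [M bM] := bounds.
have M0 : 0 <= M by have [h _] := bM 0 ltac:(lra); rewrite (le_trans _ h).
have iA1 : mu2.-integrable spherical_dom (EFin \o A1 a psi).
  apply: (@bounded_integrable _ (M * (1 * (1 * 1) + 1 * 1) * (1 * 1) + M * (1 * 1))).
    apply: measurable_funD; apply: measurable_funM.
    - apply: measurable_funM; first exact: m_itv.
      by apply: measurable_funB; repeat apply: measurable_funM => //.
    - exact: measurable_funM.
    - exact: m_itv.
    - exact: measurable_funM.
  move=> p; have [h1 h2] := bM _ (sph_cos_bound a psi p).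
  apply: norm_add_le; last by do 2 (apply: norm_mul_le => //); exact: norm_cos.
  apply: norm_mul_le; last by apply: norm_mul_le; [exact: norm_cos | exact: norm_sin].
  apply: norm_mul_le => //; apply: norm_add_le; first by do 2 (apply: norm_mul_le => //); exact: norm_cos.
  by rewrite normrN; apply: norm_mul_le.
have iA2 : mu2.-integrable spherical_dom (EFin \o A2 a psi).
  apply: (@bounded_integrable _ (M * (1 * (1 * 1)) * (1 * 1) + M * (1 * 1))).
    apply: measurable_funD; apply: measurable_funM.
    - apply: measurable_funM; first exact: m_itv.
      by apply: measurable_funN; repeat apply: measurable_funM => //.
    - exact: measurable_funM.
    - exact: m_itv.
    - exact: measurable_funM.
  move=> p; have [h1 h2] := bM _ (sph_cos_bound a psi p).
  apply: norm_add_le; last by do 2 (apply: norm_mul_le => //); exact: norm_cos.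
  apply: norm_mul_le; last by apply: norm_mul_le; [exact: norm_cos | exact: norm_sin].
  apply: norm_mul_le => //; rewrite normrN.
  by do 2 (apply: norm_mul_le => //); exact: norm_sin.
rewrite /Rintegral; under eq_integral do rewrite dfE EFinB.
rewrite integralB//; last exact: measurable_spherical_dom.
rewrite /spherical_dom integral_setX1// integral_setX2//.
under eq_integral do rewrite int_A2.
under [X in (_ - X)%E]eq_integral do rewrite int_A1.
by rewrite !integral0 sube0.
Qed.

Let m_f a psi : measurable_fun setT (f a psi).
Proof. by apply: measurable_funM => //; exact: m_itv. Qed.

Let int_f a psi : mu2.-integrable spherical_dom (EFin \o f a psi).
Proof.
have [M bM] := bounds; apply: (@bounded_integrable _ (M * 1)) => // p.
by have [h1 h2] := bM _ (sph_cos_bound a psi p); exact: norm_mul_le.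
Qed.

(** The integral is constant in a, its derivative being the integral of [A2] minus that of [A1]. At
    a = 0 the cosine is cos p.1, and p.2 contributes the factor 2 pi. *)
Lemma zonal_integral_C1 a psi :
  (\int[mu2]_(p in spherical_dom) (G (sph_cos a psi p) * sin p.1)%:E =
   (2 * pi)%:E * \int[mu]_(x in `[0%R, pi]) (G (cos x) * sin x)%:E)%E.
Proof.
have [M bM] := bounds.
have M0 : 0 <= M by have [h _] := bM 0 ltac:(lra); rewrite (le_trans _ h).
pose v := `|a| + 1.
have aI : a \in `](- v), v[ by rewrite in_itv/= -ltr_norml /v ltrDl.
have zI : 0 \in `](- v), v[ by rewrite in_itv/= -ltr_norml normr0 /v (lt_le_trans ltr01)// lerDr.
have E : \int[mu2]_(p in spherical_dom) f a psi p = \int[mu2]_(p in spherical_dom) f 0 psi p.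
  apply: (@Rintegral_parameter_cst _ _ R mu2 spherical_dom (fun a => f a psi) (fun a => df a psi) (- v) v (M * 1 * 1)) => //.
  - exact: measurable_spherical_dom.
  - by move=> x _; apply: measurable_funTS; exact: m_f.
  - by move=> x p _ _; have [h1 h2] := bM _ (sph_cos_bound x psi p); rewrite mulr1; exact: norm_mul_le.
  - move=> x p _ _; rewrite /f /df.
    have h := @is_derive1_chain _ G (fun a => sph_cos a psi p) x _ _ (dG (sph_cos_bound x psi p)) (is_derive_u x psi p).
    exact: (is_derive1Mr (sin p.1) h).
  - move=> x p _ _; have [h1 h2] := bM _ (sph_cos_bound x psi p).
    by apply: norm_mul_le => //; exact: norm_mul_le.
have -> : (\int[mu2]_(p in spherical_dom) (f a psi p)%:E =
           \int[mu2]_(p in spherical_dom) (f 0 psi p)%:E)%E.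
  move: E; rewrite /Rintegral => E; rewrite -[LHS]fineK; last first.
    by apply: integrable_fin_num; [exact: measurable_spherical_dom | exact: int_f].
  rewrite -[RHS]fineK; last first.
    by apply: integrable_fin_num; [exact: measurable_spherical_dom | exact: int_f].
  by rewrite E.
rewrite /spherical_dom integral_setX1//; last exact: int_f.
have f0 x y : f 0 psi (x, y) = G (cos x) * sin x.
  by rewrite /f /sph_cos sin0 cos0 mul0r add0r mul1r.
have iG : mu.-integrable `[0%R, pi] (EFin \o (fun x => G (cos x) * sin x)).
  apply: measurable_bounded_integrable => //.
  - by rewrite /= lebesgue_measure_itv/= lte_fin pi_gt0 ltry.
  - apply: measurable_funM; last by apply: measurable_funTS; exact: measurable_sin.
    apply: subspace_continuous_measurable_fun => //; apply: continuous_in_subspaceT => x _.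
    have c1 : -1 <= cos x <= 1 by rewrite cos_geN1 cos_le1.
    exact: (@continuous_at1_chain _ G cos x (cG c1) (@continuous_cos R x)).
  - exists (M * 1); split; first exact: num_real.
    move=> N MN x _ /=; apply: le_trans (ltW MN).
    by apply: norm_mul_le => //; have [] := bM (cos x) ltac:(by rewrite cos_geN1 cos_le1).
rewrite -integralZl//; apply: eq_integral => x _.
under eq_integral do rewrite f0.
rewrite integral_cst//= lebesgue_measure_itv/= lte_fin twopi_gt0 sube0.
by rewrite -!EFinM mulrC.
Qed.

End Zonal.

Lemma cvg_integral_nondecreasing d (Y : measurableType d) (R : realType)
    (nu : {measure set Y -> \bar R}) (D : set Y) (gn : nat -> Y -> R) (g : Y -> R) :
  measurable D -> (forall n, measurable_fun D (gn n)) ->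
  (forall n y, D y -> 0 <= gn n y) ->
  (forall n m y, D y -> (n <= m)%N -> gn n y <= gn m y) ->
  (forall y, D y -> gn n y @[n --> \oo] --> g y) ->
  (\int[nu]_(y in D) (gn n y)%:E @[n --> \oo] --> \int[nu]_(y in D) (g y)%:E)%E.
Proof.
move=> mD mg g0 ndg cg.
have -> : (\int[nu]_(y in D) (g y)%:E = \int[nu]_(y in D) limn (fun n => (gn n y)%:E))%E.
  apply: eq_integral => y; rewrite inE => Dy; apply/esym/cvg_lim => //.
  by apply: cvg_EFin; [exact: nearW | exact: cg].
apply: (@cvg_monotone_convergence _ _ _ nu D mD (fun n y => (gn n y)%:E)).
- by move=> n; apply/measurable_EFinP; exact: mg.
- by move=> n y Dy; rewrite lee_fin g0.
- by move=> y Dy n m nm; rewrite lee_fin ndg.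
Qed.

(** * Zonal integrals with a square-root singularity *)

Section ZonalChord.
Context {R : realType}.
Local Notation mu := (@lebesgue_measure R).
Local Notation mu2 := (mu \x mu)%E.
Implicit Types (G : R -> R) (a psi t : R) (p : R * R).

Lemma measurable_sph_cos a psi : measurable_fun setT (@sph_cos R a psi).
Proof.
have msin := @measurable_sin R; have mcos := @measurable_cos R.
apply: measurable_funD; apply: measurable_funM => //.
  apply: measurable_funM; first exact: measurableT_comp.
  apply: measurableT_comp => //.
  by apply: measurable_funB => //; exact: measurable_snd.
exact: measurableT_comp.
Qed.

Lemma zonal_integral_nondecreasing (Gn : nat -> R -> R) G a psi :
  (forall n, measurable_fun setT (Gn n)) ->
  (forall n t, -1 <= t <= 1 -> 0 <= Gn n t) ->
  (forall n m t, -1 <= t <= 1 -> (n <= m)%N -> Gn n t <= Gn m t) ->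
  (forall t, -1 <= t <= 1 -> Gn n t @[n --> \oo] --> G t) ->
  (forall n, \int[mu2]_(p in spherical_dom) (Gn n (sph_cos a psi p) * sin p.1)%:E =
    (2 * pi)%:E * \int[mu]_(x in `[0%R, pi]) (Gn n (cos x) * sin x)%:E)%E ->
  (\int[mu2]_(p in spherical_dom) (G (sph_cos a psi p) * sin p.1)%:E =
    (2 * pi)%:E * \int[mu]_(x in `[0%R, pi]) (G (cos x) * sin x)%:E)%E.
Proof.
move=> mG G0 ndG cG zG.
have mdom := @measurable_spherical_dom R.
have c1 (x : R) : -1 <= cos x <= 1 by rewrite cos_geN1 cos_le1.
have s0 (x : R) : `[0, pi]%classic x -> 0 <= sin x by rewrite /= in_itv/=; exact: sin_ge0_pi.
have cl : (\int[mu2]_(p in spherical_dom) (Gn n (sph_cos a psi p) * sin p.1)%:E @[n --> \oo] -->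
           \int[mu2]_(p in spherical_dom) (G (sph_cos a psi p) * sin p.1)%:E)%E.
  apply: cvg_integral_nondecreasing => //.
  - move=> n; apply: measurable_funTS; apply: measurable_funM.
      by apply: measurableT_comp => //; exact: measurable_sph_cos.
    by apply: measurableT_comp => //; exact: measurable_sin.
  - by move=> n p Dp; rewrite mulr_ge0 ?G0 ?sph_cos_bound// sin_spherical_dom_ge0.
  - by move=> n m p Dp nm; rewrite ler_wpM2r ?ndG ?sph_cos_bound// sin_spherical_dom_ge0.
  - by move=> p Dp; apply: cvgMr_tmp; apply: cG; exact: sph_cos_bound.
have cr : (\int[mu]_(x in `[0%R, pi]) (Gn n (cos x) * sin x)%:E @[n --> \oo] -->
           \int[mu]_(x in `[0%R, pi]) (G (cos x) * sin x)%:E)%E.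
  apply: cvg_integral_nondecreasing => //.
  - move=> n; apply: measurable_funTS; apply: measurable_funM; last exact: measurable_sin.
    by apply: measurableT_comp => //; exact: measurable_cos.
  - by move=> n x Dx; rewrite mulr_ge0 ?G0 ?s0.
  - by move=> n m x Dx nm; rewrite ler_wpM2r ?ndG ?s0.
  - by move=> x Dx; apply: cvgMr_tmp; exact: cG.
have cr' := cvgeZl (y := (2 * pi)%:E) isT cr.
move: cl; under eq_fun do rewrite zG; move=> cl.
exact: cvg_unique cl cr'.
Qed.

Definition chord_half t : R := Num.sqrt ((1 - t) / 2).

(* Up to the shift by [ln 2], which makes it nonnegative, the phase average of
   [ln (1 / |p - q|)] over two fibres whose base points have scalar product [t]. *)
Definition pair_cost t : R := ln 2 - ln (1 + chord_half t) / 2.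

(** The square root in [pair_cost] is not differentiable at t = 1, so [zonal_integral_C1] does not
    apply to it. Adding 1 / (n + 1) under the root makes the function C^1 on [-1, 1], and the result
    increases with n to [pair_cost]. *)
Let hn (n : nat) t : R := ln 2 - ln (1 + Num.sqrt ((1 - t) / 2 + n.+1%:R^-1)) / 2.

Let x_bound n t : -1 <= t <= 1 -> 0 < (1 - t) / 2 + n.+1%:R^-1 <= 2.
Proof.
move=> /andP[t0 t1].
have n0 : 0 < n.+1%:R^-1 :> R by rewrite invr_gt0.
have n1 : n.+1%:R^-1 <= 1 :> R by rewrite invf_le1 ?ler1n ?ltr0n.
by move: n0 n1; move: (n.+1%:R^-1) => e e0 e1; lra.
Qed.

Let log_bound (x : R) : x <= 2 -> 0 <= ln (1 + Num.sqrt x) <= 2 * ln 2.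
Proof.
move=> x2; have s0 := sqrtr_ge0 x.
(* The crude bound 3 fits the shift exactly, half of ln (1 + 3) being ln 2; it leaves room for the
   regularized functions [hn]. *)
have s3 : Num.sqrt x <= 3.
  have -> : 3 = Num.sqrt 9 :> R.
    by have -> : 9 = 3 ^+ 2 :> R; [ring | rewrite sqrtr_sqr ger0_norm].
  by rewrite ler_sqrt//; lra.
rewrite ln_ge0 ?lerDl//=.
have -> : 2 * ln 2 = ln (2 ^+ 2) :> R by rewrite lnXn// mulr_natl.
by rewrite ler_ln ?posrE//; lra.
Qed.

Lemma pair_cost_ge0 t : -1 <= t -> 0 <= pair_cost t.
Proof.
move=> t1; rewrite /pair_cost /chord_half.
by have [|_] := andP (@log_bound ((1 - t) / 2) _); lra.
Qed.

Lemma measurable_chord_half : measurable_fun setT chord_half.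
Proof.
apply: measurableT_comp; first by apply: continuous_measurable_fun; exact: sqrt_continuous.
by apply: measurable_funM => //; exact: measurable_funB.
Qed.

Lemma measurable_pair_cost : measurable_fun setT pair_cost.
Proof.
apply: measurable_funB => //; apply: measurable_funM => //.
apply: measurableT_comp => //; apply: measurable_funD => //.
exact: measurable_chord_half.
Qed.

Lemma zonal_integral_pair_cost (K : {poly R}) a psi :
  (forall t, -1 <= t <= 1 -> 0 <= K.[t]) ->
  (\int[mu2]_(p in spherical_dom) (K.[sph_cos a psi p] * pair_cost (sph_cos a psi p) * sin p.1)%:E =
    (2 * pi)%:E * \int[mu]_(x in `[0%R, pi]) (K.[cos x] * pair_cost (cos x) * sin x)%:E)%E.
Proof.
move=> K0.
have mK : measurable_fun setT (horner K).
  by apply: continuous_measurable_fun; exact: continuous_horner.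
apply: (@zonal_integral_nondecreasing (fun n t => K.[t] * hn n t) (fun t => K.[t] * pair_cost t)).
- move=> n; apply: measurable_funM => //.
  apply: measurable_funB => //; apply: measurable_funM => //.
  apply: measurableT_comp => //; apply: measurable_funD => //.
  apply: measurableT_comp; first by apply: continuous_measurable_fun; exact: sqrt_continuous.
  by apply: measurable_funD => //; apply: measurable_funM => //; exact: measurable_funB.
- move=> n t t1; rewrite mulr_ge0 ?K0// /hn.
  by have /andP[_ /log_bound/andP[_]] := x_bound n t1; lra.
- move=> n m t t1 nm; rewrite ler_wpM2l ?K0// /hn lerD2l lerN2 ler_pM2r ?invr_gt0//.
  have pos (e : R) : 1 + Num.sqrt e \in Num.pos by rewrite posrE ltr_pwDl ?sqrtr_ge0.
  rewrite ler_ln ?pos// lerD2l ler_sqrt; last first.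
    by have /andP[/ltW] := x_bound n t1.
  by rewrite lerD2l lef_pV2 ?posrE// ler_nat.
- move=> t t1; apply: cvgMl_tmp; apply: cvgB; first exact: cvg_cst.
  apply: cvgMr_tmp.
  have cs : Num.sqrt ((1 - t) / 2 + n.+1%:R^-1) @[n --> \oo] --> chord_half t.
    apply: continuous_cvg; first exact: sqrt_continuous.
    rewrite -[X in _ --> X]addr0; apply: cvgD; first exact: cvg_cst.
    exact: cvg_harmonic.
  have s0 : 0 <= chord_half t by exact: sqrtr_ge0.
  apply: continuous_cvg; first by apply: continuous_ln; rewrite ltr_pwDl.
  by apply: cvgD => //; exact: cvg_cst.
- move=> n.
  pose x t := (1 - t) / 2 + n.+1%:R^-1 : R.
  pose s t := Num.sqrt (x t).
  pose h' t := - ((1 + s t)^-1 * ((2 * s t)^-1 * (- 1 / 2)) / 2).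
  pose G' t := K^`().[t] * hn n t + K.[t] * h' t.
  have dx t : is_derive t 1 x (- 1 / 2).
    apply: (is_derive_eq (is_derive1D (is_derive1Mr 2^-1 (is_derive1B (is_derive1_cst 1 t) (is_derive1_id t))) (is_derive1_cst n.+1%:R^-1 t))).
    by rewrite addr0 sub0r.
  have ds t : -1 <= t <= 1 -> is_derive t 1 s ((2 * s t)^-1 * (- 1 / 2)).
    move=> t1; have /andP[x0 _] := x_bound n t1.
    exact: (@is_derive1_chain _ Num.sqrt x t _ _ (is_derive1_sqrt x0) (dx t)).
  have dh t : -1 <= t <= 1 -> is_derive t 1 (hn n) (h' t).
    move=> t1; have s0 : 0 < 1 + s t by rewrite ltr_pwDl ?sqrtr_ge0.
    have h1 := is_derive1D (is_derive1_cst 1 t) (ds t t1).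
    have h2 := @is_derive1_chain _ (@ln R) (fun t => 1 + s t) t _ _ (is_derive1_ln s0) h1.
    apply: (is_derive_eq (is_derive1B (is_derive1_cst (ln 2) t) (is_derive1Mr 2^-1 h2))).
    by rewrite !add0r.
  apply: (@zonal_integral_C1 _ (fun t => K.[t] * hn n t) G').
    move=> t t1; exact: (is_derive1M (is_derive_poly K t) (dh t t1)).
  move=> t t1; have /andP[x0 _] := x_bound n t1.
  have st : 0 < s t by rewrite sqrtr_gt0.
  have c1 := is_derive1_continuous (ds t t1).
  have c2 := is_derive1_continuous (dh t t1).
  have c0 (c : R) : {for t, continuous (fun=> c)} by exact: is_derive1_continuous (is_derive1_cst c t).
  have c3 : {for t, continuous (fun t => (1 + s t)^-1)}.
    apply: (@continuousV _ _ (fun t => 1 + s t)); first by rewrite gt_eqF// addr_gt0.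
    exact: (continuous_at1D (c0 1) c1).
  have c4 : {for t, continuous (fun t => (2 * s t)^-1)}.
    apply: (@continuousV _ _ (fun t => 2 * s t)); first by rewrite gt_eqF// mulr_gt0.
    exact: (continuous_at1M (c0 2) c1).
  have c5 : {for t, continuous h'}.
    have c6 := continuous_at1M (continuous_at1M c3 (continuous_at1M c4 (c0 (- 1 / 2)))) (c0 2^-1).
    exact: (@continuousN _ _ _ _ t c6).
  exact: (continuous_at1D (continuous_at1M (@continuous_horner _ K^`() t) c2) (continuous_at1M (@continuous_horner _ K t) c5)).
Qed.

End ZonalChord.

(** * The radial integral of the pair cost *)

Section PairEnergy.
Context {R : realType}.
Local Notation mu := (@lebesgue_measure R).
Variable L : nat.
Local Notation Q := (@legendre_sum R L).

Let n : R := L.+1%:R.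
Let s (x : R) : R := sin (x / 2).

Lemma continuous_itv_integrable (f : R -> R) (a b : R) :
  (forall x : R, a <= x <= b -> {for x, continuous f}) -> mu.-integrable `[a, b] (EFin \o f).
Proof.
move=> cf; apply: continuous_compact_integrable; first exact: segment_compact.
by apply: continuous_in_subspaceT => x; rewrite inE/= in_itv/=; exact: cf.
Qed.

Let ds (x : R) : is_derive x (1 : R) s (cos (x / 2) / 2).
Proof.
have h := is_derive1Mr 2^-1 (is_derive1_id x).
by apply: (is_derive_eq (@is_derive1_chain _ sin (fun x => x / 2) x _ _ (is_derive_sin _) h)); rewrite mul1r.
Qed.

Let s01 (x : R) : 0 <= x <= pi -> 0 <= s x <= 1.
Proof. by move=> xpi; rewrite /s sin_le1 sin_ge0_pi//; lra. Qed.

Let sin_half x : sin x = 2 * s x * cos (x / 2).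
Proof.
have e : x = x / 2 + x / 2 by field.
by rewrite [in LHS]e sinD /s; ring.
Qed.

Let cos_half x : cos x = 1 - 2 * s x ^+ 2.
Proof.
have e : x = x / 2 + x / 2 by field.
by rewrite [in LHS]e cosD -!expr2 cos2sin2 /s; ring.
Qed.

Let chord_halfE (x : R) : 0 <= x <= pi -> chord_half (cos x) = s x.
Proof.
move=> /s01 /andP[s0 _]; rewrite /chord_half cos_half.
have -> : (1 - (1 - 2 * s x ^+ 2)) / 2 = s x ^+ 2 by field.
by rewrite sqrtr_sqr ger0_norm.
Qed.

(* substitution s = sin(x/2) *)
Let int_half (h H : R -> R) :
  (forall y : R, 0 <= y <= 1 -> is_derive y 1 H (y * h y)) ->
  (forall y : R, 0 <= y <= 1 -> {for y, continuous h}) ->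
  \int[mu]_(x in `[0, pi]) (h (s x) * sin x) = 4 * (H 1 - H 0).
Proof.
move=> dH ch.
have dF (x : R) : 0 <= x <= pi -> is_derive x 1 (fun x => 4 * H (s x)) (h (s x) * sin x).
  move=> xpi; have hs := s01 xpi.
  apply: (is_derive_eq (is_derive1Ml 4 (@is_derive1_chain _ H s x _ _ (dH _ hs) (ds x)))).
  by rewrite sin_half; field.
have cF (x : R) : 0 <= x <= pi -> {for x, continuous (fun x => h (s x) * sin x)}.
  move=> xpi; have hs := s01 xpi.
  have c1 := @continuous_at1_chain _ h s x (ch _ hs) (is_derive1_continuous (ds x)).
  exact: (continuous_at1M c1 (@continuous_sin R x)).
rewrite (Rintegral_itv_derive (pi_gt0 R) dF cF) /s sin_pihalf mul0r sin0; ring.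
Qed.

Let q : {poly R} := Q \Po (1 - 2%:P * 'X ^+ 2).

Let Q_cos (x : R) : Q.[cos x] = q.[s x].
Proof.
by rewrite /q horner_comp cos_half !exprS !expr0 !mulr1 -polyC1 !(hornerD, hornerN, hornerM, hornerX, hornerC).
Qed.

Let int_poly (p : {poly R}) :
  \int[mu]_(x in `[0, pi]) (p.[s x] * sin x) = 4 * pint 0 1 ('X * p).
Proof.
have dH (y : R) : 0 <= y <= 1 -> is_derive y 1 (horner (pprimitive ('X * p))) (y * p.[y]).
  move=> _; have := is_derive_poly (pprimitive ('X * p)) y.
  by rewrite deriv_pprimitive hornerM hornerX.
have ch (y : R) : 0 <= y <= 1 -> {for y, continuous (horner p)} by move=> _; exact: continuous_horner.
exact: (int_half dH ch).
Qed.

Let dln (y : R) : 0 <= y -> is_derive y (1 : R) (fun y => ln (1 + y)) (1 + y)^-1.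
Proof.
move=> y0; have p : 0 < 1 + y by rewrite ltr_pwDl.
have h := is_derive1D (is_derive1_cst 1 y) (is_derive1_id y).
by apply: (is_derive_eq (@is_derive1_chain _ (@ln R) (fun y => 1 + y) y _ _ (is_derive1_ln p) h)); rewrite add0r mulr1.
Qed.

(** Four times the integral of y ln (1 + y) over [0, 1], with the primitive [H] found by parts. This
    value produces the term - N^2 / 4. *)
Let int_log : \int[mu]_(x in `[0, pi]) (ln (1 + s x) * sin x) = 1.
Proof.
pose H (y : R) := (y * y - 1) / 2 * ln (1 + y) + (y / 2 - y * y / 4).
have dH (y : R) : 0 <= y <= 1 -> is_derive y 1 H (y * ln (1 + y)).
  move=> /andP[y0 _]; have p : 1 + y != 0 by rewrite gt_eqF// ltr_pwDl.
  have d2 := is_derive1M (is_derive1_id y) (is_derive1_id y).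
  have h1 := is_derive1Mr 2^-1 (is_derive1B d2 (is_derive1_cst 1 y)).
  have h2 := is_derive1B (is_derive1Mr 2^-1 (is_derive1_id y)) (is_derive1Mr 4^-1 d2).
  apply: (is_derive_eq (is_derive1D (is_derive1M h1 (dln y0)) h2)).
  by field.
have ch (y : R) : 0 <= y <= 1 -> {for y, continuous (fun y : R => ln (1 + y))}.
  by move=> /andP[y0 _]; exact: is_derive1_continuous (dln y0).
by rewrite (int_half dH ch) /H addr0 ln1; field.
Qed.

(** The J of the overview, written in the angle x whose half has sine y; the factor 1/4 compensates
    the substitution. *)
Let J : R := (\int[mu]_(x in `[0, pi]) (Q.[cos x] ^+ 2 * ln (1 + s x) * sin x)) / 4.

Let c_s (x : R) : {for x, continuous s}. Proof. exact: is_derive1_continuous (ds x). Qed.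
Let c_sin (x : R) : {for x, continuous (@sin R)}. Proof. exact: continuous_sin. Qed.
Let c_Q (x : R) : {for x, continuous (fun x : R => Q.[cos x] ^+ 2)}.
Proof.
have c := @continuous_at1_chain _ (horner Q) cos x (@continuous_horner _ Q _) (@continuous_cos R x).
exact: (continuous_at1M c c).
Qed.
Let c_ln (x : R) : 0 <= x <= pi -> {for x, continuous (fun x : R => ln (1 + s x))}.
Proof.
move=> /s01/andP[s0 _].
exact: (@continuous_at1_chain _ (fun y => ln (1 + y)) s x (is_derive1_continuous (dln s0)) (@c_s x)).
Qed.

Let i_J : mu.-integrable `[0, pi] (EFin \o (fun x => Q.[cos x] ^+ 2 * ln (1 + s x) * sin x)).
Proof.
apply: continuous_itv_integrable => x xpi.
exact: (continuous_at1M (continuous_at1M (@c_Q x) (c_ln xpi)) (@c_sin x)).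
Qed.

Let J_ge0 : 0 <= J.
Proof.
rewrite /J divr_ge0//; apply: Rintegral_ge0 => x; rewrite /= in_itv/= => xpi.
have /andP[s0 _] := s01 xpi.
by rewrite mulr_ge0 ?sin_ge0_pi// mulr_ge0 ?sqr_ge0// ln_ge0// lerDl.
Qed.

Let J_le : J <= pint 0 1 (q ^+ 2 * 'X ^+ 2).
Proof.
have e : \int[mu]_(x in `[0, pi]) ((q ^+ 2 * 'X).[s x] * sin x) = 4 * pint 0 1 (q ^+ 2 * 'X ^+ 2).
  by rewrite int_poly; congr (_ * pint _ _ _); ring.
rewrite /J ler_pdivrMr// [leRHS]mulrC -e.
have px x : (q ^+ 2 * 'X).[x] = q.[x] ^+ 2 * x by rewrite hornerM hornerX expr2 hornerM.
apply: le_Rintegral => //.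
- apply: continuous_itv_integrable => x xpi.
  have c := @continuous_at1_chain _ (horner (q ^+ 2 * 'X)) s x (@continuous_horner _ _ _) (@c_s x).
  exact: (continuous_at1M c (@c_sin x)).
- move=> x; rewrite /= in_itv/= => xpi; have /andP[s0 _] := s01 xpi.
  rewrite ler_wpM2r ?sin_ge0_pi// px Q_cos ler_wpM2l ?sqr_ge0//.
  by rewrite le_ln1Dx// (lt_le_trans _ s0).
Qed.

Lemma integral_pair_cost : exists2 J,
  0 <= J <= pint 0 1 ((Q \Po (1 - 2%:P * 'X ^+ 2)) ^+ 2 * 'X ^+ 2) &
  (\int[mu]_(x in `[0%R, pi]) ((n ^+ 4 - Q.[cos x] ^+ 2) * pair_cost (cos x) * sin x)%:E =
  (2 * ((n ^+ 4 - n ^+ 2) * ln 2 - n ^+ 4 / 4 + J))%:E)%E.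
Proof.
exists J; first by rewrite J_ge0 J_le.
have i1 : mu.-integrable `[0, pi] (EFin \o @sin R).
  by apply: continuous_itv_integrable => x _; exact: c_sin.
have i2 : mu.-integrable `[0, pi] (EFin \o (fun x => Q.[cos x] ^+ 2 * sin x)).
  by apply: continuous_itv_integrable => x xpi; exact: (continuous_at1M (@c_Q x) (@c_sin x)).
have i3 : mu.-integrable `[0, pi] (EFin \o (fun x => ln (1 + s x) * sin x)).
  by apply: continuous_itv_integrable => x xpi; exact: (continuous_at1M (c_ln xpi) (@c_sin x)).
have e1 : \int[mu]_(x in `[0, pi]) sin x = 2.
  have := int_poly 1; under eq_Rintegral do rewrite hornerC mul1r.
  move=> ->; rewrite (@pintE _ _ _ _ (2^-1 *: ('X * 'X))).
    by rewrite !(hornerZ, hornerM, hornerX); field.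
  rewrite derivZ derivM derivX !mulr1 mul1r -mul_polyC -mulr2n -(mulr_natl 'X 2) [LHS]mulrA.
  by rewrite -polyC_natr -polyCM mulVf// polyC1 mul1r.
have e2 : \int[mu]_(x in `[0, pi]) (Q.[cos x] ^+ 2 * sin x) = 2 * n ^+ 2.
  rewrite -pint_legendre_sum_sqr.
  pose F (x : R) := - (pprimitive (Q * Q)).[cos x].
  have dF (x : R) : 0 <= x <= pi -> is_derive x 1 F (Q.[cos x] ^+ 2 * sin x).
    move=> _; have h := is_derive_poly (pprimitive (Q * Q)) (cos x).
    rewrite deriv_pprimitive in h.
    apply: (is_derive_eq (is_derive1N (@is_derive1_chain _ (horner (pprimitive (Q * Q))) cos x _ _ h (is_derive_cos x)))).
    by rewrite mulrN opprK hornerM.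
  rewrite (Rintegral_itv_derive (pi_gt0 R) dF).
    by rewrite /F cospi cos0 /pint opprK addrC.
  by move=> x xpi; exact: (continuous_at1M (@c_Q x) (@c_sin x)).
have e3 := int_log.
have e4 : \int[mu]_(x in `[0, pi]) (Q.[cos x] ^+ 2 * ln (1 + s x) * sin x) = 4 * J.
  by rewrite /J; field.
have Zi (c : R) f : mu.-integrable `[0, pi] (EFin \o f) -> mu.-integrable `[0, pi] (EFin \o (fun x => c * f x)).
  move=> fi; rewrite (_ : _ \o _ = fun x => (c%:E * (f x)%:E)%E); last by apply/funext => x.
  exact: integrableZl.
have Bi f g : mu.-integrable `[0, pi] (EFin \o f) -> mu.-integrable `[0, pi] (EFin \o g) ->
    mu.-integrable `[0, pi] (EFin \o (fun x => f x - g x)).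
  move=> fi gi; rewrite (_ : _ \o _ = fun x => ((f x)%:E - (g x)%:E)%E); last by apply/funext => x.
  exact: integrableB.
pose F x := (n ^+ 4 * ln 2 * sin x - ln 2 * (Q.[cos x] ^+ 2 * sin x))
  - (n ^+ 4 / 2 * (ln (1 + s x) * sin x) - 2^-1 * (Q.[cos x] ^+ 2 * ln (1 + s x) * sin x)).
transitivity (\int[mu]_(x in `[0%R, pi]) (F x)%:E)%E.
  apply: eq_integral => x; rewrite inE/= in_itv/= => xpi; congr (_%:E).
  by rewrite /F /pair_cost chord_halfE//; field.
have iF : mu.-integrable `[0, pi] (EFin \o F) by apply: (Bi _ _ (Bi _ _ _ _) (Bi _ _ _ _)); exact: Zi.
rewrite -[LHS]fineK; last exact: integrable_fin_num iF.
congr (_%:E); transitivity (\int[mu]_(x in `[0, pi]) F x); first by [].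
rewrite /F RintegralB//; [|by apply: Bi; exact: Zi|by apply: Bi; exact: Zi].
rewrite RintegralB//; [|exact: Zi|exact: Zi].
rewrite RintegralB//; [|exact: Zi|exact: Zi].
rewrite !RintegralZl// e1 e2 e3 e4; first by field.
Qed.

End PairEnergy.

(** * Distances between points on Hopf fibres *)

Section CircleLog.
Context {R : realType}.
Local Notation mu := (@lebesgue_measure R).
Implicit Types (t x : R).

Lemma is_derive1V (f : R -> R) x (a : R) : f x != 0 -> is_derive x 1 f a ->
  is_derive x 1 (fun y => (f y)^-1) (- (f x) ^- 2 * a).
Proof. by move=> fx0 fa; exact: is_deriveV. Qed.

Lemma continuous_at1V (f : R -> R) x : f x != 0 -> {for x, continuous f} ->
  {for x, continuous (fun y => (f y)^-1)}.
Proof. by move=> fx0 cf; exact: (@continuousV _ _ f x). Qed.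

Section Harmonic.
Variables a b : R.
Hypothesis ab1 : a ^+ 2 + b ^+ 2 < 1.

Let rho2 : R := a ^+ 2 + b ^+ 2.
Let X t : R := a * cos t + b * sin t.
Let Y t : R := b * cos t - a * sin t.
(** This is |1 - x w|^2 for w = X t + i Y t = (a + i b) e^{-it}. *)
Let D x t : R := 1 - 2 * x * X t + x ^+ 2 * rho2.

Let XY t : X t ^+ 2 + Y t ^+ 2 = rho2.
Proof.
transitivity (rho2 * (cos t ^+ 2 + sin t ^+ 2)); first by rewrite /X /Y /rho2; ring.
by rewrite cos2Dsin2 mulr1.
Qed.

Let DE x t : D x t = (1 - x * X t) ^+ 2 + (x * Y t) ^+ 2.
Proof. by rewrite /D -(XY t); ring. Qed.

Let rho2_ge0 : 0 <= rho2. Proof. by rewrite addr_ge0 ?sqr_ge0. Qed.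

Let rho2_p : 0 < 1 + rho2. Proof. by rewrite ltr_pwDl. Qed.

(** Any bound above 1 with v^2 rho2 < 1 would do: x then runs over an open interval containing 0 and
    1 on which [D] stays away from 0. This choice needs no square root and allows rho2 = 0. *)
Let v : R := 2 / (1 + rho2).
Let v1 : 1 < v.
Proof. by rewrite /v ltr_pdivlMr// mul1r; have := ab1; rewrite -/rho2; lra. Qed.

Let vrho : v ^+ 2 * rho2 < 1.
Proof.
have p := rho2_p.
have -> : v ^+ 2 * rho2 = (4 * rho2) / (1 + rho2) ^+ 2 by rewrite /v; field; rewrite gt_eqF.
rewrite ltr_pdivrMr ?exprn_gt0// mul1r -subr_gt0.
have -> : (1 + rho2) ^+ 2 - 4 * rho2 = (1 - rho2) ^+ 2 by ring.
by rewrite exprn_gt0// subr_gt0.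
Qed.

Let m : R := ((1 - v ^+ 2 * rho2) / 2) ^+ 2.
Let m_gt0 : 0 < m.
Proof. by rewrite exprn_gt0// divr_gt0// subr_gt0. Qed.

Let xv2 x : x \in `](- v), v[ -> x ^+ 2 <= v ^+ 2.
Proof.
by rewrite in_itv/= => /andP[x1 x2]; have := v1; nra.
Qed.

(** From (x X)^2 <= w < 1 with w = v^2 rho2, since sqrt w <= (1 + w) / 2. *)
Let xX_lt1 x t : x \in `](- v), v[ -> (1 - v ^+ 2 * rho2) / 2 <= 1 - x * X t.
Proof.
move=> xv; have x2 := xv2 xv.
have h : (x * X t) ^+ 2 <= v ^+ 2 * rho2.
  rewrite exprMn ler_pM ?sqr_ge0//; have := XY t; have := sqr_ge0 (Y t); lra.
have := vrho; move: (x * X t) (v ^+ 2 * rho2) h => u w h w1; nra.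
Qed.

Let D_ge x t : x \in `](- v), v[ -> m <= D x t.
Proof.
move=> xv; rewrite DE -[leLHS]addr0 lerD ?sqr_ge0// /m.
rewrite ler_pXn2r ?nnegrE//; first exact: xX_lt1.
  by rewrite divr_ge0// subr_ge0 ltW.
by rewrite (le_trans _ (xX_lt1 t xv))// divr_ge0// subr_ge0 ltW.
Qed.

Let D_gt0 x t : x \in `](- v), v[ -> 0 < D x t.
Proof. by move=> xv; rewrite (lt_le_trans m_gt0)// D_ge. Qed.

Let X_le1 t : `|X t| <= 1.
Proof.
by have := XY t; have := sqr_ge0 (Y t); have := ab1; rewrite -/rho2 ler_norml => *; apply/andP; split; nra.
Qed.

Let v2 : v <= 2.
Proof. by rewrite /v ler_pdivrMr//; have := rho2_ge0; lra. Qed.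

Let D_le x t : x \in `](- v), v[ -> D x t <= 9.
Proof.
move=> xv; have x2 := xv2 xv; have := X_le1 t; rewrite ler_norml => /andP[X1 X2].
move: xv; rewrite in_itv/= => /andP[xa xb]; have := v2; have := v1; have := vrho.
have hh : x ^+ 2 * rho2 <= v ^+ 2 * rho2 by rewrite ler_wpM2r.
rewrite /D => h1 h2 h3.
have : - (x * X t) <= 2 by nra.
nra.
Qed.

Let f x t : R := ln (D x t).
Let df x t : R := (- 2 * X t + 2 * x * rho2) / D x t.

Let is_derive_D x t : is_derive x 1 (fun x => D x t) (- 2 * X t + 2 * x * rho2).
Proof.
have h1 := is_derive1B (is_derive1_cst 1 x) (is_derive1Mr (X t) (is_derive1Ml 2 (is_derive1_id x))).
have h2 := is_derive1Mr rho2 (is_derive1M (is_derive1_id x) (is_derive1_id x)).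
by apply: (is_derive_eq (is_derive1D h1 h2)); ring.
Qed.

Let is_derive_f x t : x \in `](- v), v[ -> is_derive x 1 (fun x => f x t) (df x t).
Proof.
move=> xv; have D0 := D_gt0 t xv.
apply: (is_derive_eq (@is_derive1_chain _ (@ln R) (fun x => D x t) x _ _ (is_derive1_ln D0) (is_derive_D x t))).
by rewrite /df mulrC.
Qed.

Let is_derive_X t : is_derive t (1 : R) X (Y t).
Proof.
apply: (is_derive_eq (is_derive1D (is_derive1Ml a (is_derive_cos t)) (is_derive1Ml b (is_derive_sin t)))).
by rewrite /Y; ring.
Qed.

Let is_derive_Y t : is_derive t (1 : R) Y (- X t).
Proof.
apply: (is_derive_eq (is_derive1B (is_derive1Ml b (is_derive_cos t)) (is_derive1Ml a (is_derive_sin t)))).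
by rewrite /X; ring.
Qed.

Let cX t : {for t, continuous X}. Proof. exact: is_derive1_continuous (is_derive_X t). Qed.

Let c_cst (c t : R) : {for t, continuous (fun=> c)}.
Proof. exact: is_derive1_continuous (is_derive1_cst c t). Qed.

Let cD x t : {for t, continuous (D x)}.
Proof.
have h := is_derive1D (is_derive1B (is_derive1_cst 1 t) (is_derive1Ml (2 * x) (is_derive_X t))) (is_derive1_cst (x ^+ 2 * rho2) t).
exact: is_derive1_continuous h.
Qed.

Let twopi_gt0 : 0 < 2 * pi :> R. Proof. by rewrite mulr_gt0 ?pi_gt0. Qed.

Let X2pi : X (2 * pi) = X 0.
Proof. by rewrite /X mulr_natl cos2pi sin2pi cos0 sin0. Qed.
Let Y2pi : Y (2 * pi) = Y 0.
Proof. by rewrite /Y mulr_natl cos2pi sin2pi cos0 sin0. Qed.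

(* [df] is, up to a factor [2 / x], the derivative along the circle of the
   argument of [1 - x z], [z] running over a circle of radius [sqrt rho2]. *)
Let int_df x : x \in `](- v), v[ -> \int[mu]_(t in `[0, 2 * pi]) df x t = 0.
Proof.
move=> xv.
have cdf t : 0 <= t <= 2 * pi -> {for t, continuous (df x)}.
  move=> _; have h1 := continuous_at1D (continuous_at1M (@c_cst (- 2) t) (@cX t)) (@c_cst (2 * x * rho2) t).
  have h2 : {for t, continuous (fun t => (D x t)^-1)}.
    by apply: continuous_at1V; [rewrite gt_eqF// D_gt0 | exact: cD].
  exact: (continuous_at1M h1 h2).
(* At x = 0 the primitive [Psi] used below is replaced by its limit 2 Y. *)
have [x0|x0] := eqVneq x 0.
  have dF t : 0 <= t <= 2 * pi -> is_derive t 1 (fun t => 2 * Y t) (df x t).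
    move=> _; apply: (is_derive_eq (is_derive1Ml 2 (is_derive_Y t))).
    by rewrite /df /D x0; field.
  by rewrite (Rintegral_itv_derive twopi_gt0 dF cdf) Y2pi subrr.
pose Psi t := 2 / x * atan (x * Y t / (1 - x * X t)).
have dF t : 0 <= t <= 2 * pi -> is_derive t 1 Psi (df x t).
  move=> _.
  have p : 0 < 1 - x * X t.
    by rewrite (lt_le_trans _ (xX_lt1 t xv))// divr_gt0// subr_gt0.
  have p0 : 1 - x * X t != 0 by rewrite gt_eqF.
  have d1 := is_derive1B (is_derive1_cst 1 t) (is_derive1Ml x (is_derive_X t)).
  have d2 := is_derive1M (is_derive1Ml x (is_derive_Y t)) (@is_derive1V (fun t => 1 - x * X t) t _ p0 d1).
  have d3 := @is_derive1_chain _ (@atan R) (fun t => x * Y t / (1 - x * X t)) t _ _ (is_derive1_atan _) d2.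
  apply: (is_derive_eq (is_derive1Ml (2 / x) d3)).
  rewrite /df DE -(XY t); have D0 := D_gt0 t xv; rewrite DE in D0.
  by field; rewrite x0 p0 gt_eqF.
by rewrite (Rintegral_itv_derive twopi_gt0 dF cdf) /Psi X2pi Y2pi subrr.
Qed.

(** The dilation x joins the integrand at x = 1 to ln 1 = 0 at x = 0, and by [int_df] the integral
    does not change on the way. *)
Lemma circle_mean_log_aux : \int[mu]_(t in `[0, 2 * pi]) ln (1 - 2 * (a * cos t + b * sin t) + (a ^+ 2 + b ^+ 2)) = 0.
Proof.
have x1 : 1 \in `](- v), v[ by rewrite in_itv/=; have := v1 => h; move: h; move: v => w h; apply/andP; split; lra.
have x0 : 0 \in `](- v), v[ by rewrite in_itv/=; have := v1 => h; move: h; move: v => w h; apply/andP; split; lra.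
have twofin : (mu `[0%R, (2 * pi)%R] < +oo)%E by rewrite /= lebesgue_measure_itv/= lte_fin twopi_gt0 ltry.
pose C : R := `|ln m| + ln 9 + 10 / m.
have m0 := m_gt0; have ln9 : 0 <= ln 9 :> R by rewrite ln_ge0// ler1n.
have E : \int[mu]_(t in `[0, 2 * pi]) f 1 t = \int[mu]_(t in `[0, 2 * pi]) f 0 t.
  apply: (@Rintegral_parameter_cst _ _ R mu `[0, 2 * pi]%classic f df (- v) v C) => //.
  - move=> x xv; apply: subspace_continuous_measurable_fun => //; apply: continuous_in_subspaceT => t _.
    exact: (@continuous_at1_chain _ (@ln R) (D x) t (continuous_ln (D_gt0 t xv)) (@cD x t)).
  - move=> x t xv _; have := D_ge t xv; have := D_le t xv; have := D_gt0 t xv => d0 d1 d2.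
    have l1 : ln m <= f x t by rewrite /f ler_ln ?posrE.
    have l2 : f x t <= ln 9 by rewrite /f ler_ln ?posrE.
    have c0 : 0 <= 10 / m by rewrite divr_ge0// ltW.
    have := ler_norm (- ln m); rewrite normrN => l3.
    by have := normr_ge0 (ln m); rewrite ler_norml /C => l4; apply/andP; split; lra.
  - by move=> x t xv _; exact: is_derive_f.
  - move=> x t xv _; have d2 := D_ge t xv; have d0 := D_gt0 t xv.
    rewrite /df normrM normfV (gtr0_norm d0).
    have n10 : `|- 2 * X t + 2 * x * rho2| <= 10.
      have := X_le1 t; rewrite !ler_norml => /andP[X1 X2].
      move: xv; rewrite in_itv/= => /andP[xa xb]; have := v2; have := rho2_ge0; have := ab1; rewrite -/rho2.
      by move=> *; apply/andP; split; nra.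
    rewrite (le_trans (_ : _ <= 10 / m))//; last by rewrite /C lerDr addr_ge0.
    by apply: ler_pM => //; [rewrite invr_ge0 ltW | rewrite lef_pV2 ?posrE].
transitivity (\int[mu]_(t in `[0, 2 * pi]) f 1 t).
  by apply: eq_Rintegral => t _; rewrite /f /D /X /rho2 mulr1 expr1n mul1r.
rewrite E; under eq_Rintegral do rewrite /f /D mulr0 mul0r expr0n mul0r subr0 addr0 ln1.
by rewrite /Rintegral integral0.
Qed.

End Harmonic.

Lemma circle_mean_log (a b : R) : a ^+ 2 + b ^+ 2 < 1 ->
  \int[mu]_(t in `[0, 2 * pi]) ln (2 - 2 * (a * cos t + b * sin t)) =
  2 * pi * ln (1 + Num.sqrt (1 - (a ^+ 2 + b ^+ 2))).
Proof.
move=> ab1; set r2 := a ^+ 2 + b ^+ 2 in ab1 *.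
have r0 : 0 <= r2 by rewrite addr_ge0 ?sqr_ge0.
(* [c] is the larger root of c^2 - 2c + r2 = 0, so that c (1 + r2 / c^2) = 2: the integrand is ln c
   plus the mean-zero logarithm for (a / c, b / c), a point of the open unit disc since c > 1. *)
set c := 1 + Num.sqrt (1 - r2).
have s0 : 0 < Num.sqrt (1 - r2) by rewrite sqrtr_gt0 subr_gt0.
have c1 : 1 < c by rewrite ltrDl.
have c0 : 0 < c by rewrite (lt_trans ltr01).
have cc : c * (2 - c) = r2.
  have := @sqr_sqrtr _ (1 - r2); rewrite subr_ge0 ltW// => /(_ isT) h.
  have -> : c * (2 - c) = 1 - Num.sqrt (1 - r2) ^+ 2 by rewrite /c; ring.
  by rewrite h; ring.
have ab1' : (a / c) ^+ 2 + (b / c) ^+ 2 < 1.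
  have -> : (a / c) ^+ 2 + (b / c) ^+ 2 = r2 / c ^+ 2 by rewrite /r2; field; rewrite gt_eqF.
  rewrite ltr_pdivrMr ?exprn_gt0// mul1r -cc expr2 ltr_pM2l//; lra.
have h0 := circle_mean_log_aux ab1'.
have E t : 2 - 2 * (a * cos t + b * sin t) =
    c * (1 - 2 * (a / c * cos t + b / c * sin t) + ((a / c) ^+ 2 + (b / c) ^+ 2)).
  have -> : (a / c) ^+ 2 + (b / c) ^+ 2 = (2 - c) / c.
    have -> : (a / c) ^+ 2 + (b / c) ^+ 2 = r2 / c ^+ 2 by rewrite /r2; field; rewrite gt_eqF.
    by rewrite -cc; field; rewrite gt_eqF.
  by field; rewrite gt_eqF.
have pos t : 0 < 1 - 2 * (a / c * cos t + b / c * sin t) + ((a / c) ^+ 2 + (b / c) ^+ 2).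
  set A := a / c in ab1' *; set B := b / c in ab1' *.
  have h : A * cos t + B * sin t < 1.
    have e : (A * cos t + B * sin t) ^+ 2 + (B * cos t - A * sin t) ^+ 2 = (A ^+ 2 + B ^+ 2) * (cos t ^+ 2 + sin t ^+ 2) by ring.
    by rewrite cos2Dsin2 mulr1 in e; have := sqr_ge0 (B * cos t - A * sin t); nra.
  have e : 1 - 2 * (A * cos t + B * sin t) + (A ^+ 2 + B ^+ 2) = (1 - (A * cos t + B * sin t)) ^+ 2 + (B * cos t - A * sin t) ^+ 2.
    have := cos2Dsin2 t => cs; transitivity (1 - 2 * (A * cos t + B * sin t) + (A ^+ 2 + B ^+ 2) * (cos t ^+ 2 + sin t ^+ 2)); [by rewrite cs mulr1 | ring].
  by rewrite e ltr_pwDl ?sqr_ge0// exprn_gt0// subr_gt0.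
set g := (fun t => 1 - 2 * (a / c * cos t + b / c * sin t) + ((a / c) ^+ 2 + (b / c) ^+ 2)) in pos.
have ig : mu.-integrable `[0, (2 * pi)] (EFin \o (fun t => ln (g t))).
  apply: continuous_compact_integrable; first exact: segment_compact.
  apply: continuous_in_subspaceT => t _.
  have d1 := is_derive1D (is_derive1B (is_derive1_cst 1 t) (is_derive1Ml 2 (is_derive1D (is_derive1Ml (a / c) (is_derive_cos t)) (is_derive1Ml (b / c) (is_derive_sin t))))) (is_derive1_cst ((a / c) ^+ 2 + (b / c) ^+ 2) t).
  exact: is_derive1_continuous (@is_derive1_chain _ (@ln R) g t _ _ (is_derive1_ln (pos t)) d1).
have twopi_gt0 : 0 < 2 * pi :> R by rewrite mulr_gt0 ?pi_gt0.
transitivity (\int[mu]_(t in `[0, 2 * pi]) (cst (ln c) t + ln (g t))).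
  by apply: eq_Rintegral => t _; rewrite E -[X in _ * X]/(g t) lnM ?posrE//; exact: pos.
rewrite RintegralD//; last first.
  by apply: continuous_compact_integrable; [exact: segment_compact | apply: continuous_subspaceT; exact: cst_continuous].
by rewrite h0 addr0 Rintegral_cst//= lebesgue_measure_itv/= lte_fin twopi_gt0 sube0 mulrC.
Qed.

End CircleLog.

(** * Two points on Hopf fibres *)

Section FibreDistance.
Context {R : realType}.
Local Notation mu := (@lebesgue_measure R).
Implicit Types (p q : 4.-tuple R) (y z : 3.-tuple R) (t c : R).

Lemma euclidean_dist_sphere n (x y : n.-tuple R) : unit_sphere n x -> unit_sphere n y ->
  euclidean_dist x y = Num.sqrt (2 - 2 * dot x y).
Proof.
rewrite /unit_sphere /= => x1 y1; congr Num.sqrt.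
have -> : 2 - 2 * dot x y = dot x x + dot y y - 2 * dot x y by rewrite x1 y1; ring.
rewrite /dot mulr_sumr -big_split/= -sumrB; apply: eq_bigr => i _; ring.
Qed.

Lemma dot_sphere_le1 n (x y : n.-tuple R) : unit_sphere n x -> unit_sphere n y ->
  -1 <= dot x y <= 1.
Proof.
rewrite /unit_sphere /= => x1 y1.
have h (e : R) : e ^+ 2 = 1 -> 0 <= 2 + 2 * e * dot x y.
  move=> e1; have -> : 2 + 2 * e * dot x y = \sum_(i < n) (tnth x i + e * tnth y i) ^+ 2.
    have -> : 2 + 2 * e * dot x y = dot x x + e ^+ 2 * dot y y + 2 * e * dot x y by rewrite x1 y1 e1; ring.
    rewrite /dot !mulr_sumr -!big_split/=; apply: eq_bigr => i _; ring.
  by apply: sumr_ge0 => i _; exact: sqr_ge0.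
have := h 1 (expr1n _ 2); have := h (-1) ltac:(by rewrite sqrrN expr1n); lra.
Qed.

Lemma dot_sphere_lt1 n (x y : n.-tuple R) : unit_sphere n x -> unit_sphere n y ->
  x != y -> dot x y < 1.
Proof.
move=> x1 y1 xy; have /andP[_ le1] := dot_sphere_le1 x1 y1.
rewrite lt_neqAle le1 andbT; apply: contra xy => /eqP d1; apply/eqP.
have : \sum_(i < n) (tnth x i - tnth y i) ^+ 2 = 0.
  have := x1; have := y1; rewrite /unit_sphere /= => {}y1 {}x1.
  transitivity (dot x x + dot y y - 2 * dot x y); last by rewrite x1 y1 d1; ring.
  rewrite /dot mulr_sumr -big_split/= -sumrB; apply: eq_bigr => i _; ring.
move/eqP; rewrite psumr_eq0; last by move=> i _; exact: sqr_ge0.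
move/allP => h; apply: eq_from_tnth => i; apply/eqP; rewrite -subr_eq0 -sqrf_eq0.
exact: h (mem_index_enum i).
Qed.

(** For x <= 0 both sides take the default value 0, so coincident points need no separate case. *)
Lemma ln_inv_sqrt (x : R) : ln (1 / Num.sqrt x) = - (ln x / 2).
Proof.
have [x0|x0] := leP x 0; first by rewrite ler0_sqrtr// invr0 mulr0 !ln0// mul0r oppr0.
rewrite div1r lnV ?posrE ?sqrtr_gt0//; congr (- _).
rewrite -[in RHS](@sqr_sqrtr _ x) ?ltW// lnXn ?sqrtr_gt0// -(mulr_natl (ln _)).
by rewrite mulrC mulrA mulVf// mul1r.
Qed.

(** The derivative of [fibre_rot t p] at t = 0, that is the unit tangent of the fibre when p is on
    the sphere. *)
Definition fibre_dir p : 4.-tuple R := [tuple - p`_1; p`_0; p`_3; - p`_2].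

Lemma dot_fibre_rot t t' p q : dot (fibre_rot t p) (fibre_rot t' q) =
  cos (t - t') * dot p q + sin (t - t') * dot (fibre_dir p) q.
Proof.
by rewrite cosB sinB /dot !big_ord_recl !big_ord0 !(tnth_nth 0) /=; ring.
Qed.

(** The two scalar products are, up to sign, the real and imaginary parts of the Hermitian product
    for which [fibre_dir] is multiplication by i; the Hopf map sees only its modulus. *)
Lemma dot_hopf p q : unit_sphere 4 p -> unit_sphere 4 q ->
  dot p q ^+ 2 + dot (fibre_dir p) q ^+ 2 = (1 + dot (hopf p) (hopf q)) / 2.
Proof.
rewrite /unit_sphere /= => p1 q1; apply: (@mulIf _ 2) => //; rewrite divfK//.
transitivity (dot p p * dot q q + dot (hopf p) (hopf q)); last by rewrite p1 q1 mulr1.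
by rewrite /dot !big_ord_recl !big_ord0 !(tnth_nth 0) /=; ring.
Qed.

(** Chords of the unit sphere are at most 2, so the shift makes this nonnegative there, also for p =
    q, where the second logarithm is 0 by default. *)
Definition log_gap p q : R := ln 2 + ln (1 / euclidean_dist p q).

Lemma log_gap_sphere p q : unit_sphere 4 p -> unit_sphere 4 q ->
  log_gap p q = ln 2 - ln (2 - 2 * dot p q) / 2.
Proof. by move=> p1 q1; rewrite /log_gap euclidean_dist_sphere// ln_inv_sqrt. Qed.

Lemma log_gap_ge0 p q : unit_sphere 4 p -> unit_sphere 4 q -> 0 <= log_gap p q.
Proof.
move=> p1 q1; rewrite log_gap_sphere//; have /andP[d1 d2] := dot_sphere_le1 p1 q1.
suff : ln (2 - 2 * dot p q) <= 2 * ln 2 by lra.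
have [d0|d0] := leP (2 - 2 * dot p q) 0.
  by rewrite ln0// mulr_ge0// ln_ge0// ler1n.
have -> : 2 * ln 2 = ln (2 ^+ 2) :> R by rewrite lnXn// mulr_natl.
by rewrite ler_ln ?posrE//; lra.
Qed.

(** Averaging over one phase suffices. The other phase and the offset c only rotate the vector (A,
    B), and the mean depends on A^2 + B^2 alone, which is less than 1 because the fibres differ. *)
Lemma fibre_mean_log_gap c t' p q : unit_sphere 4 p -> unit_sphere 4 q ->
  hopf p != hopf q -> unit_sphere 3 (hopf p) -> unit_sphere 3 (hopf q) ->
  (\int[mu]_(t in `[0%R, (2 * pi)%R]) (log_gap (fibre_rot (t + c) p) (fibre_rot t' q))%:E =
   (2 * pi * pair_cost (dot (hopf p) (hopf q)))%:E)%E.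
Proof.
move=> p1 q1 pq hp hq.
set A := dot p q; set B := dot (fibre_dir p) q.
have AB : A ^+ 2 + B ^+ 2 = (1 + dot (hopf p) (hopf q)) / 2 by exact: dot_hopf.
have d1 := dot_sphere_lt1 hp hq pq.
pose u := c - t'.
pose a := A * cos u + B * sin u; pose b := B * cos u - A * sin u.
have ab : a ^+ 2 + b ^+ 2 = A ^+ 2 + B ^+ 2.
  transitivity ((A ^+ 2 + B ^+ 2) * (cos u ^+ 2 + sin u ^+ 2)); first by rewrite /a /b; ring.
  by rewrite cos2Dsin2 mulr1.
have ab1 : a ^+ 2 + b ^+ 2 < 1 by rewrite ab AB; lra.
pose g t := 2 - 2 * (a * cos t + b * sin t).
have gE t : log_gap (fibre_rot (t + c) p) (fibre_rot t' q) = ln 2 - ln (g t) / 2.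
  rewrite log_gap_sphere; [|exact: unit_sphere_fibre_rot..].
  rewrite dot_fibre_rot -/A -/B; have -> : t + c - t' = t + u by rewrite /u; ring.
  by rewrite cosD sinD /g /a /b; congr (_ - ln _ / _); ring.
have g0 t : 0 < g t.
  have e : (a * cos t + b * sin t) ^+ 2 + (b * cos t - a * sin t) ^+ 2 = a ^+ 2 + b ^+ 2.
    transitivity ((a ^+ 2 + b ^+ 2) * (cos t ^+ 2 + sin t ^+ 2)); first ring.
    by rewrite cos2Dsin2 mulr1.
  have := sqr_ge0 (b * cos t - a * sin t); rewrite /g; nra.
have cg t : {for t, continuous (fun t => ln (g t))}.
  have h := is_derive1B (is_derive1_cst 2 t) (is_derive1Ml 2 (is_derive1D (is_derive1Ml a (is_derive_cos t)) (is_derive1Ml b (is_derive_sin t)))).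
  exact: is_derive1_continuous (@is_derive1_chain _ (@ln R) g t _ _ (is_derive1_ln (g0 t)) h).
have ig : mu.-integrable `[0, (2 * pi)] (EFin \o (fun t => ln (g t))).
  by apply: continuous_itv_integrable => t _; exact: cg.
have twopi_gt0 : 0 < 2 * pi :> R by rewrite mulr_gt0 ?pi_gt0.
have i2 : mu.-integrable `[0, (2 * pi)] (EFin \o (fun t => - 2^-1 * ln (g t))).
  rewrite (_ : _ \o _ = fun x => ((- 2^-1)%:E * (ln (g x))%:E)%E); last by apply/funext => x.
  exact: integrableZl.
have ic : mu.-integrable `[0, (2 * pi)] (EFin \o (cst (ln 2 : R))).
  by apply: continuous_itv_integrable => t _; exact: cst_continuous.
have E : \int[mu]_(t in `[0, (2 * pi)]) (cst (ln 2 : R) t + - 2^-1 * ln (g t)) =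
    2 * pi * pair_cost (dot (hopf p) (hopf q)).
  rewrite RintegralD// RintegralZl// circle_mean_log//.
  rewrite Rintegral_cst//= lebesgue_measure_itv/= lte_fin twopi_gt0 sube0 /=.
  rewrite ab AB /pair_cost /chord_half.
  have -> : 1 - (1 + dot (hopf p) (hopf q)) / 2 = (1 - dot (hopf p) (hopf q)) / 2 by field.
  by field.
rewrite -E /Rintegral fineK.
  by apply: eq_integral => t _; rewrite gE; congr (_%:E); rewrite /cst; field.
apply: integrable_fin_num => //.
rewrite (_ : (fun _ => _) = ((EFin \o cst (ln 2 : R)) \+ (EFin \o (fun t => - 2^-1 * ln (g t))%R))%E).
  exact: integrableD.
by apply/funext => t.
Qed.

End FibreDistance.

(** * Chords between roots of unity *)

Section RootsOfUnity.
Import complex.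
Context {R : realType}.
Local Notation C := (complex.complex R).

Let sqn (w : C) : R := complex.Re w ^+ 2 + complex.Im w ^+ 2.

Let sqnM (w w' : C) : sqn (w * w') = sqn w * sqn w'.
Proof. by case: w => a b; case: w' => c d; rewrite /sqn /=; ring. Qed.

Let sqn_prod (I : finType) (P : pred I) (F : I -> C) :
  sqn (\prod_(i | P i) F i) = \prod_(i | P i) sqn (F i).
Proof.
apply: (big_morph sqn sqnM); by rewrite /sqn /= expr1n expr0n addr0.
Qed.

Variable k : nat.
Hypothesis k0 : (0 < k)%N.

Let ang (j : nat) : R := 2 * pi * j%:R / k%:R.
Let z (j : nat) : C := complex.Complex (cos (ang j)) (sin (ang j)).

Let kR : k%:R != 0 :> R. Proof. by rewrite pnatr_eq0 -lt0n. Qed.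

Let zX j : z 1 ^+ j = z j.
Proof.
elim: j => [|j ih].
  by rewrite expr0 /z /ang mulr0 mul0r cos0 sin0.
rewrite exprS ih; rewrite /z; have -> : ang j.+1 = ang 1 + ang j.
  by rewrite /ang -natr1; field.
by rewrite cosD sinD; congr complex.Complex; rewrite addrC (mulrC (sin _)).
Qed.

Let z_prim : k.-primitive_root (z 1).
Proof.
rewrite /primitive_root_of_unity k0 /=; apply/forallP => i; rewrite unity_rootE zX.
have ik : (i.+1 <= k)%N := ltn_ord i.
have [ek|nk] := eqVneq i.+1 k.
  rewrite ek /z /ang; have -> : 2 * pi * k%:R / k%:R = pi *+ 2 :> R by rewrite mulfK// mulr_natl.
  by rewrite cos2pi sin2pi eqxx.
rewrite eqbF_neg; apply/eqP => /(congr1 (@complex.Re R)) /= c1.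
(* Half the angle: cos (2x) = 1 forces sin x = 0, impossible for 0 < x < pi. *)
pose x : R := pi * i.+1%:R / k%:R.
have x0 : 0 < x by rewrite divr_gt0 ?mulr_gt0 ?pi_gt0 ?ltr0n.
have x1 : x < pi.
  by rewrite ltr_pdivrMr ?ltr0n// ltr_pM2l ?pi_gt0// ltr_nat ltn_neqAle nk.
have e : ang i.+1 = x + x by rewrite /ang /x; field.
move: c1; rewrite e cosD => c1.
have := cos2Dsin2 x => h; have : sin x ^+ 2 = 0 by move: c1 h; nra.
by move/eqP; rewrite sqrf_eq0 gt_eqF// sin_gt0_pi// x0.
Qed.

Let sqn_z j : sqn (z j) = 1.
Proof. by rewrite /sqn /= cos2Dsin2. Qed.

Let sqnB i j : sqn (z i - z j) = 2 - 2 * cos (ang i - ang j).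
Proof.
rewrite /sqn /= cosB; have h1 := cos2Dsin2 (ang i); have h2 := cos2Dsin2 (ang j).
transitivity ((cos (ang i) ^+ 2 + sin (ang i) ^+ 2) + (cos (ang j) ^+ 2 + sin (ang j) ^+ 2)
  - 2 * (cos (ang i) * cos (ang j) + sin (ang i) * sin (ang j))); first by ring.
by rewrite h1 h2; ring.
Qed.

(* Evaluate the derivative of [X^k - 1] at one of its roots. *)
Lemma prod_chord_roots_of_unity (a : 'I_k) :
  \prod_(b < k | b != a) (2 - 2 * cos (ang a - ang b)) = k%:R ^+ 2.
Proof.
under eq_bigr do rewrite -sqnB.
rewrite -sqn_prod.
have E : (\prod_(b < k) ('X - (z b)%:P)) = 'X^k - 1 :> {poly C}.
  rewrite -(factor_Xn_sub_1 z_prim) big_mkord; apply: eq_bigr => b _.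
  by rewrite zX.
have dE : ('X^k - 1 : {poly C})^`() = 'X^(k.-1) *+ k.
  by rewrite derivB derivXn -polyC1 derivC subr0.
move: E; rewrite (bigD1 a)//; move=> /(congr1 (@deriv C)); rewrite dE derivM.
rewrite derivXsubC.
rewrite mul1r.
move=> /(congr1 (horner^~ (z a))).
rewrite /=.
rewrite hornerD.
rewrite hornerM hornerXsubC subrr mul0r addr0 horner_prod.
under eq_bigr do rewrite hornerXsubC.
move=> ->; rewrite hornerMn hornerXn -mulr_natl sqnM.
have -> : sqn (k%:R : C) = k%:R ^+ 2.
  have -> : (k%:R : C) = complex.Complex k%:R 0.
    elim: (k) => [//|m ih]; rewrite -natr1 ih -[in RHS]natr1.
    by congr complex.Complex; rewrite /= addr0.
  by rewrite /sqn /= expr0n addr0.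
have -> : sqn (z a ^+ k.-1) = 1.
  by rewrite -zX -exprM zX sqn_z.
by rewrite mulr1.
Qed.

End RootsOfUnity.

Section FibreSelfEnergy.
Context {R : realType}.

Lemma ln_prod_pos (I : finType) (P : pred I) (F : I -> R) :
  (forall i, P i -> 0 < F i) -> ln (\prod_(i | P i) F i) = \sum_(i | P i) ln (F i).
Proof.
move=> F0; have [] : 0 < \prod_(i | P i) F i /\ ln (\prod_(i | P i) F i) = \sum_(i | P i) ln (F i); last by [].
apply: (big_rec2 (fun x y => 0 < x /\ ln x = y)); first by rewrite ln1.
by move=> i x y /F0 Fi [x0 <-]; rewrite mulr_gt0// lnM ?posrE.
Qed.

(** As p and [fibre_dir p] are orthonormal, the squared distances are those of the k-th roots of
    unity; their product is k^2, and half its logarithm is ln k. *)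
Lemma fibre_self_energy (k : nat) (a : 'I_k) (t : R) (p : 4.-tuple R) : unit_sphere 4 p ->
  \sum_(b < k | b != a) ln (1 / euclidean_dist (fibre_rot (t + 2 * pi * a%:R / k%:R) p)
                                               (fibre_rot (t + 2 * pi * b%:R / k%:R) p)) = - ln k%:R.
Proof.
move=> p1; have k0 : (0 < k)%N by case: k a => [[]|].
have prodE := @prod_chord_roots_of_unity R k k0 a.
pose F (b : 'I_k) : R := 2 - 2 * cos (2 * pi * a%:R / k%:R - 2 * pi * b%:R / k%:R).
have Fge b : 0 <= F b by rewrite /F; have := cos_le1 (2 * pi * a%:R / k%:R - 2 * pi * b%:R / k%:R : R); lra.
(* Distinct indices give distinct points: a zero factor would make the product k^2 vanish. *)
have Fgt b : b != a -> 0 < F b.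
  move=> ba; rewrite lt_neqAle Fge andbT eq_sym; apply/eqP => Fb.
  have : k%:R ^+ 2 != 0 :> R by rewrite expf_neq0// pnatr_eq0 -lt0n.
  by rewrite -prodE (bigD1 b)//= -/(F b) Fb mul0r eqxx.
transitivity (\sum_(b < k | b != a) - (ln (F b) / 2)).
  apply: eq_bigr => b _; rewrite euclidean_dist_sphere; [|exact: unit_sphere_fibre_rot..].
  rewrite dot_fibre_rot ln_inv_sqrt.
  have -> : dot p p = 1 by exact: p1.
  have -> : dot (fibre_dir p) p = 0.
    by rewrite /dot !big_ord_recl !big_ord0 !(tnth_nth 0) /=; ring.
  by rewrite mulr1 mulr0 addr0 /F; congr (- (ln (2 - 2 * cos _) / _)); ring.
rewrite sumrN -mulr_suml -ln_prod_pos//.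
rewrite (_ : \prod_(i | i != a) F i = k%:R ^+ 2)// lnXn ?ltr0n// -(mulr_natr (ln _)).
by rewrite mulfK.
Qed.

End FibreSelfEnergy.

(** * Expectations over the harmonic ensemble and the phases *)

Section IndependentLaw.
Local Open Scope ereal_scope.
Context d d1 d2 d3 (T : measurableType d) (S1 : measurableType d1)
  (S2 : measurableType d2) (S3 : measurableType d3) (R : realType).
Variable P : probability T R.
Variables (X : {mfun T >-> S1}) (V : {mfun T >-> S2}) (W : {mfun T >-> S3}).
Variables (U1 : probability S2 R) (U2 : probability S3 R).

Hypothesis indep : forall A B C, measurable A -> measurable B -> measurable C ->
  P (X @^-1` A `&` (V @^-1` B `&` W @^-1` C)) = P (X @^-1` A) * (U1 B * U2 C).

Let mpre d' (S' : measurableType d') (Z : {mfun T >-> S'}) A : measurable A -> measurable (Z @^-1` A).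
Proof. by move=> mA; rewrite -[X in measurable X]setTI; exact: (measurable_funP Z). Qed.

Let m_XV : measurable_fun setT (fun w => (X w, V w)).
Proof. by apply/measurable_fun_pair; exact: measurable_funP. Qed.

Let m_XVW : measurable_fun setT (fun w => ((X w, V w), W w)).
Proof. by apply/measurable_fun_pair => //; exact: measurable_funP. Qed.

Let XV : {mfun T >-> (S1 * S2)%type} := HB.pack (fun w => (X w, V w)) (isMeasurableFun.Build _ _ _ _ _ m_XV).
Let XVW : {mfun T >-> (S1 * S2 * S3)%type} := HB.pack (fun w => ((X w, V w), W w)) (isMeasurableFun.Build _ _ _ _ _ m_XVW).

(** As functions of A both sides are measures that agree, on rectangles, with the product of the law
    of X and U1 scaled by U2 C; uniqueness of product measures does the rest. *)
Let law_step (C : set S3) (mC : measurable C) (A : set (S1 * S2)) : measurable A ->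
  P (XV @^-1` A `&` W @^-1` C) = distribution P XV A * U2 C.
Proof.
move=> mA.
have mWC : measurable (W @^-1` C) by exact: mpre.
pose c : {nonneg R} := NngNum (fine_ge0 (measure_ge0 U2 C)).
have cE : c%:num%:E = U2 C by rewrite /= fineK// fin_num_measure.
pose m' : {measure set (S1 * S2) -> \bar R} :=
  measure_function_pushforward__canonical__measure_function_Measure (mrestr P mWC) (measurable_funP XV).
pose m'' : {measure set (S1 * S2) -> \bar R} := mscale c (distribution P XV).
have e1 : (distribution P X \x mscale c U1) A = m' A.
  apply: product_measure_unique => // B D mB mD.
  rewrite /m' /= /pushforward /mrestr /=.
  transitivity (P (X @^-1` B `&` (V @^-1` D `&` W @^-1` C))); first by rewrite setIA.
  by rewrite indep// /mscale cE (muleC (U2 C)).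
have e2 : (distribution P X \x mscale c U1) A = m'' A.
  apply: product_measure_unique => // B D mB mD.
  rewrite /m'' /= /mscale /distribution /pushforward cE.
  transitivity (U2 C * P (X @^-1` B `&` (V @^-1` D `&` W @^-1` setT))).
    by rewrite preimage_setT setIT.
  by rewrite indep// probability_setT mule1 muleCA.
by rewrite muleC -cE -[RHS]/(m'' A) -e2 e1.
Qed.

(** Only W is averaged. X and V stay random: they will be the base points and the phase of the other
    fibre. *)
Lemma ge0_expectation_indep (f : S1 * S2 * S3 -> \bar R) : measurable_fun setT f ->
  (forall x, 0 <= f x) ->
  \int[P]_w f (X w, V w, W w) = \int[P]_w \int[U2]_t f (X w, V w, t).
Proof.
move=> mf f0.
have lawE A : measurable A -> (distribution P XV \x U2) A = distribution P XVW A.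
  move=> mA; apply: product_measure_unique => // B C mB mC.
  by rewrite /= -law_step.
transitivity (\int[distribution P XVW]_z f z).
  by rewrite ge0_integral_pushforward//; exact: measurable_funP.
rewrite -(eq_measure_integral _ (fun A mA _ => lawE A mA)).
rewrite fubini_tonelli1//.
rewrite ge0_integral_pushforward//; last 2 first.
- exact: measurable_fun_fubini_tonelli_F.
- by move=> x _; exact: integral_ge0.
Qed.

End IndependentLaw.

(** The factorial moment measure is a finite sum of laws; bundling it as a single measure lets
    [ge0_integral_density] apply. *)
Lemma finite_sum_measure d (E : measurableType d) (R : realType) (I : Type) (s : seq I)
    (law : I -> {measure set E -> \bar R}) :
  exists m : {measure set E -> \bar R},
    (forall B, measurable B -> m B = \sum_(i <- s) law i B)%E /\
    (forall f : E -> \bar R, measurable_fun setT f -> (forall x, 0 <= f x)%E ->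
      \int[m]_x f x = \sum_(i <- s) \int[law i]_x f x)%E.
Proof.
elim: s => [|i s [m [mB mf]]].
  exists mzero; split => [B _|f _ _]; first by rewrite big_nil.
  by rewrite big_nil integral_measure_zero.
exists (measure_add (law i) m); split => [B mB'|f mf' f0].
  by rewrite big_cons -mB//; exact: measure_addE.
by rewrite big_cons -mf// ge0_integral_measure_add.
Qed.

(** * The two-point intensity of the ensemble *)

Section PairIntensity.
Context {R : realType}.
Local Notation mu := (@lebesgue_measure R).
Local Notation mu2 := (mu \x mu)%E.
Local Notation sigma := (@surface_measure R).
Variables (d : measure_display) (T : measurableType d) (P : probability T R) (L : nat).
Variable Y : 'I_(L.+1 ^ 2) -> {RV P >-> 3.-tuple R}.
Hypothesis hY : harmonic_ensemble Y.
Local Notation E := (3.-tuple R).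
Local Notation r := (L.+1 ^ 2)%N.
Local Notation Q := (@legendre_sum R L).

Definition pair2 (x y : E) : 2.-tuple E := [tuple x; y].

Let K2 (t : R) : R := (16 * pi ^+ 2)^-1 * (L.+1%:R ^+ 4 - Q.[t] ^+ 2).

Let det2 (A : 'M[R]_2) : \det A = A ord0 ord0 * A ord_max ord_max - A ord0 ord_max * A ord_max ord0.
Proof.
rewrite (expand_det_row _ ord0) !big_ord_recl big_ord0 addr0 /cofactor.
rewrite !det_mx11 !mxE /= expr0 mul1r expr1 mulN1r mulrN.
congr (_ * _ - _ * _); congr (A _ _); exact/val_inj.
Qed.

Let kernelE (x y : E) : harmonic_kernel L x y = (4 * pi)^-1 * Q.[dot x y].
Proof.
rewrite /harmonic_kernel /legendre_sum horner_sum; congr (_ * _).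
by apply: eq_bigr => l _; rewrite (hornerZ _ (legendre _)).
Qed.

Let rho2 (x y : E) : R := harmonic_kernel L x x * harmonic_kernel L y y - harmonic_kernel L x y * harmonic_kernel L y x.

Let rho2E x y : unit_sphere 3 x -> unit_sphere 3 y -> rho2 x y = K2 (dot x y).
Proof.
move=> x1 y1; rewrite /rho2 !kernelE.
have -> : dot y x = dot x y by rewrite /dot; apply: eq_bigr => i _; rewrite mulrC.
have -> : dot x x = 1 by exact: x1.
have -> : dot y y = 1 by exact: y1.
rewrite legendre_sum_horner1 /K2; move: (pi_gt0 R); move: (pi : R) => c c0.
by field; rewrite gt_eqF.
Qed.

Let K2_ge0 t : -1 <= t <= 1 -> 0 <= K2 t.
Proof.
move=> t1; rewrite /K2 mulr_ge0//; first by rewrite invr_ge0 mulr_ge0// sqr_ge0.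
rewrite subr_ge0 -[Q.[t] ^+ 2]real_normK ?num_real//.
have -> : L.+1%:R ^+ 4 = (L.+1%:R ^+ 2) ^+ 2 :> R by rewrite -exprM.
by rewrite ler_pXn2r ?nnegrE ?exprn_ge0// legendre_sum_le.
Qed.

Let m_tnth (i : 'I_3) : measurable_fun setT (fun x : E => tnth x i).
Proof. exact: measurable_tnth. Qed.

Let E2 := (E * E)%type.

Let m_dot (f g : E2 -> E) : measurable_fun setT f -> measurable_fun setT g ->
  measurable_fun setT (fun p => dot (f p) (g p)).
Proof.
move=> mf mg; rewrite /dot; apply: measurable_sum => i.
by apply: measurable_funM; apply: (measurableT_comp (m_tnth i)).
Qed.

Let m_pair2 : measurable_fun setT (fun p : E2 => pair2 p.1 p.2).
Proof.
apply: measurable_cons; first exact: measurable_fst.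
by apply: measurable_cons; [exact: measurable_snd | exact: measurable_cst].
Qed.

Let mQ : measurable_fun setT (horner Q).
Proof. by apply: continuous_measurable_fun; exact: continuous_horner. Qed.

Let m_rho2 : measurable_fun setT (fun p : E2 => rho2 p.1 p.2).
Proof.
have mk (f g : E2 -> E) : measurable_fun setT f -> measurable_fun setT g ->
    measurable_fun setT (fun p => harmonic_kernel L (f p) (g p)).
  move=> mf mg; under eq_fun do rewrite kernelE.
  apply: measurable_funM => //; apply: (measurableT_comp mQ); exact: m_dot.
by apply: measurable_funB; apply: measurable_funM; apply: mk.
Qed.

(** The truncation gives a density that is nonnegative everywhere, as Tonelli requires, and leaves
    the intensity unchanged on the sphere. *)
Let g (p : E2) : R := Num.max 0 (K2 (dot p.1 p.2)).

Let g0 p : 0 <= g p. Proof. by rewrite /g le_max lexx. Qed.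

Let gE x y : unit_sphere 3 x -> unit_sphere 3 y -> g (x, y) = K2 (dot x y).
Proof. by move=> x1 y1; rewrite /g max_r// K2_ge0// dot_sphere_le1. Qed.

Let mg : measurable_fun setT g.
Proof.
apply: measurable_maxr => //; apply: measurable_funM => //.
apply: measurable_funB => //; apply: measurable_funX.
by apply: (measurableT_comp mQ); exact: m_dot.
Qed.

Let iterated2 (B : set (2.-tuple E)) : measurable B ->
  (iterated_integral sigma (fun x : 2.-tuple E => (\1_B x *
     \det (\matrix_(i < 2, j < 2) harmonic_kernel L (tnth x i) (tnth x j)))%:E) =
   \int[sigma \x sigma]_p (\1_B (pair2 p.1 p.2) * g p)%:E)%E.
Proof.
move=> mB /=.
pose f (p : E2) : \bar R := (\1_B (pair2 p.1 p.2) * rho2 p.1 p.2)%:E.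
have mf : measurable_fun setT f.
  apply/measurable_EFinP; apply: measurable_funM => //.
  by apply: (measurableT_comp _ m_pair2); exact: measurable_indic.
transitivity (\int[sigma]_x \int[sigma]_y f (x, y))%E.
  apply: eq_integral => x _; apply: eq_integral => y _.
  rewrite /f /=; congr (_%:E); congr (\1_B _ * _).
  by rewrite det2 !mxE.
pose G x : \bar R := (\int[sigma]_y f (x, y))%E.
have f0 x y : unit_sphere 3 x -> unit_sphere 3 y -> (0 <= f (x, y))%E.
  move=> x1 y1; rewrite lee_fin mulr_ge0//= rho2E// K2_ge0//.
  exact: dot_sphere_le1.
have mfx x : measurable_fun setT (fun y => f (x, y)) by exact: measurableT_comp.
pose h (p : E2) : \bar R := (\1_B (pair2 p.1 p.2) * g p)%:E.
have mh : measurable_fun setT h.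
  apply/measurable_EFinP; apply: measurable_funM => //.
  by apply: (measurableT_comp _ m_pair2); exact: measurable_indic.
have h0 p : (0 <= h p)%E by rewrite lee_fin mulr_ge0.
have mhx x : measurable_fun setT (fun y => h (x, y)) by exact: measurableT_comp.
have GE x : unit_sphere 3 x -> G x = (\int[sigma]_y h (x, y))%E.
  move=> x1; rewrite /G (@integral_surface R (fun y => f (x, y)))//; last by move=> y; exact: f0.
  rewrite (@ge0_integral_surface R (fun y => h (x, y)))//.
  apply: eq_integral => p _; congr (_ * _)%E; rewrite /f /h/= rho2E ?gE//; exact: spherical_unit.
(* Off the sphere f may be negative, so its positive and negative parts are treated separately. *)
have mG : measurable_fun setT G.
  rewrite (_ : G = (fun x => \int[sigma]_y (f^\+)%E (x, y) - \int[sigma]_y (f^\-)%E (x, y))%E); last first.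
    apply/funext => x; rewrite /G integralE; congr (_ - _)%E; apply: eq_integral => y _.
      by rewrite !funeposE.
    by rewrite !funenegE.
  apply: emeasurable_funB.
    apply: (@measurable_fun_fubini_tonelli_F _ _ _ _ _ sigma (f^\+)%E).
      exact: measurable_funepos.
    by move=> p; exact: funepos_ge0.
  apply: (@measurable_fun_fubini_tonelli_F _ _ _ _ _ sigma (f^\-)%E).
    exact: measurable_funeneg.
  by move=> p; exact: funeneg_ge0.
rewrite (@fubini_tonelli1 _ _ _ _ _ sigma sigma h mh h0).
rewrite (@integral_surface R G)//; last first.
  by move=> x x1; rewrite GE//; exact: integral_ge0.
rewrite (@ge0_integral_surface R (fubini_F sigma h)); last 2 first.
- exact: measurable_fun_fubini_tonelli_F.
- by move=> x; exact: integral_ge0.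
by apply: eq_integral => p _; rewrite GE//; exact: spherical_unit.
Qed.

Let Y2 (u : {ffun 'I_2 -> 'I_r}) (w : T) : 2.-tuple E := [tuple Y (u j) w | j < 2].

Let mY2 u : measurable_fun setT (Y2 u).
Proof.
apply/measurable_fun_tnthP => i; rewrite (_ : _ \o _ = Y (u i)); first exact: measurable_funP.
by apply/funext => w; rewrite /= tnth_mktuple.
Qed.

Let mfunY2 u : {mfun T >-> 2.-tuple E} := HB.pack (Y2 u) (isMeasurableFun.Build _ _ _ _ _ (mY2 u)).

(** [m] is the second factorial moment measure, the sum of the joint laws over injective labellings;
    the case of two points in [determinantal] says that it has density [g]. *)
Lemma harmonic_pair_integral (f : 2.-tuple E -> \bar R) : measurable_fun setT f ->
  (forall x, 0 <= f x)%E ->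
  (\sum_(u : {ffun 'I_2 -> 'I_r} | injectiveb u) \int[P]_w f [tuple Y (u j) w | j < 2] =
   \int[mu2]_(p in spherical_dom) (\int[mu2]_(q in spherical_dom)
      (f (pair2 (spherical p) (spherical q)) * ((16 * pi ^+ 2)^-1 *
         (L.+1%:R ^+ 4 - Q.[dot (spherical p) (spherical q)] ^+ 2))%:E * (sin q.1)%:E) * (sin p.1)%:E))%E.
Proof.
move=> mf f0.
have [m [mB mI]] := finite_sum_measure (enum [pred u : {ffun 'I_2 -> 'I_r} | injectiveb u])
   (fun u => distribution P (mfunY2 u)).
have intY2 u : (\int[distribution P (mfunY2 u)]_x f x = \int[P]_w f (Y2 u w))%E.
  by rewrite ge0_integral_pushforward//; exact: mY2.
transitivity (\int[m]_x f x)%E.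
  by rewrite mI// big_enum/=; apply: eq_big => [u|u _]; rewrite ?inE// intY2.
have mBE B : measurable B -> m B = (\int[sigma \x sigma]_p (\1_B (pair2 p.1 p.2) * g p)%:E)%E.
  move=> mB'; rewrite -iterated2// -(hY.2 2%N B mB') mB//.
  have m1 u : measurable_fun setT (fun w => (\1_B (Y2 u w))%:E : \bar R).
    apply/measurable_EFinP.
    have mi : measurable_fun setT (\1_B : 2.-tuple E -> R) by exact: measurable_indic.
    exact: (measurableT_comp mi (mY2 u)).
  apply/esym; transitivity (\int[P]_w (\sum_(u <- enum [pred u : {ffun 'I_2 -> 'I_r} | injectiveb u]) (\1_B (Y2 u w))%:E))%E.
    by rewrite expectation.unlock; apply: eq_integral => w _; rewrite big_enum/= sumEFin.
  have m0 u (w : T) : setT w -> (0 <= (\1_B (Y2 u w))%:E :> \bar R)%E by move=> _; rewrite lee_fin.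
  apply: etrans; first exact: (ge0_integral_sum P measurableT m1 m0 _).
  apply: eq_bigr => u _; rewrite -[RHS]/(P (Y2 u @^-1` B)).
  have mb : measurable (Y2 u @^-1` B) by rewrite -[X in measurable X]setTI; exact: mY2.
  by rewrite -[X in _ = P X]setIT -integral_indic.
pose h (p : E2) : \bar R := (f (pair2 p.1 p.2) * (g p)%:E)%E.
have mh : measurable_fun setT h.
  apply: emeasurable_funM; first exact: (measurableT_comp mf m_pair2).
  exact/measurable_EFinP.
have h0 p : (0 <= h p)%E by rewrite mule_ge0// lee_fin.
rewrite (@ge0_integral_density _ _ _ _ R (sigma \x sigma)%E m setT (fun p => pair2 p.1 p.2) g)//.
rewrite (@fubini_tonelli1 _ _ _ _ _ sigma sigma h mh h0).
rewrite (@ge0_integral_surface R (fubini_F sigma h)); last 2 first.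
- exact: measurable_fun_fubini_tonelli_F.
- by move=> x; exact: integral_ge0.
apply: eq_integral => p _; congr (_ * _)%E.
rewrite /fubini_F (@ge0_integral_surface R (fun y => h (spherical p, y)))//; last exact: measurableT_comp.
apply: eq_integral => q _; congr (_ * _ * _)%E.
by rewrite gE//; exact: spherical_unit.
Qed.

End PairIntensity.

(** * Expected cost of the pairs of base points *)

Section PairCostExpectation.
Context {R : realType}.
Local Notation mu := (@lebesgue_measure R).
Local Notation mu2 := (mu \x mu)%E.
Variables (d : measure_display) (T : measurableType d) (P : probability T R) (L : nat).
Variable Y : 'I_(L.+1 ^ 2) -> {RV P >-> 3.-tuple R}.
Hypothesis hY : harmonic_ensemble Y.
Local Notation E := (3.-tuple R).
Local Notation r := (L.+1 ^ 2)%N.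
Local Notation Q := (@legendre_sum R L).

Lemma sum_injective_pairs (n : nat) (V : nmodType) (F : 'I_n -> 'I_n -> V) :
  \sum_(u : {ffun 'I_2 -> 'I_n} | injectiveb u) F (u ord0) (u ord_max) =
  \sum_(i < n) \sum_(j < n | j != i) F i j.
Proof.
rewrite pair_big_dep/=.
pose h (p : 'I_n * 'I_n) : {ffun 'I_2 -> 'I_n} := [ffun k : 'I_2 => if k == ord0 then p.1 else p.2].
rewrite (reindex h); last first.
  exists (fun u : {ffun 'I_2 -> 'I_n} => (u ord0, u ord_max)) => [[i j] _|u _]; first by rewrite /h !ffunE.
  apply/ffunP => k; rewrite ffunE; case: ifPn => [/eqP ->//|k0] /=.
  by congr (u _); apply/val_inj; move: k0; case: k => [[|[|]]].
apply: eq_big => [[i j]|[i j] _] /=; last by rewrite /h !ffunE.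
apply/injectiveP/idP => [hi|ij a b].
  by apply/eqP => ji; have := hi ord0 ord_max; rewrite /h !ffunE/= ji => /(_ erefl).
rewrite /h !ffunE/=; case: ifPn => [/eqP ->|a0]; case: ifPn => [/eqP ->|b0] //.
- by move=> e; move: ij; rewrite e eqxx.
- by move=> e; move: ij; rewrite e eqxx.
- by move=> _; apply/val_inj; move: a0 b0; case: a => [[|[|]]]//; case: b => [[|[|]]].
Qed.

Lemma measurable_dot d' (S : measurableType d') n (f g : S -> n.-tuple R) :
  measurable_fun setT f -> measurable_fun setT g ->
  measurable_fun setT (fun w => dot (f w) (g w)).
Proof.
move=> mf mg; rewrite /dot; apply: measurable_sum => i.
by apply: measurable_funM; apply: (measurableT_comp (measurable_tnth i)).
Qed.

Let dot2 (t : 2.-tuple E) : R := dot (tnth t ord0) (tnth t ord_max).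
Let m_dot2 : measurable_fun setT dot2.
Proof. by apply: measurable_dot; exact: measurable_tnth. Qed.

Let sum_pairs (f : R -> \bar R) : measurable_fun setT f -> (forall t, 0 <= f t)%E ->
  (\sum_(i < r) \sum_(j < r | j != i) \int[P]_w f (dot (Y i w) (Y j w)) =
   \int[mu2]_(p in spherical_dom) (\int[mu2]_(q in spherical_dom)
      (f (sph_cos p.1 p.2 q) * ((16 * pi ^+ 2)^-1 *
         (L.+1%:R ^+ 4 - Q.[sph_cos p.1 p.2 q] ^+ 2))%:E * (sin q.1)%:E) * (sin p.1)%:E))%E.
Proof.
move=> mf f0; rewrite -(sum_injective_pairs (fun i j => \int[P]_w f (dot (Y i w) (Y j w)))%E).
have := harmonic_pair_integral hY (f := fun t => f (dot2 t)) (measurableT_comp mf m_dot2) (fun x => f0 _).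
have -> : (\sum_(u : {ffun 'I_2 -> 'I_r} | injectiveb u) \int[P]_w f (dot2 [tuple Y (u j) w  | j < 2]) =
  \sum_(u : {ffun 'I_2 -> 'I_r} | injectiveb u) \int[P]_w f (dot (Y (u ord0) w) (Y (u ord_max) w)))%E.
  by apply: eq_bigr => u _; apply: eq_integral => w _; rewrite /dot2 !tnth_mktuple.
move=> ->; apply: eq_integral => p _; congr (_ * _)%E; apply: eq_integral => q _.
by rewrite -dot_spherical.
Qed.

(** Repulsion: Q(1)^2 = n^4 makes the intensity vanish wherever the scalar product is 1. The average
    over phases relies on this, as it needs distinct fibres. *)
Lemma harmonic_pair_neq i j : i != j -> P [set w | dot (Y i w) (Y j w) = 1] = 0%E.
Proof.
move=> ij.
have m1 : measurable [set t : R | t = 1] by exact: measurable_set1.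
have mf : measurable_fun setT (fun t => (\1_[set t : R | t = 1] t)%:E : \bar R).
  by apply/measurable_EFinP; exact: measurable_indic.
have f0 t : (0 <= (\1_[set t : R | t = 1] t)%:E :> \bar R)%E by rewrite lee_fin.
have := sum_pairs mf f0; rewrite [RHS]integral0_eq; last first.
  move=> p _; rewrite integral0_eq ?mul0e// => q _.
  rewrite indicE; case: (boolP (_ \in _)) => [|_]; last by rewrite mul0e mul0e.
  by rewrite inE/= => ->; rewrite legendre_sum_horner1 -exprM subrr mulr0 mule0 mul0e.
move=> S0.
have z : (\int[P]_w (\1_[set t : R | t = 1] (dot (Y i w) (Y j w)))%:E = 0)%E.
  apply/eqP; rewrite eq_le integral_ge0 ?andbT; last by move=> w _; rewrite lee_fin.
  rewrite -S0 (bigD1 i)//= (bigD1 j)/=; last by rewrite eq_sym.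
  rewrite -addeA leeDl// adde_ge0//; first by apply: sume_ge0 => l _; apply: integral_ge0 => w _; rewrite lee_fin.
  by apply: sume_ge0 => l _; apply: sume_ge0 => l' _; apply: integral_ge0 => w _; rewrite lee_fin.
rewrite -z -[X in P X]setIT -integral_indic//.
have md : measurable_fun setT (fun w => dot (Y i w) (Y j w)) by apply: measurable_dot; exact: measurable_funP.
by rewrite -[X in measurable X]setTI; exact: (md measurableT _ m1).
Qed.

Let n : R := L.+1%:R.

(** The inner zonal integral does not depend on the first point, so the outer one multiplies it by
    the area 4 pi; the factors 2 pi, 1 / (16 pi^2), 2 and 4 pi have product 1. *)
Lemma harmonic_pair_cost : exists2 J,
  0 <= J <= pint 0 1 ((Q \Po (1 - 2%:P * 'X ^+ 2)) ^+ 2 * 'X ^+ 2) &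
  (\sum_(i < r) \sum_(j < r | j != i) \int[P]_w (pair_cost (dot (Y i w) (Y j w)))%:E =
   ((n ^+ 4 - n ^+ 2) * ln 2 - n ^+ 4 / 4 + J)%:E)%E.
Proof.
have [J J0 HJ] := @integral_pair_cost R L; exists J => //.
pose f (t : R) : \bar R := (Num.max 0 (pair_cost t))%:E.
have mf : measurable_fun setT f.
  by apply/measurable_EFinP; apply: measurable_maxr => //; exact: measurable_pair_cost.
have f0 t : (0 <= f t)%E by rewrite lee_fin le_max lexx.
have fE t : -1 <= t -> f t = (pair_cost t)%:E by move=> t1; rewrite /f max_r// pair_cost_ge0.
transitivity (\sum_(i < r) \sum_(j < r | j != i) \int[P]_w f (dot (Y i w) (Y j w)))%E.
  apply: eq_bigr => i _; apply: eq_bigr => j _; apply: eq_integral => w _.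
  by rewrite fE//; have /andP[] := dot_sphere_le1 (hY.1 i w) (hY.1 j w).
rewrite sum_pairs//.
pose c : R := (16 * pi ^+ 2)^-1.
pose K : {poly R} := c *: ((n ^+ 4)%:P - Q ^+ 2).
have KE t : K.[t] = c * (n ^+ 4 - Q.[t] ^+ 2).
  by rewrite hornerZ hornerD hornerN hornerC [Q ^+ 2]expr2 hornerM -expr2.
have pi0 : 0 < pi :> R by exact: pi_gt0.
have c0 : 0 < c by rewrite invr_gt0 mulr_gt0 ?exprn_gt0.
have K0 t : -1 <= t <= 1 -> 0 <= K.[t].
  move=> t1; rewrite KE mulr_ge0 ?(ltW c0)// subr_ge0 -[Q.[t] ^+ 2]real_normK ?num_real//.
  have -> : n ^+ 4 = (n ^+ 2) ^+ 2 :> R by rewrite -exprM.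
  by rewrite ler_pXn2r ?nnegrE ?exprn_ge0// legendre_sum_le.
have inner p : (\int[mu2]_(q in spherical_dom)
      (f (sph_cos p.1 p.2 q) * ((16 * pi ^+ 2)^-1 *
         (L.+1%:R ^+ 4 - Q.[sph_cos p.1 p.2 q] ^+ 2))%:E * (sin q.1)%:E) =
    (2 * pi * (c * (2 * ((n ^+ 4 - n ^+ 2) * ln 2 - n ^+ 4 / 4 + J))))%:E)%E.
  transitivity (\int[mu2]_(q in spherical_dom) (K.[sph_cos p.1 p.2 q] * pair_cost (sph_cos p.1 p.2 q) * sin q.1)%:E)%E.
    apply: eq_integral => q _; have /andP[u1 _] := sph_cos_bound p.1 p.2 q.
    by rewrite fE// -!EFinM KE; congr (_%:E); rewrite -/n -/c; ring.
  rewrite zonal_integral_pair_cost//.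
  transitivity ((2 * pi)%:E * (c%:E * \int[mu]_(x in `[0%R, pi]) ((n ^+ 4 - Q.[cos x] ^+ 2) * pair_cost (cos x) * sin x)%:E))%E.
    congr (_ * _)%E; rewrite -ge0_integralZl//.
    - by apply: eq_integral => x _; rewrite KE -EFinM; congr (_%:E); ring.
    - apply: measurable_funTS; apply/measurable_EFinP; apply: measurable_funM; last exact: measurable_sin.
      apply: measurable_funM; last first.
        by apply: (measurableT_comp measurable_pair_cost); exact: measurable_cos.
      apply: measurable_funB => //; apply: measurable_funX.
      by apply: measurableT_comp; [apply: continuous_measurable_fun; exact: continuous_horner | exact: measurable_cos].
    - move=> x; rewrite /= in_itv/= => xpi; have u1 : -1 <= cos x <= 1 by rewrite cos_geN1 cos_le1.
      rewrite lee_fin mulr_ge0 ?sin_ge0_pi// mulr_ge0//; last by rewrite pair_cost_ge0//; lra.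
      by have := K0 _ u1; rewrite KE pmulr_rge0.
    - by rewrite lee_fin ltW.
  by rewrite HJ -!EFinM.
set V := _ * ln 2 - _ / 4 + J in inner HJ *.
pose v : R := 2 * pi * (c * (2 * V)).
transitivity (\int[mu2]_(p in spherical_dom) (v * sin p.1)%:E)%E.
  by apply: eq_integral => p _; rewrite inner.
have dv (t : R) : -1 <= t <= 1 -> is_derive t 1 (cst v) (cst 0 t) by move=> _; exact: is_derive_cst.
have cv (t : R) : -1 <= t <= 1 -> {for t, continuous (cst 0 : R -> R)} by move=> _; exact: cst_continuous.
rewrite (zonal_integral_C1 dv cv 0 0) /=.
have -> : (\int[mu]_(x in `[0%R, pi]) (v * sin x)%:E = (2 * v)%:E)%E.
  have cs (x : R) : 0 <= x <= pi -> {for x, continuous (fun x : R => v * sin x)}.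
    by move=> _; exact: (continuous_at1M (@cst_continuous _ _ v x) (@continuous_sin R x)).
  rewrite -[LHS]fineK; last exact: integrable_fin_num (continuous_itv_integrable cs).
  congr (_%:E); transitivity (\int[mu]_(x in `[0, pi]) (v * sin x)); first by [].
  have dF (x : R) : 0 <= x <= pi -> is_derive x 1 (fun x => v * - cos x) (v * sin x).
    by move=> _; apply: (is_derive_eq (is_derive1Ml v (is_derive1N (is_derive_cos x)))); rewrite opprK.
  by rewrite (Rintegral_itv_derive pi0 dF cs) cospi cos0; ring.
rewrite -EFinM /v /c; congr (_%:E); move: pi0; move: (pi : R) => e e0; field; exact: lt0r_neq0.
Qed.

End PairCostExpectation.

(** * Averaging over the random phases *)

Section PhaseAverage.
Context {R : realType}.
Local Notation mu := (@lebesgue_measure R).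
Local Notation E := (3.-tuple R).
Variables (d : measure_display) (T : measurableType d) (P : probability T R) (r : nat).
Variables (Y : 'I_r -> {RV P >-> E}) (theta : 'I_r -> {RV P >-> R}).
Hypothesis Ysphere : forall i w, unit_sphere 3 (Y i w).
Hypothesis htheta : random_phases Y theta.
Variable s : E -> 4.-tuple R.
Hypothesis hs : hopf_section s.

Lemma measurable_unit_sphere n : measurable (@unit_sphere R n).
Proof.
have -> : @unit_sphere R n = setT `&` (fun x => dot x x) @^-1` [set 1] by rewrite setTI.
by apply: measurable_dot => //; exact: measurable_set1.
Qed.

Lemma measurable_fibre_rot d' (S : measurableType d') (f : S -> R) (g : S -> 4.-tuple R) :
  measurable_fun setT f -> measurable_fun setT g ->
  measurable_fun setT (fun w => fibre_rot (f w) (g w)).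
Proof.
move=> mf mg.
have mc : measurable_fun setT (fun w => cos (f w)) by exact: (measurableT_comp (@measurable_cos R)).
have ms : measurable_fun setT (fun w => sin (f w)) by exact: (measurableT_comp (@measurable_sin R)).
have mt (l : 'I_4) : measurable_fun setT (fun w => (g w)`_l).
  rewrite (_ : (fun w => (g w)`_l) = (fun w => tnth (g w) l)).
    exact: (measurableT_comp (measurable_tnth l)).
  by apply/funext => w; rewrite (tnth_nth 0).
have m4 (a b c e : S -> R) : measurable_fun setT a -> measurable_fun setT b -> measurable_fun setT c ->
    measurable_fun setT e -> measurable_fun setT (fun w => [tuple a w; b w; c w; e w]).
  move=> ma mb m_c me; do 4!apply: measurable_cons => //; exact: measurable_cst.
have [m0 m1 m2 m3] := And4 (mt ord0) (mt (Ordinal (isT : 1 < 4)%N)) (mt (Ordinal (isT : 2 < 4)%N)) (mt ord_max).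
by apply: m4; first [apply: measurable_funB | apply: measurable_funD]; apply: measurable_funM.
Qed.

Let X (w : T) : r.-tuple E := [tuple Y i w | i < r].

Let mX : measurable_fun setT X.
Proof.
apply/measurable_fun_tnthP => i; rewrite (_ : _ \o _ = Y i); first exact: measurable_funP.
by apply/funext => w; rewrite /= tnth_mktuple.
Qed.

Let mfunX : {mfun T >-> r.-tuple E} := HB.pack X (isMeasurableFun.Build _ _ _ _ _ mX).

Let U : probability (measurableTypeR R) R := uniform_prob (@twopi_gt0 R).

Let m_th l : measurable_fun setT (theta l : T -> measurableTypeR R).
Proof. exact: (measurable_funP (theta l)). Qed.

Let th l : {mfun T >-> measurableTypeR R} := HB.pack (theta l : T -> measurableTypeR R) (isMeasurableFun.Build _ _ _ _ _ (m_th l)).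

Let indep i j (ij : i != j) (A : set (r.-tuple E)) (B C : set R) : measurable A -> measurable B -> measurable C ->
  P (mfunX @^-1` A `&` (th j @^-1` B `&` th i @^-1` C)) = (P (mfunX @^-1` A) * (U B * U C))%E.
Proof.
move=> mA mB mC; have [uni ind] := htheta.
pose D (l : 'I_r) : set R := if l == j then B else if l == i then C else setT.
have mD l : measurable (D l) by rewrite /D; case: ifP => // _; case: ifP.
have := ind A D mA mD; rewrite (bigD1 j)//= (bigD1 i)//= big1 ?mule1; last first.
  by move=> l /andP[lj li]; rewrite /D (negbTE lj) (negbTE li) preimage_setT probability_setT.
have -> : U B = P (theta j @^-1` B) by exact/esym/uni.
have -> : U C = P (theta i @^-1` C) by exact/esym/uni.
rewrite /D eqxx (negbTE ij) eqxx => <-; congr (P (_ `&` _)).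
apply/seteqP; split => [w [Bw Cw] l|w h]; first by case: eqP => [->//|_]; case: eqP => [->|].
by split; [have := h j; rewrite eqxx | have := h i; rewrite (negbTE ij) eqxx].
Qed.

(** The phase of the i-th fibre is averaged with the base points and the other phase fixed; the
    equality of the inner means holds off the null event of coincident base points. The offsets c
    and c' stand for the positions of the roots of unity. *)
Lemma phase_mean_log_gap (i j : 'I_r) (c c' : R) : i != j ->
  P [set w | dot (Y i w) (Y j w) = 1] = 0%E ->
  (\int[P]_w (log_gap (fibre_rot (theta i w + c) (s (Y i w))) (fibre_rot (theta j w + c') (s (Y j w))))%:E =
   \int[P]_w (pair_cost (dot (Y i w) (Y j w)))%:E)%E.
Proof.
move=> ij Pd0; have [ms sE] := hs.
(* The section is measurable on the sphere only; the extension is measurable everywhere and agrees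
   with it at the points of the process. *)
pose s' := s \_ (unit_sphere 3).
have s'E w l : s' (Y l w) = s (Y l w) by rewrite /s' patchE ifT// inE; exact: Ysphere.
have ms' : measurable_fun setT s' by apply/(measurable_restrictT s) => //; exact: measurable_unit_sphere.
pose D (z : r.-tuple E * measurableTypeR R * measurableTypeR R) : R :=
  dot (fibre_rot (z.2 + c) (s' (tnth z.1.1 i))) (fibre_rot (z.1.2 + c') (s' (tnth z.1.1 j))).
(* The truncation makes f nonnegative at all arguments; at points coming from the process it changes
   nothing, as [fE] shows. *)
pose f z : \bar R := (Num.max 0 (ln 2 - ln (2 - 2 * D z) / 2))%:E.
have mD : measurable_fun setT D.
  have ml l : measurable_fun setT (fun z : r.-tuple E * measurableTypeR R * measurableTypeR R => s' (tnth z.1.1 l)).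
    apply: (measurableT_comp ms'); apply: (measurableT_comp (measurable_tnth l)).
    exact: measurableT_comp.
  apply: measurable_dot; apply: measurable_fibre_rot => //; apply: measurable_funD => //.
  exact: measurableT_comp.
have mf : measurable_fun setT f.
  apply/measurable_EFinP; apply: measurable_maxr => //; apply: measurable_funB => //.
  apply: measurable_funM => //; apply: (measurableT_comp (@measurable_ln R)).
  by apply: measurable_funB => //; exact: measurable_funM.
have f0 z : (0 <= f z)%E by rewrite lee_fin le_max lexx.
have fE w v t : f (X w, v, t) =
    (log_gap (fibre_rot (t + c) (s (Y i w))) (fibre_rot (v + c') (s (Y j w))))%:E.
  rewrite /f /D/= !tnth_mktuple !s'E.
  have u l a : unit_sphere 4 (fibre_rot a (s (Y l w))).
    by apply: unit_sphere_fibre_rot; have [] := sE _ (Ysphere l w).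
  by rewrite -log_gap_sphere// max_r// log_gap_ge0.
transitivity (\int[P]_w f (mfunX w, th j w, th i w))%E; first by apply: eq_integral => w _; rewrite fE.
rewrite (@ge0_expectation_indep _ _ _ _ _ _ _ _ R P mfunX (th j) (th i) U U (indep ij) f)//.
have inner w : dot (Y i w) (Y j w) <> 1 ->
    (\int[U]_t f (mfunX w, th j w, t) = (pair_cost (dot (Y i w) (Y j w)))%:E)%E.
  move=> d1; have [pi1 hi] := sE _ (Ysphere i w); have [pj1 hj] := sE _ (Ysphere j w).
  rewrite integral_uniform//; last exact: measurableT_comp.
  under eq_integral => t _ do rewrite fE.
  rewrite fibre_mean_log_gap ?hi ?hj//; last first.
    by apply/eqP => e; apply: d1; rewrite e; exact: (Ysphere j w).
  rewrite -EFinM subr0; congr (_%:E).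
  by rewrite mulKf// gt_eqF// twopi_gt0.
have md : measurable_fun setT (fun w => dot (Y i w) (Y j w)) by apply: measurable_dot; exact: measurable_funP.
apply: ge0_ae_eq_integral => //.
- have mF := @measurable_fun_fubini_tonelli_F _ _ _ _ _ U f mf f0.
  apply: (measurableT_comp mF).
  by apply/measurable_fun_pair; exact: measurable_funP.
- by apply/measurable_EFinP; apply: (measurableT_comp measurable_pair_cost).
- by move=> w _; exact: integral_ge0.
- by move=> w _; rewrite lee_fin pair_cost_ge0//; have /andP[] := dot_sphere_le1 (Ysphere i w) (Ysphere j w).
exists [set w | dot (Y i w) (Y j w) = 1]; split => //.
  have m1 : measurable [set t : R | t = 1] by exact: measurable_set1.
  by rewrite -[X in measurable X]setTI; exact: (md measurableT _ m1).
by move=> w /= h; apply: contrapT => d1; apply: h => _; exact: inner.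
Qed.

End PhaseAverage.

(** * The energy of the lifted points, fibre by fibre *)

Section LiftEnergy.
Context {R : realType}.
Local Notation E := (3.-tuple R).
Variable s : E -> 4.-tuple R.
Hypothesis hs : hopf_section s.

(** Each of the r k points contributes - ln k within its own fibre; the (r^2 - r) k^2 ordered pairs
    on different fibres each carry a shift ln 2 to be removed. *)
Lemma log_energy_hopf_lift r k (y : 'I_r -> E) (t : 'I_r -> R) :
  (forall i, unit_sphere 3 (y i)) ->
  log_energy (@hopf_lift R s r k y t) =
  \sum_(i < r) \sum_(j < r | j != i) \sum_(a < k) \sum_(b < k)
     log_gap (hopf_lift s y t (i, a)) (hopf_lift s y t (j, b))
  - ((r%:R ^+ 2 - r%:R) * k%:R ^+ 2 * ln 2 + r%:R * k%:R * ln k%:R).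
Proof.
move=> y1; rewrite /log_energy.
pose F (x z : 'I_r * 'I_k) := ln (1 / euclidean_dist (hopf_lift s y t x) (hopf_lift s y t z)).
have split_row i a : \sum_(z | z != (i, a)) F (i, a) z =
    - ln k%:R + \sum_(j < r | j != i) \sum_(b < k) F (i, a) (j, b).
  transitivity (\sum_j \sum_(b < k | (j, b) != (i, a)) F (i, a) (j, b)).
    by rewrite pair_big_dep/=; apply: eq_big => -[].
  rewrite (bigD1 i)//=; congr (_ + _).
    have [si _] := hs.2 _ (y1 i); rewrite -(fibre_self_energy a (t i) si).
    by apply: eq_bigl => b; rewrite xpair_eqE eqxx.
  apply: eq_bigr => j ji; apply: eq_bigl => b; rewrite xpair_eqE.
  by rewrite (negbTE ji).
transitivity (\sum_(i < r) \sum_(a < k) (- ln k%:R + \sum_(j < r | j != i) \sum_(b < k) F (i, a) (j, b))).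
  by rewrite pair_big/=; apply: eq_bigr => -[i a] _; exact: split_row.
pose g i j (a b : 'I_k) := log_gap (hopf_lift s y t (i, a)) (hopf_lift s y t (j, b)).
have row i : \sum_(a < k) (- ln k%:R + \sum_(j < r | j != i) \sum_(b < k) F (i, a) (j, b)) =
   \sum_(j < r | j != i) \sum_(a < k) \sum_(b < k) g i j a b -
   ((r%:R - 1) * k%:R ^+ 2 * ln 2 + k%:R * ln k%:R).
  rewrite big_split/= sumr_const card_ord exchange_big/=.
  have -> : \sum_(j < r | j != i) \sum_(a < k) \sum_(b < k) g i j a b =
     \sum_(j < r | j != i) (k%:R ^+ 2 * ln 2 + \sum_(a < k) \sum_(b < k) F (i, a) (j, b)).
    apply: eq_bigr => j _; rewrite /g /log_gap.
    under eq_bigr do rewrite big_split/= sumr_const card_ord.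
    rewrite big_split/= sumr_const card_ord -mulrnA -(mulr_natl (ln 2)) natrM; congr (_ * _ + _).
  rewrite big_split/= sumr_const.
  have -> : #|[pred j | j != i]| = r.-1.
    by have := cardC1 i; rewrite card_ord.
  have r0 : (0 < r)%N by case: r i {y t y1 F split_row g} => [[]|].
  rewrite -[(- ln _) *+ _]mulr_natl -[(_ * ln 2) *+ _]mulr_natl -subn1 natrB//; ring.
under eq_bigr do rewrite row.
rewrite sumrB; congr (_ - _); rewrite sumr_const card_ord -mulr_natl; ring.
Qed.

End LiftEnergy.

Lemma ge0_integral_big d (T : measurableType d) (R : realType) (mu : {measure set T -> \bar R})
    (I : Type) (s : seq I) (p : pred I) (f : I -> T -> R) :
  (forall i, measurable_fun setT (f i)) -> (forall i w, 0 <= f i w) ->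
  measurable_fun setT (fun w => \sum_(i <- s | p i) f i w) /\
  (\int[mu]_w (\sum_(i <- s | p i) f i w)%:E = \sum_(i <- s | p i) \int[mu]_w (f i w)%:E)%E.
Proof.
move=> mf f0; split.
  by under eq_fun do rewrite -big_filter; exact: measurable_sum.
under eq_integral do rewrite -big_filter -sumEFin.
rewrite ge0_integral_sum ?big_filter// => [i|i w _]; last by rewrite lee_fin.
exact/measurable_EFinP.
Qed.

Section LiftExpectation.
Context {R : realType}.
Local Notation E := (3.-tuple R).
Variable s : E -> 4.-tuple R.
Hypothesis hs : hopf_section s.
Variables (d : measure_display) (T : measurableType d) (P : probability T R) (L k : nat).
Local Notation r := (L.+1 ^ 2)%N.
Variables (Y : 'I_r -> {RV P >-> E}) (theta : 'I_r -> {RV P >-> R}).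
Hypothesis hY : harmonic_ensemble Y.
Hypothesis htheta : random_phases Y theta.
Local Notation Q := (@legendre_sum R L).

Let pt (w : T) : 'I_r * 'I_k -> 4.-tuple R := hopf_lift s (fun i => Y i w) (fun i => theta i w).

Let pt_sphere w x : unit_sphere 4 (pt w x).
Proof. by apply: unit_sphere_fibre_rot; have [] := hs.2 _ (hY.1 x.1 w). Qed.

Let m_pt x : measurable_fun setT (fun w => pt w x).
Proof.
apply: measurable_fibre_rot.
  by apply: measurable_funD => //; exact: measurable_funP.
rewrite (_ : (fun w => _) = (s \_ (unit_sphere 3)) \o Y x.1); last first.
  by apply/funext => w; rewrite /= patchE ifT// inE; exact: hY.1.
apply: measurableT_comp; last exact: measurable_funP.
by apply/(measurable_restrictT s) => //; [exact: measurable_unit_sphere | exact: hs.1].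
Qed.

Let gap (x z : 'I_r * 'I_k) (w : T) : R := log_gap (pt w x) (pt w z).

Let gap_ge0 x z w : 0 <= gap x z w. Proof. exact: log_gap_ge0. Qed.

Let m_gap x z : measurable_fun setT (gap x z).
Proof.
rewrite (_ : gap x z = fun w => ln 2 - ln (2 - 2 * dot (pt w x) (pt w z)) / 2).
  apply: measurable_funB => //; apply: measurable_funM => //.
  apply: (measurableT_comp (@measurable_ln R)); apply: measurable_funB => //.
  by apply: measurable_funM => //; exact: measurable_dot.
by apply/funext => w; rewrite -log_gap_sphere.
Qed.

Let n : R := L.+1%:R.

(** [G] is nonnegative with finite integral, hence integrable, and the energy differs from it by a
    constant. The shifts cancel the ln 2 term of [harmonic_pair_cost]. *)
Lemma expectation_log_energy_hopf_lift : exists2 J,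
  0 <= J <= pint 0 1 ((Q \Po (1 - 2%:P * 'X ^+ 2)) ^+ 2 * 'X ^+ 2) &
  P.-integrable setT (EFin \o (fun w => log_energy (pt w))) /\
  ('E_P[fun w => log_energy (pt w)] =
    (k%:R ^+ 2 * (J - n ^+ 4 / 4) - n ^+ 2 * k%:R * ln k%:R)%:E)%E.
Proof.
have [J hJ sumJ] := harmonic_pair_cost hY; exists J => //.
pose G w := \sum_(i < r) \sum_(j < r | j != i) \sum_(a < k) \sum_(b < k) gap (i, a) (j, b) w.
pose c : R := (r%:R ^+ 2 - r%:R) * k%:R ^+ 2 * ln 2 + r%:R * k%:R * ln k%:R.
have energyE w : log_energy (pt w) = G w - c.
  by rewrite /pt log_energy_hopf_lift// => i; exact: hY.1.
have g4 i a j := @ge0_integral_big _ T R P _ (index_enum 'I_k) xpredT (fun b => gap (i, a) (j, b))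
  (fun b => m_gap _ _) (fun b => gap_ge0 _ _).
have p4 i a j w : 0 <= \sum_(b < k) gap (i, a) (j, b) w by apply: sumr_ge0.
have g3 i j := @ge0_integral_big _ T R P _ (index_enum 'I_k) xpredT
  (fun a w => \sum_(b < k) gap (i, a) (j, b) w) (fun a => (g4 i a j).1) (fun a => p4 i a j).
have p3 i j w : 0 <= \sum_(a < k) \sum_(b < k) gap (i, a) (j, b) w by apply: sumr_ge0.
have g2 i := @ge0_integral_big _ T R P _ (index_enum 'I_r) (fun j => j != i)
  (fun j w => \sum_(a < k) \sum_(b < k) gap (i, a) (j, b) w) (fun j => (g3 i j).1) (fun j => p3 i j).
have p2 i w : 0 <= \sum_(j < r | j != i) \sum_(a < k) \sum_(b < k) gap (i, a) (j, b) w by apply: sumr_ge0.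
have [mG iG] := @ge0_integral_big _ T R P _ (index_enum 'I_r) xpredT
  (fun i w => \sum_(j < r | j != i) \sum_(a < k) \sum_(b < k) gap (i, a) (j, b) w)
  (fun i => (g2 i).1) (fun i => p2 i).
have G0 w : 0 <= G w by apply: sumr_ge0.
pose V := (n ^+ 4 - n ^+ 2) * ln 2 - n ^+ 4 / 4 + J.
have intG : (\int[P]_w (G w)%:E = (k%:R ^+ 2 * V)%:E)%E.
  rewrite /G iG EFinM -sumJ ge0_sume_distrr; last first.
    move=> i _; apply: sume_ge0 => j _; apply: integral_ge0 => w _; rewrite lee_fin pair_cost_ge0//.
    by have /andP[] := dot_sphere_le1 (hY.1 i w) (hY.1 j w).
  apply: eq_bigr => i _; rewrite (g2 i).2 ge0_sume_distrr; last first.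
    move=> j _; apply: integral_ge0 => w _; rewrite lee_fin pair_cost_ge0//.
    by have /andP[] := dot_sphere_le1 (hY.1 i w) (hY.1 j w).
  apply: eq_bigr => j ji; rewrite (g3 i j).2.
  have ij : i != j by rewrite eq_sym.
  transitivity (\sum_(a < k) \sum_(b < k) \int[P]_w (pair_cost (dot (Y i w) (Y j w)))%:E)%E.
    apply: eq_bigr => a _; rewrite (g4 i a j).2; apply: eq_bigr => b _.
    apply: (phase_mean_log_gap hY.1 htheta hs _ _ ij); exact: harmonic_pair_neq.
  set X := (X in (_ * X)%E); rewrite !big_const_ord.
  have kX (x : \bar R) m : iter m (+%E x) 0%E = (m%:R%:E * x)%E.
    elim: m => [|m IHm]; first by rewrite mul0e.
    by rewrite iterS IHm -natr1 EFinD ge0_muleDl ?lee_fin// mul1e addeC.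
  by rewrite !kX muleA.
have iGr : P.-integrable setT (EFin \o G).
  apply/integrableP; split; first exact/measurable_EFinP.
  by under eq_integral => w _ do rewrite /= ger0_norm//; rewrite intG ltry.
have ic : P.-integrable setT (EFin \o cst c) by exact: finite_measure_integrable_cst.
have energyE' : EFin \o (fun w => log_energy (pt w)) = ((EFin \o G) \- (EFin \o cst c))%E.
  by apply/funext => w; rewrite /= energyE.
rewrite energyE'; split; first exact: integrableB.
rewrite expectation.unlock -[X in (\int[P]_x X x)%E]/(EFin \o (fun w => log_energy (pt w))) energyE'.
have intc : (\int[P]_x (EFin \o cst c) x = c%:E)%E.
  by rewrite -[LHS]/(\int[P]_x cst c%:E x)%E integral_cst// (_ : _ setT = 1%E) ?mule1//; exact: probability_setT.
rewrite integralB// intc [X in (X - _)%E]intG -EFinB; congr (_%:E).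
have rn : r%:R = n ^+ 2 :> R by rewrite natrX.
by rewrite /V /c rn; field.
Qed.

End LiftExpectation.

(** * Asymptotics *)

Section Asymptotics.
Context {R : realType}.

Let ln_le (x : R) : 0 < x -> ln x <= x - 1.
Proof. by move=> x0; have := @le_ln1Dx R (x - 1); rewrite (_ : 1 + (x - 1) = x); [apply; lra | ring]. Qed.

(* [n / (k ln N)] lies between 2/3 and 2, as [n / (4 ln n) <= k <= n / (2 ln n)]
   and [2 ln n <= ln N <= 3 ln n]. *)
Lemma energy_asymptotics (L : nat) (J : R) : (63 <= L)%N ->
  let n : R := L.+1%:R in
  let k := roots_per_fibre R (L.+1 ^ 2) in
  let N : R := (k * L.+1 ^ 2)%:R in
  0 <= J <= 2 * n + 15 * n * ln n ->
  `|k%:R ^+ 2 * (J - n ^+ 4 / 4) - n ^+ 2 * k%:R * ln k%:R -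
    (- (N ^+ 2 / 4) - 1 / 3 * N * ln N + 2 / 3 * N * ln (ln N))| <= 10 * N.
Proof.
move=> L64 n k N /andP[J0 J1].
(* 64 = 2^6 = 8^2: ln 2 >= 1/2 gives ln n >= 1, and sqrt n >= 8 gives 4 ln n <= n through ln (sqrt
   n) <= sqrt n - 1; hence n / (2 ln n) >= 2. *)
have n64 : 64 <= n by rewrite /n ler_nat ltnS.
have n0 : 0 < n by lra.
set l := ln n in J1 *.
have l1 : 1 <= l.
  have h2 : ln 2^-1 <= 2^-1 - 1 :> R by exact: ln_le.
  have : ln (2 ^+ 6) <= l by rewrite ler_ln ?posrE//; apply: le_trans n64; lra.
  by rewrite lnXn// -(mulr_natl (ln 2)); move: h2; rewrite lnV ?posrE//; lra.
have ln4 : 4 * l <= n.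
  pose q := Num.sqrt n; have q2 : q ^+ 2 = n by rewrite sqr_sqrtr// ltW.
  have q0 : 0 < q by rewrite sqrtr_gt0.
  have q8 : 8 <= q by have := n64; rewrite -q2; nra.
  have -> : l = 2 * ln q by rewrite /l -q2 lnXn// mulr_natl.
  by have := ln_le q0; rewrite -q2; nra.
pose x := n / (2 * l).
have xl : x * (2 * l) = n by rewrite divfK//; lra.
have kE : k = Num.truncn x.
  rewrite /k /roots_per_fibre natrX sqrtr_sqr ger0_norm ?(ltW n0)//.
  by rewrite lnXn// -(mulr_natl (ln _)).
have x2 : 2 <= x by nra.
have /andP[k1 k2] : k%:R <= x < k.+1%:R by rewrite kE truncn_itv//; lra.
(* As x >= 2, truncation keeps at least half of x. *)
have K2 : x / 2 <= k%:R by move: k2; rewrite -natr1; lra.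
have NE : N = k%:R * n ^+ 2 by rewrite /N natrM natrX.
set K : R := k%:R in k1 K2 NE *.
have K1 : 1 <= K by lra.
have K0 : 0 < K by lra.
have KlU : K * l <= n / 2 by nra.
have KlL : n / 4 <= K * l by nra.
set M := ln N.
have ME : M = ln K + 2 * l.
  by rewrite /M NE lnM ?posrE ?exprn_gt0// lnXn// mulr_natl.
have lK0 : 0 <= ln K by exact: ln_ge0.
have lKl : ln K <= l by rewrite ler_ln ?posrE//; nra.
have M0 : 0 < M by lra.
have KM0 : 0 < K * M by exact: mulr_gt0.
pose y := n / (K * M).
have yE : y * (K * M) = n by rewrite divfK// gt_eqF.
have y0 : 0 < y by exact: divr_gt0.
have lny : ln y = l - ln K - ln M by rewrite ln_div ?posrE// lnM ?posrE// /l; lra.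
have KMU : K * M <= 3 / 2 * n by nra.
have KML : n / 2 <= K * M by nra.
have y2 : y <= 2 by nra.
have y1 : 2 / 3 <= y by nra.
have yV : y^-1 <= 3 / 2.
  have : y * y^-1 = 1 by rewrite divff// gt_eqF.
  by move: (y^-1) => z yz; nra.
have ly1 : ln y <= 1 by have := ln_le y0; lra.
have ly2 : - ln y <= 1 by have := @ln_le y^-1; rewrite invr_gt0 lnV ?posrE// => /(_ y0); lra.
have N0 : 0 < N by rewrite NE mulr_gt0// exprn_gt0.
(* Since ln N = ln K + 2 ln n, all terms in N ln N, N ln K and N ln ln N combine into (2/3) N ln y,
   where y is bounded above and away from 0. *)
have -> : K ^+ 2 * (J - n ^+ 4 / 4) - n ^+ 2 * K * ln K -
    (- (N ^+ 2 / 4) - 1 / 3 * N * M + 2 / 3 * N * ln M) = K ^+ 2 * J + 2 / 3 * N * ln y.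
  by rewrite lny ME NE; field.
(* As K <= K l <= n / 2, the two terms give n^2 + 15 n^2 / 2; with |ln y| <= 1 the final constant 10
   exceeds 9 + 2/3. *)
have KJ : K * J <= 9 * n ^+ 2.
  have h1 : K * J <= K * (2 * n + 15 * n * l) by rewrite ler_wpM2l// ltW.
  have h2 : n * (K * l) <= n * (n / 2) by rewrite ler_pM2l.
  have h3 : n * K <= n * (n / 2) by rewrite ler_pM2l//; apply: le_trans KlU; rewrite ler_peMr// ltW.
  have h4 : 0 <= n * n by rewrite mulr_ge0// ltW.
  by apply: le_trans h1 _; lra.
have KJ0 : 0 <= K ^+ 2 * J by rewrite mulr_ge0// sqr_ge0.
have KJN : K ^+ 2 * J <= 9 * N.
  by rewrite NE expr2 -mulrA [9 * _]mulrCA ler_wpM2l// ltW.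
have NlU : N * ln y <= N by rewrite ler_piMr// ltW.
have NlL : - (N * ln y) <= N by rewrite -mulrN ler_piMr// ltW.
rewrite -mulrA ler_norml; move: (K ^+ 2 * J) (N * ln y) KJ0 KJN NlU NlL => a b a0 a9 b1 b2.
by apply/andP; split; lra.
Qed.

Lemma eqaddO_eventually (f g N : nat -> R) (C : R) (m : nat) : (forall L, 0 <= N L) ->
  (forall L, (m <= L)%N -> `|f L - g L| <= C * N L) -> f = g +O_\oo N.
Proof.
move=> N0 h; apply/eqaddOP; near=> c.
exists m => // L /= mL; rewrite [`|N L|]ger0_norm//.
by apply: (le_trans (h L mL)); rewrite ler_wpM2r//; near: c; exact: nbhs_pinfty_ge.
Unshelve. all: by end_near. Qed.

End Asymptotics.

Theorem corollary3p9 (R : realType)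
  (s : 3.-tuple R -> 4.-tuple R) (hs : hopf_section s)
  (d : nat -> measure_display) (T : forall L : nat, measurableType (d L))
  (P : forall L : nat, probability (T L) R)
  (Y : forall L : nat, 'I_(L.+1 ^ 2) -> {RV (P L) >-> 3.-tuple R})
  (theta : forall L : nat, 'I_(L.+1 ^ 2) -> {RV (P L) >-> R})
  (hY : forall L : nat, (1 <= L)%N -> harmonic_ensemble (Y L))
  (htheta : forall L : nat, (1 <= L)%N -> random_phases (Y L) (theta L)) :
  let r (L : nat) : nat := (L.+1 ^ 2)%N in
  let k (L : nat) : nat := roots_per_fibre R (r L) in
  let N (L : nat) : R := (k L * r L)%:R in
  let E0 (L : nat) (w : T L) : R :=
    log_energy (@hopf_lift R s (r L) (k L) (fun i => Y L i w)
                                           (fun i => theta L i w)) in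
  (forall L : nat, (1 <= L)%N -> (P L).-integrable setT (EFin \o E0 L)) /\
  (fun L : nat => fine 'E_(P L)[E0 L]%E) =
  (fun L : nat => - (N L ^+ 2 / 4) - 1 / 3 * N L * ln (N L)
                  + 2 / 3 * N L * ln (ln (N L)))
  +O_\oo N.
Proof.
have energy L (hL : (1 <= L)%N) :=
  expectation_log_energy_hopf_lift hs (roots_per_fibre R (L.+1 ^ 2)) (hY L hL) (htheta L hL).
move=> r k N E0; split=> [L L1|]; first by have [J _ []] := energy L L1.
apply: (@eqaddO_eventually _ _ _ N 10 63) => // L L63.
have [J /andP[J0 J1] [_ EJ]] := energy L (leq_trans (isT : (1 <= 63)%N) L63).
have J2 := @pint_legendre_sum_chord R L (leq_trans (isT : (3 <= 63)%N) L63).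
rewrite [fine _](congr1 fine EJ) /=.
by apply: energy_asymptotics L63 _; rewrite J0 (le_trans J1 J2).
Qed.
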